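(* Let $n,m\ge1$, $\lambda\vdash m$, let $\mathcal T$ be a standard Young tableau of shape $\lambda$, and let $I=(i_1\le\cdots\le i_m)$ be an ordered multiset of $\{1,\dots,n\}$ with multiplicities $m_i(I)=\mu_i$. Let $\theta_\mu(\mathcal T)$ be the filling of $\lambda$ obtained from $\mathcal T$ by replacing each entry $r$ by $i_r$, $1\le r\le m$. Then in $(\mathbb{C}^n)^{\otimes m}$ $$\mathcal E^\lambda_{\mathcal T}\cdot(e_{i_1}\otimes\cdots\otimes e_{i_m})=\begin{cases}c\cdot\xi_{\theta_\mu(\mathcal T)}\otimes v_{\mathcal T}&\text{if }\theta_\mu(\mathcal T)\in\mathrm{SSYT}(\lambda,n),\\0&\text{if }\theta_\mu(\mathcal T)\notin\mathrm{SSYT}(\lambda,n),\end{cases}$$ where $c$ is some nonzero constant and $\mathrm{SSYT}(\lambda,n)$ is the set of semistandard Young tableaux of shape $\lambda$ with entries at most $n$.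
   Context: Let $q\in\mathbb{C}^\times$ be not a root of unity (fix $q^{1/2}$); $[k]_q=\frac{q^k-q^{-k}}{q-q^{-1}}$. Hecke algebra: $\mathcal H_m$ is generated by $T_1,\dots,T_{m-1}$ with $(T_i-q)(T_i+q^{-1})=0$, $T_iT_{i+1}T_i=T_{i+1}T_iT_{i+1}$, $T_iT_j=T_jT_i$ for $|i-j|>1$; $T_\sigma$ is the standard basis given by reduced words. Jucys–Murphy elements: $y_1=1$, $y_k=1+(q-q^{-1})\sum_{i<k}T_{(i,k)}$. For $\lambda\vdash m$, $V^\lambda$ is the irreducible $\mathcal H_m$-module with a basis $\{v_{\mathcal T}\}$ (Young basis) indexed by standard Young tableaux of shape $\lambda$ such that $y_kv_{\mathcal T}=q^{2c_k(\mathcal T)}v_{\mathcal T}$, $c_k(\mathcal T)=j-i$ if $k$ occupies box $(i,j)$. $c_\lambda=\prod_{\alpha\in\lambda}q^{c(\alpha)}[h(\alpha)]_q$ (contents $c(\alpha)$, hook lengths $h(\alpha)$), and $\mathcal E^\lambda_{\mathcal T}=\frac1{c_\lambda}\sum_{\sigma\in\mathfrak S_m}\langle T_{\sigma^{-1}}v_{\mathcal T},v_{\mathcal T}\rangle T_\sigma$, where $\langle T_{\sigma^{-1}}v_{\mathcal T},v_{\mathcal T}\rangle$ is the coefficient of $v_{\mathcal T}$ in $T_{\sigma^{-1}}v_{\mathcal T}$; it is a primitive idempotent. $\mathcal H_m$ acts on $(\mathbb{C}^n)^{\otimes m}$ by $T_k\mapsto\check R_k$, $\check R=q\sum_i e_{ii}\otimes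 e_{ii}+\sum_{i\ne j}e_{ij}\otimes e_{ji}+(q-q^{-1})\sum_{i>j}e_{ii}\otimes e_{jj}$ acting in factors $k,k+1$. $U_q(\mathfrak{gl}_n)$ (standard generators $E_i,F_i,q^{\pm\varepsilon_i/2}$) acts on $\mathbb{C}^n$ by $q^{\varepsilon_i/2}e_j=q^{\delta_{ij}/2}e_j$, $E_ie_j=\delta_{j,i+1}e_i$, $F_ie_j=\delta_{ij}e_{i+1}$, and on tensors by $\Delta(q^{\pm\varepsilon_i/2})=q^{\pm\varepsilon_i/2}\otimes q^{\pm\varepsilon_i/2}$, $\Delta(Y)=Y\otimes q^{(\varepsilon_i-\varepsilon_{i+1})/2}+q^{-(\varepsilon_i-\varepsilon_{i+1})/2}\otimes Y$ for $Y=E_i,F_i$. This action commutes with $\mathcal H_m$ and $(\mathbb{C}^n)^{\otimes m}\cong\bigoplus_{\lambda\vdash m,\ \ell(\lambda)\le n}U^\lambda\otimes V^\lambda$ (Schur–Weyl–Jimbo duality), $U^\lambda$ the simple module of highest weight $\lambda$. $U_q(\mathfrak{gl}_k)\subset U_q(\mathfrak{gl}_n)$ is generated by $E_i,F_i$ ($i<k$) and $q^{\pm\varepsilon_i/2}$ ($i\le k$). Gelfand–Tsetlin basis: $U^\lambda$ has a basis $\{\xi_\Lambda\}$ indexed by Gelfand–Tsetlin patterns $\Lambda=(\lambda_{ij})_{1\le j\le i\le n}$ with top row $\lambda_{nj}=\lambda_j$ and $\lambda_{ij}\ge\lambda_{i-1,j}\ge\lambda_{i,j+1}$; $\xi_\Lambda$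 is characterized up to scalar by lying, for each $k=1,\dots,n$, in a simple $U_q(\mathfrak{gl}_k)$-submodule of highest weight $(\lambda_{k1},\dots,\lambda_{kk})$. Semistandard tableaux $S$ of shape $\lambda$ with entries in $\{1,\dots,n\}$ correspond bijectively to patterns $\Lambda(S)$ by $\lambda_{ij}=$ number of entries $\le i$ in row $j$ of $S$; write $\xi_S=\xi_{\Lambda(S)}$. Via the duality decomposition, the line in $(\mathbb{C}^n)^{\otimes m}$ spanned by $\xi_\Lambda\otimes v_{\mathcal T}$ consists of the $w$ with $y_kw=q^{2c_k(\mathcal T)}w$ for $1\le k\le m$ and lying, for every $1\le k\le n$, in the sum of all simple $U_q(\mathfrak{gl}_k)$-submodules of highest weight $(\lambda_{k1},\dots,\lambda_{kk})$. *)

(* Defs.v *)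
From HB Require Import structures.
From mathcomp Require Import all_boot all_order all_fingroup all_algebra.
From mathcomp Require Import zify.

Set Implicit Arguments.
Unset Strict Implicit.
Unset Printing Implicit Defensive.

Import GRing.Theory.
Local Open Scope ring_scope.

(* Conventions.  Indices are 0-based: the generators T_1, ..., T_(m-1) and
   E_1, ..., E_(n-1) are indexed by 'I_m.-1 and 'I_n.-1, tensor factors and
   tableau entries 1, ..., m by 'I_m, and basis vectors e_1, ..., e_n by 'I_n.
   The level k of gl_k is kept 1-based. *)

Section Adjacent.
Variable m : nat.

Lemma adj_hi_subproof (i : 'I_m.-1) : (i.+1 < m)%N.
Proof. by case: i => i /=; lia. Qed.

Definition adj_lo (i : 'I_m.-1) : 'I_m := Ordinal (ltnW (adj_hi_subproof i)).
Definition adj_hi (i : 'I_m.-1) : 'I_m := Ordinal (adj_hi_subproof i).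
Definition adj_tperm (i : 'I_m.-1) : 'S_m := tperm (adj_lo i) (adj_hi i).

(* [(s * t) x = t (s x)] in MathComp, so this is the composition of functions
   s_(i_1) \o ... \o s_(i_l) for w = [:: i_1; ...; i_l]. *)
Definition word_perm (w : seq 'I_m.-1) : 'S_m :=
  foldr (fun i u => (u * adj_tperm i)%g) 1%g w.

Definition inv_set (s : 'S_m) : {set 'I_m * 'I_m} :=
  [set p : 'I_m * 'I_m | (p.1 < p.2)%N && (s p.2 < s p.1)%N].

Definition perm_length (s : 'S_m) : nat := #|inv_set s|.

Lemma word_perm_rcons w i :
  word_perm (rcons w i) = (adj_tperm i * word_perm w)%g.
Proof.
elim: w => [|j w IH] /=; first by rewrite mul1g mulg1.
by rewrite IH mulgA.
Qed.

Lemma adj_tperm_lt (i : 'I_m.-1) (x y : 'I_m) :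
  (x < y)%N -> (x, y) != (adj_lo i, adj_hi i) ->
  (adj_tperm i x < adj_tperm i y)%N.
Proof.
rewrite /adj_tperm => xy; rewrite xpair_eqE negb_and => ne.
case: tpermP => [ex|ex|/eqP nx1 /eqP nx2];
  case: tpermP => [ey|ey|/eqP ny1 /eqP ny2];
  move: ne xy; rewrite -?ex -?ey ?ex ?ey -?val_eqE /=; try lia.
all: move: nx1 nx2 || move: ny1 ny2; rewrite -?val_eqE /=; lia.
Qed.

Lemma perm_length_descent (s : 'S_m) (i : 'I_m.-1) :
  (s (adj_hi i) < s (adj_lo i))%N ->
  perm_length s = (perm_length (adj_tperm i * s)%g).+1.
Proof.
move=> desc; rewrite /perm_length.
have pin : (adj_lo i, adj_hi i) \in inv_set s by rewrite inE /= ltnSn desc.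
rewrite (cardsD1 (adj_lo i, adj_hi i)) pin add1n; congr _.+1.
pose f (p : 'I_m * 'I_m) := (adj_tperm i p.1, adj_tperm i p.2).
have fK : involutive f by case=> x y; rewrite /f /= !tpermK.
rewrite -(card_imset (inv_set (adj_tperm i * s)%g) (inv_inj fK)); apply: eq_card => -[x y].
apply/idP/imsetP => [|[[a b]]].
- rewrite !inE /= => /and3P[ne xy sxy]; exists (f (x, y)); last by rewrite fK.
  by rewrite inE /= !permM !tpermK sxy adj_tperm_lt.
- rewrite inE /= !permM => /andP[ab sab] ->; rewrite !inE /=.
  have ne : (a, b) != (adj_lo i, adj_hi i).
    apply/eqP => -[ea eb]; move: sab; rewrite ea eb /adj_tperm tpermL tpermR.
    by rewrite ltnNge (ltnW desc).
  rewrite sab adj_tperm_lt // !andbT; apply/eqP => e.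
  have /= [ea eb] : (a, b) = f (adj_lo i, adj_hi i) by rewrite -e -/(f (a, b)) fK.
  by move: ab; rewrite ea eb /adj_tperm tpermL tpermR /=; lia.
Qed.

Lemma perm_no_descent (s : 'S_m) :
  (forall i, s (adj_lo i) <= s (adj_hi i))%N -> s = 1%g.
Proof.
move=> nd.
have step (x y : 'I_m) : y = x.+1 :> nat -> (s x < s y)%N.
  move=> yx; have lx : (x < m.-1)%N by case: (y) yx => /= ? ? ?; lia.
  have -> : x = adj_lo (Ordinal lx) by apply/val_inj.
  have -> : y = adj_hi (Ordinal lx) by apply/val_inj.
  rewrite ltn_neqAle nd andbT (inj_eq val_inj) (inj_eq perm_inj) -val_eqE /=.
  by lia.
have ge (x : 'I_m) : (x <= s x)%N.
  case: x => x; elim: x => [|x IH] //= lx.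
  apply: leq_ltn_trans (IH (ltnW lx)) _.
  exact: (step (Ordinal (ltnW lx)) (Ordinal lx)).
have sumE : (\sum_(x : 'I_m) x = \sum_(x : 'I_m) s x)%N.
  by rewrite (reindex_inj (@perm_inj _ s)).
have := leqif_sum (fun (x : 'I_m) (_ : true) => leqif_eq (ge x)).
move=> [_]; rewrite sumE eqxx => /esym/forallP h.
by apply/permP => x; rewrite perm1; apply/val_inj/esym/eqP; exact: h.
Qed.

Lemma reduced_word_exists (s : 'S_m) :
  exists w : (perm_length s).-tuple 'I_m.-1, word_perm w == s.
Proof.
suff [w sw ws] : exists2 w, size w = perm_length s & word_perm w = s.
  by exists (Tuple (introT eqP sw)); rewrite /= ws.
have [l] := ubnP (perm_length s); elim: l s => // l IH s le.
have [/existsP[i desc]|] :=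
  boolP [exists i, (s (adj_hi i) < s (adj_lo i))%N]; last first.
  rewrite negb_exists => /forallP nd.
  have -> : s = 1%g by apply: perm_no_descent => i; rewrite leqNgt nd.
  exists [::] => //; apply/esym/eqP; rewrite cards_eq0.
  by apply/eqP/setP => -[x y]; rewrite !inE /= !perm1; lia.
have lE := perm_length_descent desc.
have [|w sw ws] := IH (adj_tperm i * s)%g; first by rewrite -ltnS -lE.
exists (rcons w i); first by rewrite size_rcons sw lE.
by rewrite word_perm_rcons ws mulgA /adj_tperm tperm2 mul1g.
Qed.

Definition reduced_word (s : 'S_m) : seq 'I_m.-1 :=
  xchoose (reduced_word_exists s).

End Adjacent.

Section Submodules.
Variables (F : fieldType) (V : vectType F) (A : 'End(V) -> Prop).

Definition stable_sub (W : {vspace V}) : Prop :=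
  forall f, A f -> (f @: W <= W)%VS.

Definition simple_sub (W : {vspace V}) : Prop :=
  [/\ W != 0%VS, stable_sub W &
      forall W' : {vspace V}, stable_sub W' -> (W' <= W)%VS ->
        W' = 0%VS \/ W' = W].

End Submodules.

(* An H_m-module is a vector space V with a family rho of endomorphisms
   satisfying the defining relations of H_m. *)
Section Hecke.
Variables (F : fieldType) (q : F) (m : nat) (V : vectType F).
Variable rho : 'I_m.-1 -> 'End(V).

Definition hecke_module : Prop :=
  [/\ forall i, ((rho i - q *: \1) \o (rho i + q^-1 *: \1) = 0)%VF,
      forall i j : 'I_m.-1, j = i.+1 :> nat ->
        (rho i \o (rho j \o rho i) = rho j \o (rho i \o rho j))%VF &
      forall i j : 'I_m.-1, (i.+1 < j)%N || (j.+1 < i)%N ->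
        (rho i \o rho j = rho j \o rho i)%VF].

Definition hecke_irreducible : Prop :=
  simple_sub (fun f => exists i, f = rho i) fullv.

(* The action of the standard basis element T_s. *)
Definition hecke_T (s : 'S_m) : 'End(V) :=
  foldr (fun i f => (rho i \o f)%VF) \1%VF (reduced_word s).

(* An element \sum_s (a s) T_s of H_m is given by its coefficients a. *)
Definition hecke_act (a : 'S_m -> F) : 'End(V) :=
  \sum_(s : 'S_m) a s *: hecke_T s.

Definition jucys_murphy (k : 'I_m) : 'End(V) :=
  \1%VF + (q - q^-1) *: \sum_(i < m | (i < k)%N) hecke_T (tperm i k).

End Hecke.

Definition is_partition_of (m : nat) (la : seq nat) : bool :=
  [&& sorted geq la, 0%N \notin la & sumn la == m].

Section Tableaux.
Variable la : seq nat.

Definition box : finType := {i : 'I_(size la) & 'I_(nth 0%N la i)}.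

Definition box_row (b : box) : nat := tag b.
Definition box_col (b : box) : nat := tagged b.

Definition content (b : box) : int := (box_col b)%:Z - (box_row b)%:Z.

(* The hook of b contains b itself. *)
Definition hook_length (b : box) : nat :=
  #|[set b' : box | (box_row b' == box_row b) && (box_col b <= box_col b')%N
       || (box_col b' == box_col b) && (box_row b < box_row b')%N]|.

Definition rows_rel p (r : rel nat) (S : {ffun box -> 'I_p}) : bool :=
  [forall b, forall b' : box,
    (box_row b == box_row b') && (box_col b < box_col b')%N ==> r (S b) (S b')].

Definition cols_rel p (r : rel nat) (S : {ffun box -> 'I_p}) : bool :=
  [forall b, forall b' : box,
    (box_col b == box_col b') && (box_row b < box_row b')%N ==> r (S b) (S b')].

Definition is_ssyt n (S : {ffun box -> 'I_n}) : bool :=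
  rows_rel leq S && cols_rel ltn S.

(* For la a partition of m, there are m boxes and injective means bijective. *)
Definition is_syt m (T : {ffun box -> 'I_m}) : bool :=
  [&& injectiveb T, rows_rel ltn T & cols_rel ltn T].

Definition syt m : finType := {T : {ffun box -> 'I_m} | is_syt T}.

(* theta_mu(T), with mu the vector of multiplicities of the multiset I. *)
Definition theta n m (I : m.-tuple 'I_n) (T : syt m) : {ffun box -> 'I_n} :=
  [ffun b => tnth I (val T b)].

(* The entry lambda_(k,j+1) of the pattern Lambda(S): the number of entries
   at most k (in 1-based value) in row j of S. *)
Definition gt_pattern n (S : {ffun box -> 'I_n}) (k j : nat) : nat :=
  #|[set b : box | (box_row b == j) && (S b < k)%N]|.

End Tableaux.

Section YoungModule.
Variables (F : fieldType) (q : F) (m : nat) (la : seq nat).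

Definition qint (k : nat) : F := (q ^+ k - q ^- k) / (q - q^-1).

Definition c_la : F :=
  \prod_(b : box la) (q ^ content b * qint (hook_length b)).

(* The box b is occupied in T by k = T b, so c_k(T) = content b. *)
Definition jm_eigenvector (V : vectType F) (rho : 'I_m.-1 -> 'End(V))
    (T : syt la m) (x : V) : Prop :=
  forall b : box la,
    jucys_murphy q rho (val T b) x = q ^ (2 * content b) *: x.

(* V is the module V^lambda and v its Young basis. *)
Definition young_module (V : vectType F) (rho : 'I_m.-1 -> 'End(V))
    (v : syt la m -> V) : Prop :=
  [/\ hecke_module q rho, hecke_irreducible rho,
      basis_of fullv (codom_tuple v) &
      forall T, jm_eigenvector rho T (v T)].

(* The coefficients of the idempotent E^lambda_T in the basis (T_s). *)
Definition young_idempotent (V : vectType F) (rho : 'I_m.-1 -> 'End(V))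
    (v : syt la m -> V) (T : syt la m) (s : 'S_m) : F :=
  c_la^-1 *
  coord (codom_tuple v) (enum_rank T) (hecke_T rho s^-1%g (v T)).

End YoungModule.

(* The tensor power (F^n)^{\otimes m}, as functions on the words J of length m;
   e_J stands for e_(j_1) \otimes ... \otimes e_(j_m). *)
Definition tens (F : fieldType) (n m : nat) : vectType F :=
  {ffun m.-tuple 'I_n -> F^o}.

Section TensorSpace.
Variables (F : fieldType) (n m : nat).

Definition tens_basis (J : m.-tuple 'I_n) : tens F n m :=
  [ffun K => (K == J)%:R].

(* A_0 \otimes ... \otimes A_(m-1), where A e_j = \sum_i A i j e_i. *)
Definition tens_op_fun (A : 'I_m -> 'M[F]_n) (w : tens F n m) : tens F n m :=
  [ffun J : m.-tuple 'I_n =>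
    \sum_(K : m.-tuple 'I_n) (\prod_(r < m) A r (tnth J r) (tnth K r)) * w K].

Fact tens_op_is_linear A : linear (tens_op_fun A).
Proof.
move=> a u w; apply/ffunP => J; rewrite !ffunE scaler_sumr -big_split /=.
by apply: eq_bigr => K _; rewrite !ffunE mulrDr [a *: _]/(a * _) mulrCA.
Qed.

HB.instance Definition _ A :=
  GRing.isLinear.Build F (tens F n m) (tens F n m) *:%R (tens_op_fun A)
    (tens_op_is_linear A).

Definition tens_op (A : 'I_m -> 'M[F]_n) : 'End(tens F n m) :=
  linfun (tens_op_fun A).

Definition tens_op2 (k : 'I_m.-1) (A B : 'M[F]_n) : 'End(tens F n m) :=
  tens_op (fun r => if r == adj_lo k then A
                    else if r == adj_hi k then B else 1%:M).

Definition Rcheck (q : F) (k : 'I_m.-1) : 'End(tens F n m) :=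
  q *: (\sum_i tens_op2 k (delta_mx i i) (delta_mx i i))
  + \sum_i \sum_(j | i != j) tens_op2 k (delta_mx i j) (delta_mx j i)
  + (q - q^-1) *:
      \sum_(i : 'I_n) \sum_(j : 'I_n | (j < i)%N)
        tens_op2 k (delta_mx i i) (delta_mx j j).

End TensorSpace.

Section QuantumGroup.
(* qh stands for q^(1/2). *)
Variables (F : fieldType) (qh : F) (n m : nat).

(* The action of q^(eps_i/2) (c = qh) or q^(-eps_i/2) (c = qh^-1) on F^n. *)
Definition Keps (c : F) (i : 'I_n) : 'M[F]_n :=
  diag_mx (\row_j (if j == i then c else 1)).

(* q^((eps_i - eps_(i+1))/2) and its inverse. *)
Definition Kalpha (i : 'I_n.-1) : 'M[F]_n :=
  Keps qh (adj_lo i) *m Keps qh^-1 (adj_hi i).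
Definition KalphaV (i : 'I_n.-1) : 'M[F]_n :=
  Keps qh^-1 (adj_lo i) *m Keps qh (adj_hi i).

(* Iterating Delta(Y) = Y \otimes K + K^-1 \otimes Y yields
   \sum_p K^-1 \otimes ... \otimes K^-1 \otimes Y \otimes K \otimes ... \otimes K
   with Y in the factor p. *)
Definition coprod (i : 'I_n.-1) (Y : 'M[F]_n) : 'End(tens F n m) :=
  \sum_(p < m) tens_op (fun r => if (r < p)%N then KalphaV i
                                 else if r == p then Y else Kalpha i).

Definition Uq_E (i : 'I_n.-1) : 'End(tens F n m) :=
  coprod i (delta_mx (adj_lo i) (adj_hi i)).
Definition Uq_F (i : 'I_n.-1) : 'End(tens F n m) :=
  coprod i (delta_mx (adj_hi i) (adj_lo i)).
Definition Uq_K (i : 'I_n) : 'End(tens F n m) := tens_op (fun=> Keps qh i).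
Definition Uq_KV (i : 'I_n) : 'End(tens F n m) := tens_op (fun=> Keps qh^-1 i).

(* The generators of the subalgebra U_q(gl_k). *)
Inductive Uq_gl (k : nat) : 'End(tens F n m) -> Prop :=
| Uq_gl_E (i : 'I_n.-1) of (i.+1 < k)%N : Uq_gl k (Uq_E i)
| Uq_gl_F (i : 'I_n.-1) of (i.+1 < k)%N : Uq_gl k (Uq_F i)
| Uq_gl_K (i : 'I_n) of (i < k)%N : Uq_gl k (Uq_K i)
| Uq_gl_KV (i : 'I_n) of (i < k)%N : Uq_gl k (Uq_KV i).

Definition highest_weight_vector (k : nat) (nu : nat -> nat)
    (u : tens F n m) : Prop :=
  [/\ u != 0,
      forall i : 'I_n.-1, (i.+1 < k)%N -> Uq_E i u = 0 &
      forall i : 'I_n, (i < k)%N -> Uq_K i u = qh ^+ nu i *: u].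

Definition simple_highest_weight (k : nat) (nu : nat -> nat)
    (W : {vspace tens F n m}) : Prop :=
  simple_sub (Uq_gl k) W /\
  exists2 u, u \in W & highest_weight_vector k nu u.

(* x lies in the sum of all simple submodules of highest weight nu. *)
Definition in_isotypic (k : nat) (nu : nat -> nat) (x : tens F n m) : Prop :=
  exists2 Ws : seq {vspace tens F n m},
    forall W, W \in Ws -> simple_highest_weight k nu W &
    x \in (\sum_(W <- Ws) W)%VS.

(* The line spanned by xi_S \otimes v_T. *)
Definition in_xi_line (q : F) (la : seq nat)
    (S : {ffun box la -> 'I_n}) (T : syt la m) (x : tens F n m) : Prop :=
  jm_eigenvector q (@Rcheck F n m q) T x /\
  forall k, (0 < k <= n)%N -> in_isotypic k (gt_pattern S k) x.

(* x is a vector xi_S \otimes v_T, which is defined up to a nonzero scalar. *)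
Definition is_xi_tensor_v (q : F) (la : seq nat)
    (S : {ffun box la -> 'I_n}) (T : syt la m) (x : tens F n m) : Prop :=
  x != 0 /\ forall w, in_xi_line q S T w <-> exists a : F, w = a *: x.

End QuantumGroup.

(* Main.v *)
(* For a functional g on V the elements X(x, g) = sum_s g(T_(s^-1) x) T_s satisfy
   h X(x, g) = X(h x, g) and X(x, g) h = X(x, g h) for h in the Hecke algebra, so
   that c_lambda E_T = X(v_T, f_T), where (f_T) is the basis dual to (v_T).

   Put w = X(v_T, f_T) e_I. If T_i e_I = q e_I, then X(x, g T_i) e_I = q X(x, g) e_I.
   By the seminormal form, X(x, f_T) e_I vanishes together with X(x, f_T') e_I
   whenever T and T' have the same image under theta_mu, and it vanishes if i and
   i + 1 with i_i = i_(i+1) are in one column of T; such a T' exists when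
   theta_mu(T) has a repeated entry in a column. Otherwise the coefficient of e_I
   in w is sum_s q^(l(s)) f_T(T_s v_T) over the stabilizer of I, which is shown to
   be nonzero by merging the colours i_1, ..., i_m one position at a time.

   A highest weight vector for U_q(gl_k) in a generalized joint eigenspace of the
   Jucys-Murphy elements with the contents of a tableau U has weight the shape of
   U and is unique up to a scalar. With the contravariant form this makes the part
   of the eigenspace with letters <= k zero or simple of that highest weight.
   The elements X(x, f_T) kill the other generalized eigenspaces, also those of
   the first p Jucys-Murphy elements; applied to the first p letters of e_I, those
   <= k, this puts w into the isotypic component of U_q(gl_k) prescribed by T.

   Conversely, if x spans the line of xi_S (x) v_T, then x is a multiple of
   X(v_T, f_T) x. The map u |-> X(u, f_T) x is a Hecke homomorphism, and comparing
   the highest weights of the parts of X(v_U, f_T) x along the end of the word I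
   shows that the coefficient of e_I in it is zero unless theta_mu(U) =
   theta_mu(T). Hence this coefficient is, as a function of u, proportional to the
   one of X(u, f_T) e_I, and a homomorphism into the span of the permutations of I
   is determined by its coefficient at e_I. *)
From HB Require Import structures.
Require Import Defs.
From mathcomp Require Import all_boot all_order all_fingroup all_algebra.
From mathcomp Require Import zify ring.

Set Implicit Arguments.
Unset Strict Implicit.
Unset Printing Implicit Defensive.

Import GRing.Theory.
Local Open Scope ring_scope.

(** Only one irreducible module with its eigenbasis is given, so on the tensor space the
    Jucys-Murphy operators have to be treated as possibly non-diagonalizable: simple submodules for
    U_q(gl_k) are found inside joint generalized eigenspaces. The form on the tensor space is
    bilinear over a field without positivity, hence the non-vanishing of (u, u) at a highest weight
    vector u has to be deduced from the uniqueness of u.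

    For the same reason the sum over the stabilizer of I might cancel. Adding one position to a
    colour class splits the sum over cosets; on a suitably chosen tableau with the same coloured
    filling as T the parts form a geometric series in q^2, which is non-zero because q is not a root
    of unity. Choosing another tableau is harmless: a functional phi with phi (T_i x) = q phi (x)
    for all i, i + 1 of equal colour vanishes on all or on none of the Young basis vectors with a
    given coloured filling. *)

Ltac split_ifs :=
  repeat match goal with |- context [if ?b then _ else _] =>
    lazymatch b with context [if _ then _ else _] => fail | _ => case: (boolP b) => ? end
  end.

(** * Lengths and descents of permutations *)

Section PermLength.
Variable m : nat.
Implicit Types (s : 'S_m) (i : 'I_m.-1).

Lemma adj_tpermK i s : (adj_tperm i * (adj_tperm i * s))%g = s.
Proof. by rewrite mulgA /adj_tperm tperm2 mul1g. Qed.

Lemma adj_tpermKr i s : (s * adj_tperm i * adj_tperm i)%g = s.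
Proof. by rewrite -mulgA /adj_tperm tperm2 mulg1. Qed.

Lemma adj_tpermV i : ((adj_tperm i)^-1)%g = adj_tperm i.
Proof. by rewrite /adj_tperm tpermV. Qed.

Lemma val_adj_tperm i (x : 'I_m) : adj_tperm i x = (if (x : nat) == (i : nat) then i.+1
  else if (x : nat) == i.+1 then (i : nat) else (x : nat))%N :> nat.
Proof.
rewrite /adj_tperm; case: tpermP => [->|->|/eqP + /eqP]; rewrite -?val_eqE /=.
- by rewrite eqxx.
- by rewrite gtn_eqF // eqxx.
- by move=> /negPf-> /negPf->.
Qed.

Lemma adj_lo_neq_hi i : adj_lo i != adj_hi i.
Proof. by rewrite -val_eqE /= neq_ltn ltnSn. Qed.

Lemma descentN s i : (s (adj_hi i) < s (adj_lo i))%N = ~~ (s (adj_lo i) < s (adj_hi i))%N.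
Proof.
have := adj_lo_neq_hi i; rewrite -(inj_eq (@perm_inj _ s)) -val_eqE /=.
by case: ltngtP.
Qed.

Lemma perm_length_ascent s i :
  (s (adj_lo i) < s (adj_hi i))%N ->
  perm_length (adj_tperm i * s)%g = (perm_length s).+1.
Proof.
move=> asc; rewrite (@perm_length_descent _ _ i) ?adj_tpermK //.
by rewrite !permM /adj_tperm tpermL tpermR.
Qed.

Lemma perm_lengthV s : perm_length s^-1%g = perm_length s.
Proof.
rewrite /perm_length.
pose f (p : 'I_m * 'I_m) := (s p.2, s p.1).
have finj : injective f by case=> a b [c d] [] /perm_inj-> /perm_inj->.
rewrite -[RHS](card_imset _ finj); apply: eq_card => -[x y].
apply/idP/imsetP => [|[[a b]]].
  rewrite !inE /= => /andP[xy yx]; exists (s^-1 y, s^-1 x)%g; last by rewrite /f /= !permKV.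
  by rewrite inE /= !permKV yx xy.
by rewrite !inE /= => /andP[ab ba] [-> ->]; rewrite !permK ba ab.
Qed.

Lemma perm_length1 : perm_length (1%g : 'S_m) = 0%N.
Proof. by apply/eqP; rewrite cards_eq0; apply/eqP/setP => -[x y]; rewrite !inE /= !perm1; lia. Qed.

Lemma perm_length_ltS s i : (perm_length (adj_tperm i * s)%g <= (perm_length s).+1)%N.
Proof.
have [asc|] := boolP (s (adj_lo i) < s (adj_hi i))%N; first by rewrite perm_length_ascent.
by rewrite -descentN => /perm_length_descent->; lia.
Qed.

Lemma perm_length_word (w : seq 'I_m.-1) : (perm_length (word_perm w) <= size w)%N.
Proof.
elim/last_ind: w => [|w i IH]; first by rewrite /= perm_length1.
by rewrite word_perm_rcons size_rcons; have := perm_length_ltS (word_perm w) i; lia.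
Qed.

Lemma reduced_wordP s : word_perm (reduced_word s) = s.
Proof. by apply/eqP; exact: (xchooseP (reduced_word_exists s)). Qed.

End PermLength.

(** * The standard basis of the Hecke algebra and its multiplication rules *)

Section HeckeModule.
Variables (F : fieldType) (q : F) (q0 : q != 0) (m : nat) (V : vectType F).
Variables (rho : 'I_m.-1 -> 'End(V)) (H : hecke_module q rho).
Local Notation dq := (q - q^-1).

Lemma hecke_quad i x : rho i (rho i x) = x + dq *: rho i x.
Proof.
have [/(_ i) /lfunP/(_ x) e _ _] := H; move: e.
rewrite !(comp_lfunE, add_lfunE, opp_lfunE, scale_lfunE, id_lfunE, zero_lfunE) linearD linearZ /= !scalerDr !scalerA mulfV // scale1r.
rewrite opprD addrA => /eqP; rewrite subr_eq add0r => /eqP.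
by move=> {2}<-; rewrite scalerBl addrA subrK addrK.
Qed.

Lemma hecke_braid (i j : 'I_m.-1) x : j = i.+1 :> nat ->
  rho i (rho j (rho i x)) = rho j (rho i (rho j x)).
Proof. by have [_ h _] := H; move=> /h /lfunP /(_ x); rewrite !comp_lfunE. Qed.

Lemma hecke_comm (i j : 'I_m.-1) x : (i.+1 < j)%N || (j.+1 < i)%N ->
  rho i (rho j x) = rho j (rho i x).
Proof. by have [_ _ h] := H; move=> /h /lfunP /(_ x); rewrite !comp_lfunE. Qed.

Definition word_op (w : seq 'I_m.-1) : 'End(V) :=
  foldr (fun i f => (rho i \o f)%VF) \1%VF w.

Lemma word_op_rcons w i x : word_op (rcons w i) x = word_op w (rho i x).
Proof. by elim: w => [|j w IH] /=; rewrite comp_lfunE ?id_lfunE // IH comp_lfunE. Qed.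

(** Matsumoto's theorem, by induction on the length. If the words end in i and j, both are descents
    of s, so s has reduced words ending in either reduced word of the longest element of the
    subgroup generated by s_i and s_j. The induction hypothesis leads to such words, and one
    commutation or braid relation connects them. *)
Lemma word_op_reduced w w' : word_perm w = word_perm w' ->
  size w = perm_length (word_perm w) -> size w' = perm_length (word_perm w) ->
  forall x, word_op w x = word_op w' x.
Proof.
elim: {w}(size w) {-2}w (erefl (size w)) w' => [|l IH] w sw w' e rw rw' x.
  by move: rw'; rewrite -rw sw => /eqP/nilP->; move/eqP/nilP: sw => ->.
have l0 : (0 < perm_length (word_perm w))%N by rewrite -rw sw.
case/lastP: w sw e rw rw' l0 => // u i; rewrite size_rcons => -[su].
case/lastP: w' => [|u' j]; first by move=> _ _ <-.
set s := word_perm (rcons u i); move=> e; rewrite !size_rcons => rw rw' l0.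
have eu : word_perm u = (adj_tperm i * s)%g by rewrite /s word_perm_rcons adj_tpermK.
have eu' : word_perm u' = (adj_tperm j * s)%g by rewrite e word_perm_rcons adj_tpermK.
have lu := perm_length_word u; have lu' := perm_length_word u'.
have desc (k : 'I_m.-1) (z : seq 'I_m.-1) : word_perm z = (adj_tperm k * s)%g ->
    (size z).+1 = perm_length s -> (s (adj_hi k) < s (adj_lo k))%N.
  move=> ez rz; rewrite descentN; apply/negP => /perm_length_ascent.
  by have := perm_length_word z; rewrite ez; lia.
have di := desc _ _ eu rw; have dj := desc _ _ eu' rw'.
have li := perm_length_descent di; have lj := perm_length_descent dj.
rewrite !word_op_rcons.
have [ij|ij] := eqVneq i j.
  by subst j; apply: IH; rewrite ?eu ?eu' //; lia.
have red (t : 'S_m) : exists2 w, word_perm w = t & size w = perm_length t.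
  by have [w /eqP] := reduced_word_exists t; exists w; rewrite ?size_tuple.
(* A reduced word of s ending with i (resp. j) may be replaced by any other
   such word, so it suffices to compare two words ending with i and j. *)
have repl k (z z' : seq 'I_m.-1) : word_perm z = (adj_tperm k * s)%g ->
    (size z).+1 = perm_length s -> word_perm z' = (adj_tperm k * s)%g ->
    size z' = size z -> forall y, word_op z y = word_op z' y.
  move=> ez sz ez' sz'; have dk := desc _ _ ez sz; have lk := perm_length_descent dk.
  by apply: IH; rewrite ?ez ?ez' //; lia.
have far (a b : 'I_m.-1) : (a.+1 < b)%N -> (adj_tperm a * adj_tperm b = adj_tperm b * adj_tperm a)%g.
  move=> ab; apply/permP => y; rewrite !permM.
  by apply: val_inj; rewrite /= !val_adj_tperm; split_ifs; lia.
case: (boolP ((i.+1 < j)%N || (j.+1 < i)%N)) => [fij|nfij].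
  have cij : (adj_tperm i * adj_tperm j = adj_tperm j * adj_tperm i)%g.
    by case/orP: fij => [/far|/far->].
  have dji : ((adj_tperm i * s)%g (adj_hi j) < (adj_tperm i * s)%g (adj_lo j))%N.
    by rewrite !permM /adj_tperm !tpermD // -!val_eqE /=; move: fij ij; rewrite -val_eqE /=; lia.
  have lji := perm_length_descent dji.
  have [w ew sw] := red (adj_tperm j * (adj_tperm i * s))%g.
  rewrite (repl i u (rcons w j)) //; first last.
  - by rewrite size_rcons; lia.
  - by rewrite word_perm_rcons ew adj_tpermK.
  rewrite (repl j u' (rcons w i)) //; first last.
  - by rewrite size_rcons; lia.
  - by rewrite word_perm_rcons ew !mulgA cij -!mulgA adj_tpermK.
  by rewrite !word_op_rcons hecke_comm // orbC.
have key (a b : 'I_m.-1) (z z' : seq 'I_m.-1) : b = a.+1 :> nat ->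
   word_perm z = (adj_tperm a * s)%g -> word_perm z' = (adj_tperm b * s)%g ->
   (size z).+1 = perm_length s -> (size z').+1 = perm_length s ->
   word_op z (rho a x) = word_op z' (rho b x).
  move=> ab ez ez' sz sz'.
  have da := desc _ _ ez sz; have db := desc _ _ ez' sz'.
  have hab : adj_hi a = adj_lo b by apply: val_inj; rewrite /= ab.
  have n1 : adj_lo a != adj_hi b by rewrite -val_eqE /=; lia.
  have n2 : adj_hi b != adj_lo a by rewrite eq_sym.
  have n3 := adj_lo_neq_hi a; have n4 := adj_lo_neq_hi b.
  have n5 : adj_lo b != adj_lo a by rewrite -hab eq_sym.
  have n6 : adj_hi b != adj_lo b by rewrite eq_sym.
  have la := perm_length_descent da.
  have d2 : ((adj_tperm a * s)%g (adj_hi b) < (adj_tperm a * s)%g (adj_lo b))%N.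
    by rewrite !permM /adj_tperm -hab tpermR tpermD // ?hab // (ltn_trans _ da) // hab.
  have l2 := perm_length_descent d2.
  have d3 : ((adj_tperm b * (adj_tperm a * s))%g (adj_hi a) < (adj_tperm b * (adj_tperm a * s))%g (adj_lo a))%N.
    rewrite !permM /adj_tperm hab tpermL [tperm (adj_lo b) _ _]tpermD // tpermL.
    by rewrite tpermD // ?hab // 1?eq_sym.
  have l3 := perm_length_descent d3.
  have br : (adj_tperm a * adj_tperm b * adj_tperm a = adj_tperm b * adj_tperm a * adj_tperm b)%g.
    rewrite -{1}[adj_tperm a]adj_tpermV -{2}[adj_tperm b]adj_tpermV -!mulgA -!conjgE.
    by rewrite /adj_tperm !tpermJ -hab tpermR tpermL !tpermD // hab // eq_sym.
  have [w ew sw] := red (adj_tperm a * (adj_tperm b * (adj_tperm a * s)))%g.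
  rewrite (repl a z (rcons (rcons w a) b)) //; first last.
  - by rewrite !size_rcons sw; move: sz sz' la l2 l3; clear; lia.
  - by rewrite !word_perm_rcons ew !adj_tpermK.
  rewrite (repl b z' (rcons (rcons w b) a)) //; first last.
  - by rewrite !size_rcons sw; move: sz sz' la l2 l3; clear; lia.
  - rewrite !word_perm_rcons ew !mulgA br.
    by rewrite -(mulgA _ (adj_tperm b) (adj_tperm a)) -!mulgA !adj_tpermK.
  by rewrite !word_op_rcons hecke_braid.
have [ji|ji] : (j = i.+1 :> nat) \/ (i = j.+1 :> nat).
  by move: ij nfij; rewrite -val_eqE /=; lia.
- exact: key.
- by symmetry; apply: key.
Qed.

Lemma hecke_T_word w x : size w = perm_length (word_perm w) ->
  hecke_T rho (word_perm w) x = word_op w x.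
Proof.
move=> sw; rewrite /hecke_T -/(word_op _); apply: word_op_reduced; rewrite reduced_wordP //.
by rewrite /reduced_word size_tuple.
Qed.

Lemma hecke_T_as_word (s : 'S_m) : exists2 w, word_perm w = s & size w = perm_length s /\
   forall x, hecke_T rho s x = word_op w x.
Proof.
exists (reduced_word s); first exact: reduced_wordP.
by rewrite /reduced_word size_tuple.
Qed.

Lemma hecke_T1 x : hecke_T rho 1%g x = x.
Proof. by rewrite -[1%g]/(word_perm [::]) hecke_T_word /= ?perm_length1 ?id_lfunE. Qed.

Lemma hecke_T_ascR (s : 'S_m) i x : (s (adj_lo i) < s (adj_hi i))%N ->
  hecke_T rho (adj_tperm i * s)%g x = hecke_T rho s (rho i x).
Proof.
move=> asc; have [w ew [sw ->]] := hecke_T_as_word s.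
rewrite -{1}ew -word_perm_rcons hecke_T_word ?word_op_rcons //.
by rewrite size_rcons word_perm_rcons ew perm_length_ascent // sw.
Qed.

Lemma hecke_T_ascL (s : 'S_m) i x : (s^-1%g (adj_lo i) < s^-1%g (adj_hi i))%N ->
  hecke_T rho (s * adj_tperm i)%g x = rho i (hecke_T rho s x).
Proof.
move=> asc; have [w ew [sw ->]] := hecke_T_as_word s.
rewrite -{1}ew -[(_ * _)%g]/(word_perm (i :: w)) hecke_T_word /= ?comp_lfunE //.
by rewrite sw ew -[RHS]perm_lengthV invMg adj_tpermV perm_length_ascent // perm_lengthV.
Qed.

Lemma hecke_TR (s : 'S_m) i x : hecke_T rho s (rho i x) =
  hecke_T rho (adj_tperm i * s)%g x +
  (if (s (adj_hi i) < s (adj_lo i))%N then dq *: hecke_T rho s x else 0).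
Proof.
case: ifPn; last by rewrite descentN negbK => asc; rewrite addr0 hecke_T_ascR.
move=> desc; have asc : ((adj_tperm i * s)%g (adj_lo i) < (adj_tperm i * s)%g (adj_hi i))%N.
  by rewrite !permM /adj_tperm tpermL tpermR.
have e y : hecke_T rho s y = hecke_T rho (adj_tperm i * s)%g (rho i y).
  by rewrite -{1}[s](adj_tpermK i) hecke_T_ascR.
by rewrite !e hecke_quad linearD linearZ.
Qed.

Lemma hecke_TL (s : 'S_m) i x : rho i (hecke_T rho s x) =
  hecke_T rho (s * adj_tperm i)%g x +
  (if (s^-1%g (adj_hi i) < s^-1%g (adj_lo i))%N then dq *: hecke_T rho s x else 0).
Proof.
case: ifPn; last by rewrite descentN negbK => asc; rewrite addr0 hecke_T_ascL.
move=> desc.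
have asc : ((s * adj_tperm i)^-1%g (adj_lo i) < (s * adj_tperm i)^-1%g (adj_hi i))%N.
  by rewrite invMg adj_tpermV !permM /adj_tperm tpermL tpermR.
have e : hecke_T rho s x = rho i (hecke_T rho (s * adj_tperm i)%g x).
  by rewrite -{1}[s](adj_tpermKr i) hecke_T_ascL.
by rewrite !e hecke_quad.
Qed.

End HeckeModule.

Definition lfun_simp := (comp_lfunE, add_lfunE, opp_lfunE, scale_lfunE, id_lfunE, zero_lfunE, sum_lfunE).

(** * Jucys-Murphy elements *)

Section HeckeJM.
Variables (F : fieldType) (q : F) (q0 : q != 0) (m : nat) (V : vectType F).
Variables (rho : 'I_m.-1 -> 'End(V)).
Local Notation dq := (q - q^-1).

(** Indexing by all natural numbers, with value 0 from m - 1 on, frees the recursion for [jm] and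
    inductions on positions from bounded indices. *)
Definition rn (k : nat) : 'End(V) := oapp rho 0 (insub k).

(** The recursion y_(k+1) = T_k y_k T_k; with indices from 0, [jm k] is y_(k+1) in the usual
    numbering. *)
Fixpoint jm (k : nat) : 'End(V) :=
  if k is k'.+1 then (rn k' \o (jm k' \o rn k'))%VF else \1%VF.

Lemma rnE (i : 'I_m.-1) : rn i = rho i.
Proof. by rewrite /rn valK. Qed.

Lemma rn_ord k : (k < m.-1)%N -> exists i : 'I_m.-1, k = i :> nat.
Proof. by move=> h; exists (Ordinal h). Qed.

Lemma rn_out k : (m.-1 <= k)%N -> rn k = 0.
Proof. by rewrite leqNgt => h; rewrite /rn insubN. Qed.

Lemma jmS k x : jm k.+1 x = rn k (jm k (rn k x)).
Proof. by rewrite /= !comp_lfunE. Qed.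

Hypothesis H : hecke_module q rho.

Lemma rn_quad k x : (k < m.-1)%N -> rn k (rn k x) = x + dq *: rn k x.
Proof. by move=> /rn_ord[i ->]; rewrite !rnE (hecke_quad q0 H). Qed.

Lemma rn_braid k x : rn k (rn k.+1 (rn k x)) = rn k.+1 (rn k (rn k.+1 x)).
Proof.
have [h|/rn_out->] := ltnP k.+1 m.-1; last by rewrite !zero_lfunE linear0.
have [[i ei] [j ej]] := (rn_ord (ltnW h), rn_ord h).
by rewrite ej ei !rnE (hecke_braid H) // -ej ei.
Qed.

Lemma rn_comm k l x : (k.+1 < l)%N || (l.+1 < k)%N -> rn k (rn l x) = rn l (rn k x).
Proof.
have [hk|/rn_out->] := ltnP k m.-1; last by rewrite !zero_lfunE linear0.
have [hl|/rn_out->] := ltnP l m.-1; last by rewrite !zero_lfunE linear0.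
have [[i ->] [j ->]] := (rn_ord hk, rn_ord hl).
by move=> h; rewrite !rnE (hecke_comm H).
Qed.

Lemma jm_rn_lt k i x : (k < i)%N -> rn i (jm k x) = jm k (rn i x).
Proof.
elim: k x => [|k IH] x ki; first by rewrite /= !id_lfunE.
by rewrite !jmS rn_comm ?IH ?(@rn_comm i) //; lia.
Qed.

(** The induction starts at k = i + 2: a braid relation turns [rn i] into [rn i.+1], which commutes
    with [jm i], and a second braid relation turns it back. *)
Lemma jm_rn_gt k i x : (i.+1 < k)%N -> rn i (jm k x) = jm k (rn i x).
Proof.
elim: k x => [|k IH] x // ik.
have [ik'|] := ltnP i.+1 k; first by rewrite !jmS rn_comm ?IH ?(@rn_comm i k) //; lia.
move=> h; have -> : k = i.+1 by lia.
by rewrite !jmS rn_braid jm_rn_lt // rn_braid.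
Qed.

Lemma jm_rn k i x : k != i -> k != i.+1 -> rn i (jm k x) = jm k (rn i x).
Proof.
by move=> ? ?; have [/jm_rn_lt//|h] := ltnP k i; apply: jm_rn_gt; lia.
Qed.

Lemma jm_comm k l x : jm k (jm l x) = jm l (jm k x).
Proof.
wlog lk : k l / (l <= k)%N.
  by move=> h; have [/h|/ltnW/h] := leqP l k.
have [->//|nlk] := eqVneq l k.
have {nlk}lk : (l < k)%N by lia.
elim: l x lk => [|l IH] x lk; first by rewrite /= !id_lfunE.
by rewrite !jmS -(jm_rn_gt _ lk) IH ?(ltnW lk) // (jm_rn_gt _ lk).
Qed.

(** The relation from which the seminormal form is derived. *)
Lemma jm_shift k x : (k < m.-1)%N -> jm k.+1 (rn k x) = rn k (jm k x) + dq *: jm k.+1 x.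
Proof. by move=> h; rewrite !jmS rn_quad // !linearD !linearZ. Qed.

(** For i < k the transposition (i, k + 1) is s_k (i, k) s_k with lengths adding, so conjugation by
    T_k turns the sum for k into all terms but one of the sum for k + 1. The remaining term T_k
    comes from T_k^2 = 1 + (q - q^-1) T_k. *)
Lemma jucys_murphyE (k : 'I_m) x : jucys_murphy q rho k x = jm k x.
Proof.
rewrite /jucys_murphy; set S := (\sum_(_ < _ | _) _) => /=.
suff : dq *: (S x) = jm k x - x.
  by rewrite !lfun_simp => ->; rewrite addrC subrK.
rewrite {}/S sum_lfunE /=.
case: k => k hk /=; elim: k hk x => [|k IH] hk x.
  by rewrite big_pred0 ?id_lfunE ?subrr ?scaler0 // => i; rewrite ltn0.
have hk' : (k < m.-1)%N by lia.
pose i0 := Ordinal hk'; have e0 : k = i0 :> nat by [].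
have ek : adj_lo i0 = Ordinal (ltnW hk) by apply: val_inj.
have ek' : adj_hi i0 = Ordinal hk by apply: val_inj.
rewrite (bigD1 (Ordinal (ltnW hk))) //= -ek -ek'.
have -> : hecke_T rho (tperm (adj_lo i0) (adj_hi i0)) x = rho i0 x.
  by rewrite -/(adj_tperm i0) -[adj_tperm i0]mulg1 (hecke_T_ascR q0 H) ?perm1 ?(hecke_T1 q0 H) //=.
have -> : \sum_(i < m | (i < k.+1)%N && (i != adj_lo i0)) hecke_T rho (tperm i (adj_hi i0)) x
  = rho i0 (\sum_(i < m | (i < k)%N) hecke_T rho (tperm i (adj_lo i0)) (rho i0 x)).
  rewrite linear_sum; apply: eq_big => [i|i /andP[]]; first by rewrite -val_eqE /=; lia.
  rewrite -val_eqE /= => lik nik; have ik : (i < k)%N by lia.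
  have -> : tperm i (adj_hi i0) = (adj_tperm i0 * (tperm i (adj_lo i0) * adj_tperm i0))%g.
    rewrite /adj_tperm -{1}[tperm (adj_lo i0) (adj_hi i0)]tpermV -conjgE tpermJ.
    by rewrite tpermL tpermD // -val_eqE /=; lia.
  have n1 : i != adj_hi i0 by rewrite -val_eqE /=; lia.
  have n2 : adj_lo i0 != adj_hi i0 by rewrite -val_eqE /=; lia.
  have n3 : i != adj_lo i0 by rewrite -val_eqE /=; lia.
  rewrite (hecke_T_ascR q0 H); last first.
    by rewrite !permM tpermR (tpermD n1 n2) /adj_tperm tpermR tpermD 1?eq_sym // 1?eq_sym.
  by rewrite (hecke_T_ascL q0 H) // tpermV tpermR (tpermD n1 n2) /=; lia.
rewrite scalerDr -[X in _ + X]linearZ /= ek (IH (ltnW hk)) linearB -(rnE i0) -e0 /=.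
rewrite rn_quad // -/(jm k) !comp_lfunE.
by rewrite addrCA; congr (_ + _); rewrite opprD addrCA subrr addr0.
Qed.

End HeckeJM.

(** * Matrix units of the Hecke algebra attached to a module *)

Section MatrixUnits.
Variables (F : fieldType) (q : F) (q0 : q != 0) (m : nat) (V M : vectType F).
Variables (rho : 'I_m.-1 -> 'End(V)) (H : hecke_module q rho).
Variables (sig : 'I_m.-1 -> 'End(M)) (HM : hecke_module q sig).

(* The map V -> H_m attached to a functional f on V is left H_m-linear because
   (T_(s^-1)) is the dual basis of (T_s) for the symmetrizing trace of H_m. *)
Definition hecke_X (v : V) (f : 'Hom(V, F^o)) : 'End(M) :=
  hecke_act sig (fun s => f (hecke_T rho s^-1%g v)).

Lemma hecke_XE v f x : hecke_X v f x =
  \sum_(s : 'S_m) (f (hecke_T rho s^-1%g v) : F) *: hecke_T sig s x.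
Proof. by rewrite /hecke_X /hecke_act sum_lfunE; apply: eq_bigr => s _; rewrite scale_lfunE. Qed.

(** The rule for T_i T_s and the rule for T_(s^-1) T_i have their correction terms under the same
    condition, a descent of s^-1 at i. After reindexing the leading terms by s |-> s s_i, the
    coefficients of each T_s agree. *)
Lemma hecke_XL i v f x : sig i (hecke_X v f x) = hecke_X (rho i v) f x.
Proof.
rewrite !hecke_XE linear_sum /=.
under eq_bigr do rewrite linearZ /= (hecke_TL q0 HM) scalerDr.
rewrite big_split /= (reindex_inj (mulIg (adj_tperm i))) /=.
rewrite -[RHS]addr0 -big_split /= addr0; apply: eq_bigr => s _.
rewrite adj_tpermKr (hecke_TR q0 H) linearD [RHS]scalerDl invMg adj_tpermV; congr (_ + _).
case: ifP => _; last by rewrite scaler0 linear0 scale0r.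
by rewrite scalerA linearZ /=; congr (_ *: _); exact: mulrC.
Qed.

Lemma hecke_XR i v f x : hecke_X v f (sig i x) = hecke_X v (f \o rho i)%VF x.
Proof.
rewrite !hecke_XE.
under eq_bigr do rewrite (hecke_TR q0 HM) scalerDr.
rewrite big_split /= (reindex_inj (mulgI (adj_tperm i))) /=.
rewrite -[RHS]addr0 -big_split /= addr0; apply: eq_bigr => s _.
rewrite adj_tpermK comp_lfunE (hecke_TL q0 H) linearD [RHS]scalerDl invMg adj_tpermV invgK.
congr (_ + _).
case: ifP => _; last by rewrite scaler0 linear0 scale0r.
by rewrite scalerA linearZ /=; congr (_ *: _); exact: mulrC.
Qed.

Lemma hecke_XvD v v' f x : hecke_X (v + v') f x = hecke_X v f x + hecke_X v' f x.
Proof. by rewrite !hecke_XE -big_split; apply: eq_bigr => s _; rewrite !linearD scalerDl. Qed.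

Lemma hecke_XvZ a v f x : hecke_X (a *: v) f x = a *: hecke_X v f x.
Proof. rewrite !hecke_XE scaler_sumr; apply: eq_bigr => s _; rewrite scalerA; congr (_ *: _); by rewrite !linearZ. Qed.

Lemma hecke_XfD v f f' x : hecke_X v (f + f') x = hecke_X v f x + hecke_X v f' x.
Proof. by rewrite !hecke_XE -big_split; apply: eq_bigr => s _; rewrite add_lfunE scalerDl. Qed.

Lemma hecke_XfZ a v f x : hecke_X v (a *: f) x = a *: hecke_X v f x.
Proof. by rewrite !hecke_XE scaler_sumr; apply: eq_bigr => s _; rewrite scale_lfunE scalerA. Qed.

Lemma hecke_X_rnL k v f x : rn sig k (hecke_X v f x) = hecke_X (rn rho k v) f x.
Proof.
have [/rn_ord[i ->]|h] := ltnP k m.-1; first by rewrite !rnE hecke_XL.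
by rewrite !rn_out // !zero_lfunE -[X in hecke_X X](scale0r v) hecke_XvZ scale0r.
Qed.

Lemma hecke_X_rnR k v f x : hecke_X v f (rn sig k x) = hecke_X v (f \o rn rho k)%VF x.
Proof.
have [/rn_ord[i ->]|h] := ltnP k m.-1; first by rewrite !rnE hecke_XR.
rewrite !rn_out // !zero_lfunE linear0 comp_lfun0r.
by rewrite -[X in hecke_X _ X](scale0r f) hecke_XfZ scale0r.
Qed.

Lemma hecke_X_jmL k v f x : jm sig k (hecke_X v f x) = hecke_X (jm rho k v) f x.
Proof.
elim: k v x => [|k IH] v x; first by rewrite /= !id_lfunE.
by rewrite !jmS hecke_X_rnL IH hecke_X_rnL.
Qed.

Lemma hecke_X_jmR k v f x : hecke_X v f (jm sig k x) = hecke_X v (f \o jm rho k)%VF x.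
Proof.
elim: k f x => [|k IH] f x; first by rewrite /= !id_lfunE comp_lfun1r.
by rewrite !jmS hecke_X_rnR IH hecke_X_rnR /= !comp_lfunA.
Qed.

End MatrixUnits.

(** * Tensors as functions on words and the action of Rcheck *)

Section Words.
Variables (F : fieldType) (n : nat).

(* Junk value 0 if the word s does not have length m. *)
Definition ev m (x : tens F n m) (s : seq 'I_n) : F :=
  if insub s is Some J then x J else 0.

Definition mk m (g : seq 'I_n -> F) : tens F n m := [ffun J : m.-tuple 'I_n => g J].

Section Ev.
Variable m : nat.
Implicit Types (x y : tens F n m) (s : seq 'I_n).

Lemma ev_tuple x (J : m.-tuple 'I_n) : ev x J = x J.
Proof. by rewrite /ev valK. Qed.

Lemma ev_size x s : size s != m -> ev x s = 0.
Proof. by move=> h; rewrite /ev insubN. Qed.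

Lemma ev_ext x y : (forall s, size s = m -> ev x s = ev y s) -> x = y.
Proof.
by move=> h; apply/ffunP => J; rewrite -!ev_tuple; apply: h; rewrite size_tuple.
Qed.

Lemma ev_mk g s : ev (mk m g) s = if size s == m then g s else 0.
Proof.
have [h|h] := boolP (size s == m); last by rewrite ev_size.
by rewrite -[s]/(tval (Tuple h)) ev_tuple ffunE.
Qed.

Lemma evD x y s : ev (x + y) s = ev x s + ev y s.
Proof. by rewrite /ev; case: insub => [J|]; rewrite ?ffunE ?addr0. Qed.

Lemma ev0 s : ev (0 : tens F n m) s = 0.
Proof. by rewrite /ev; case: insub => [J|] //; rewrite ffunE. Qed.

Lemma evZ a x s : ev (a *: x) s = a * ev x s.
Proof. by rewrite /ev; case: insub => [J|]; rewrite ?ffunE ?mulr0. Qed.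

Lemma evN x s : ev (- x) s = - ev x s.
Proof. by rewrite -scaleN1r evZ mulN1r. Qed.

Lemma ev_sum I (r : seq I) P (f : I -> tens F n m) s :
  ev (\sum_(i <- r | P i) f i) s = \sum_(i <- r | P i) ev (f i) s.
Proof.
by elim/big_rec2: _ => [|i y1 y2 _ <-]; rewrite ?ev0 ?evD.
Qed.

Lemma ev_basis (J : m.-tuple 'I_n) s : ev (tens_basis F J) s = (s == J)%:R.
Proof.
have [h|h] := boolP (size s == m).
  by rewrite -[s]/(tval (Tuple h)) ev_tuple ffunE -val_eqE.
by rewrite ev_size //; case: eqP => // e; rewrite e size_tuple eqxx in h.
Qed.

(** In all operators needed here, the row of each factor at the letter of J has at most one non-zero
    entry, so the sum over words collapses to a single term. *)
Lemma tens_op_monomial (A : 'I_m -> 'M[F]_n) (x : tens F n m) (J : m.-tuple 'I_n)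
    (c : 'I_m -> F) (h : 'I_m -> 'I_n) :
  (forall r l, A r (tnth J r) l = c r * (l == h r)%:R) ->
  tens_op A x J = (\prod_r c r) * x [tuple h r | r < m].
Proof.
move=> hA; rewrite lfunE /= ffunE (bigD1 [tuple h r | r < m]) //= [X in _ + X]big1 => [|K nK].
  rewrite addr0; congr (_ * _); apply: eq_bigr => r _.
  by rewrite hA tnth_mktuple eqxx mulr1.
have [r nr] : exists r, tnth K r != h r.
  apply/existsP; rewrite -negb_forall; apply: contra nK => /forallP e.
  by apply/eqP/eq_from_tnth => r; rewrite tnth_mktuple; apply/eqP.
by rewrite (bigD1 r) //= hA (negPf nr) mulr0 !mul0r.
Qed.

End Ev.

Variable q : F.

Lemma ev_tens_op2_delta m (k : 'I_m.-1) i i' j j' x A a b C : size A = k ->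
  ev (tens_op2 k (delta_mx i i') (delta_mx j j') x) (A ++ a :: b :: C) =
  (a == i)%:R * (b == j)%:R * ev (x : tens F n m) (A ++ i' :: j' :: C).
Proof.
move=> sA; have [sz|sz] := boolP (size (A ++ a :: b :: C) == m); last first.
  by rewrite !ev_size ?mulr0 //; move: sz; rewrite !size_cat.
have sz' : size (A ++ i' :: j' :: C) == m by move: sz; rewrite !size_cat.
set s := A ++ _; set s' := A ++ _.
rewrite -[s]/(tval (Tuple sz)) -[s']/(tval (Tuple sz')) !ev_tuple /tens_op2.
pose c (r : 'I_m) : F := if r == adj_lo k then (a == i)%:R else if r == adj_hi k then (b == j)%:R else 1.
have tl : tnth (Tuple sz) (adj_lo k) = a by rewrite (tnth_nth a) /= nth_cat sA ltnn subnn.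
have th : tnth (Tuple sz) (adj_hi k) = b.
  by rewrite (tnth_nth a) /= nth_cat sA ltnNge leqnSn subSnn.
rewrite (@tens_op_monomial _ _ _ _ c (tnth (Tuple sz'))); last first.
  move=> r l; rewrite /c; case: eqP => [->|/eqP nl].
    rewrite tl mxE -natrM mulnb; congr (_ && (_ == _))%:R.
    by rewrite (tnth_nth a) /= nth_cat sA ltnn subnn.
  case: eqP => [->|/eqP nh].
    rewrite th mxE -natrM mulnb; congr (_ && (_ == _))%:R.
    by rewrite (tnth_nth a) /= nth_cat sA ltnNge leqnSn subSnn.
  rewrite mxE mul1r eq_sym; congr (_ == _)%:R.
  rewrite !(tnth_nth a) /= !nth_cat sA.
  case: ltngtP => // [h|h]; last by rewrite -val_eqE /= h eqxx in nl.
  move: nl nh; rewrite -!val_eqE /= => nl nh.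
  by have -> : (r - k = (r - k - 2).+2)%N by lia.
congr (_ * _); last by congr (x _); apply: eq_from_tnth => r; rewrite tnth_mktuple.
rewrite (bigD1 (adj_lo k)) //= (bigD1 (adj_hi k)) /=; last by rewrite eq_sym adj_lo_neq_hi.
rewrite big1 => [|r /andP[/negPf nl /negPf nh]]; last by rewrite /c nl nh.
by rewrite /c !eqxx [adj_hi k == _]eq_sym (negPf (adj_lo_neq_hi k)) mulr1.
Qed.

Lemma sum_pred1 (V : nmodType) (I : finType) (P : pred I) (a : I) (f : I -> V) :
  (forall i, P i -> i != a -> f i = 0) -> \sum_(i | P i) f i = if P a then f a else 0.
Proof.
move=> h; case: ifP => Pa.
  by rewrite (bigD1 a) //= big1 ?addr0 // => i /andP[]; apply: h.
by apply: big1 => i Pi; apply: h => //; apply: contraFneq Pa => <-.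
Qed.

Local Notation R m := (rn (@Rcheck F n m q)).
Local Notation dq := (q - q^-1).

Lemma ev_Rcheck m k x A a b C : size A = k ->
  ev (R m k x) (A ++ a :: b :: C) =
  (if a == b then q * ev x (A ++ a :: b :: C) else ev x (A ++ b :: a :: C)) +
  (if (b < a)%N then dq * ev x (A ++ a :: b :: C) else 0).
Proof.
move=> sA; have [sz|sz] := boolP (size (A ++ a :: b :: C) == m); last first.
  rewrite !ev_size ?mulr0 //; last by move: sz; rewrite !size_cat.
  by rewrite !if_same addr0.
have kk : (k < m.-1)%N by move: sz; rewrite size_cat sA /= => /eqP <-; lia.
have [i ei] := rn_ord kk; rewrite {1}ei rnE /Rcheck !lfun_simp evD evD !evZ.
have E i1 i2 j1 j2 := ev_tens_op2_delta i1 i2 j1 j2 x a b C (etrans sA ei).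
rewrite !ev_sum; congr (_ + _); last first.
  rewrite (sum_pred1 (a := a)) => [|j _ nj]; last first.
    rewrite sum_lfunE ev_sum big1 // => l _; rewrite E.
    by rewrite eq_sym (negPf nj) !mul0r.
  rewrite sum_lfunE ev_sum (sum_pred1 (a := b)) => [|j _ nj]; last first.
    rewrite E.
    by rewrite [b == j]eq_sym (negPf nj) mulr0 mul0r.
  case: ifP => _; last by rewrite mulr0.
  by rewrite E !eqxx !mul1r.
rewrite mulr_sumr -big_split /= (sum_pred1 (a := a)) => [|j _ nj] /=; last first.
  rewrite E eq_sym (negPf nj) !mul0r mulr0 add0r sum_lfunE ev_sum big1 // => l _.
  by rewrite E eq_sym (negPf nj) !mul0r.
rewrite E eqxx mul1r sum_lfunE ev_sum (sum_pred1 (a := b)) => [|j _ nj]; last first.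
  by rewrite E [b == j]eq_sym (negPf nj) mulr0 mul0r.
rewrite E !eqxx !mul1r eq_sym; case: eqP => [->|_] /=; rewrite ?mul1r ?addr0 //.
by rewrite mul0r mulr0 add0r.
Qed.

End Words.

Lemma split2 (T : Type) (s : seq T) k : (k.+1 < size s)%N ->
  exists A a b C, s = A ++ a :: b :: C /\ size A = k.
Proof.
case: s => [|x0 s0] // h; set s := x0 :: s0 in h *.
exists (take k s), (nth x0 s k), (nth x0 s k.+1), (drop k.+2 s).
by rewrite -!drop_nth ?cat_take_drop ?size_takel //; lia.
Qed.

Lemma catrcons (T : Type) (A : seq T) a s : A ++ a :: s = (rcons A a) ++ s.
Proof. by rewrite cat_rcons. Qed.

(** * The Hecke relations for Rcheck *)

Section RcheckHecke.
Variables (F : fieldType) (n : nat) (q : F) (q0 : q != 0).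
Local Notation R m := (rn (@Rcheck F n m q)).
Local Notation dq := (q - q^-1).

Lemma ev_Rcheck1 m k (x : tens F n m) A a b c C : size A = k ->
  ev (R m k.+1 x) (A ++ a :: b :: c :: C) =
  (if b == c then q * ev x (A ++ a :: b :: c :: C) else ev x (A ++ a :: c :: b :: C)) +
  (if (c < b)%N then dq * ev x (A ++ a :: b :: c :: C) else 0).
Proof. by move=> sA; rewrite !(catrcons A) ev_Rcheck ?size_rcons ?sA. Qed.

Lemma Rcheck_hecke m : hecke_module q (@Rcheck F n m q).
Proof.
split.
- move=> i; apply/lfunP => x; apply: ev_ext => s ss.
  have [|A [a [b [C [-> sA]]]]] := @split2 _ s i; first by rewrite ss; case: (i) => /= ? ?; lia.
  rewrite -!(rnE (@Rcheck F n m q)) !lfun_simp linearD linearZ /= ev0 !(evD, evN, evZ) !ev_Rcheck // eq_sym.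
  have [->|nab] := eqVneq b a; first by rewrite ltnn; field.
  by have := nab; rewrite -val_eqE /=; case: ltngtP => //= _ _; field.
{ move=> i j ij; apply/lfunP => x; apply: ev_ext => s ss.
  have [|A [a [b [C0 [es sA]]]]] := @split2 _ s i; first by rewrite ss; case: (i) => /= ? ?; lia.
  case: C0 es => [|c C] es.
    by move: ss (ltn_ord j); rewrite es size_cat sA /=; lia.
  rewrite es -!(rnE (@Rcheck F n m q)) !lfun_simp ij.
  do 5 rewrite ?(ev_Rcheck _ _ _ _ _ sA) ?(ev_Rcheck1 _ _ _ _ _ sA).
  (* Only the relative order of the three letters matters; each order leaves an identity in q. *)
  have [eab|nab] := eqVneq a b; have [eac|nac] := eqVneq a c; have [ebc|nbc] := eqVneq b c;
   subst; rewrite ?eqxx ?ltnn //=; try (by rewrite eqxx in nab); try (by rewrite eqxx in nac);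
   try (by rewrite eqxx in nbc).
  all: try (by field).
  all: repeat match goal with h : is_true (_ != _) |- _ => move: h; rewrite -val_eqE /= end.
  all: repeat (case: ltngtP => //= ?).
  all: by move=> *; first [ field | exfalso; lia ].
}
- move=> i j; wlog ij : i j / (i.+1 < j)%N.
    by move=> h /orP[] ij; [rewrite h ?ij|rewrite -h ?ij].
  move=> _; apply/lfunP => x; apply: ev_ext => s ss.
  have [|A [a [b [C0 [es sA]]]]] := @split2 _ s i; first by rewrite ss; case: (i) => /= ? ?; lia.
  have [|B [c [d [C [es' sB]]]]] := @split2 _ C0 (j - i.+2)%N.
    move: ss; rewrite es size_cat sA /=; case: (j) ij => /= ? ? ?; lia.
  rewrite es es' -!(rnE (@Rcheck F n m q)) !lfun_simp.
  have E a' b' y : ev (R m j y) (A ++ a' :: b' :: B ++ c :: d :: C) =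
    (if c == d then q * ev y (A ++ a' :: b' :: B ++ c :: d :: C) else ev y (A ++ a' :: b' :: B ++ d :: c :: C)) +
    (if (d < c)%N then dq * ev y (A ++ a' :: b' :: B ++ c :: d :: C) else 0).
    rewrite -!(cat_cons b') -!(cat_cons a') !(catA A) ev_Rcheck //.
    by rewrite size_cat sA /= sB; lia.
  rewrite !(ev_Rcheck _ _ _ _ _ sA) !E !(ev_Rcheck _ _ _ _ _ sA).
  by do ! case: ifP => _; ring.
Qed.

End RcheckHecke.

(** * The generators of the quantum group on words *)

Section Coproduct.
Variables (F : fieldType) (n : nat).

(* The action of the iterated coproduct of an operator e_b |-> e_a on words,
   where [kp] gives the diagonal entries of K. *)
Fixpoint e_act (kp : 'I_n -> F) (a b : 'I_n) (g : seq 'I_n -> F) (s : seq 'I_n) : F :=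
  if s is l :: s' then
    (l == a)%:R * (\prod_(j <- s') kp j) * g (b :: s')
    + (kp l)^-1 * e_act kp a b (fun u => g (l :: u)) s'
  else 0.

Section EAct.
Variables (kp : 'I_n -> F) (a b : 'I_n).
Implicit Types (g : seq 'I_n -> F) (s : seq 'I_n).
Local Notation E := (e_act kp a b).

Lemma e_act_ext g g' s : (forall u, size u = size s -> g u = g' u) -> E g s = E g' s.
Proof.
elim: s g g' => [|l s IH] g g' h //=; congr (_ * _ + _ * _); first exact: h.
by apply: IH => u su; apply: h; rewrite /= su.
Qed.

Lemma e_actZ c g s : E (fun u => c * g u) s = c * E g s.
Proof. by elim: s g => [|l s IH] g /=; rewrite ?mulr0 // IH; ring. Qed.

Lemma e_actD g g' s : E (fun u => g u + g' u) s = E g s + E g' s.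
Proof. by elim: s g g' => [|l s IH] g g' /=; rewrite ?addr0 // IH; ring. Qed.

Lemma e_act0 g s : (forall u, size u = size s -> g u = 0) -> E g s = 0.
Proof.
move=> h; rewrite (@e_act_ext _ (fun u => 0 * g u)) ?e_actZ ?mul0r // => u su.
by rewrite mul0r h.
Qed.

Lemma e_act_cat g s t : E g (s ++ t) =
  (\prod_(j <- t) kp j) * E (fun u => g (u ++ t)) s
  + (\prod_(j <- s) kp j)^-1 * E (fun u => g (s ++ u)) t.
Proof.
elim: s g => [|l s IH] g /=; first by rewrite big_nil invr1 mul1r mulr0 add0r.
by rewrite IH big_cat big_cons invfM /=; ring.
Qed.

Lemma e_act_rcons g s l : E g (rcons s l) =
  kp l * E (fun u => g (rcons u l)) s +
  (\prod_(j <- s) kp j)^-1 * ((l == a)%:R * g (rcons s b)).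
Proof.
rewrite -cats1 e_act_cat big_seq1 /= big_nil mulr0 addr0 mulr1 cats1.
by congr (_ * _ + _); apply: e_act_ext => u _; rewrite cats1.
Qed.

Lemma e_act_sum g s : E g s = \sum_(p < size s) (nth a s p == a)%:R *
  (\prod_(j <- take p s) (kp j)^-1) * (\prod_(j <- drop p.+1 s) kp j) *
  g (take p s ++ b :: drop p.+1 s).
Proof.
elim: s g => [|l s IH] g /=; first by rewrite big_ord0.
rewrite big_ord_recl /= drop0 big_nil mulr1 IH mulr_sumr; congr (_ + _).
by apply: eq_bigr => p _; rewrite /= big_cons; ring.
Qed.

End EAct.

Section Generators.
Variables (qh : F) (m : nat).

Definition kap (i : 'I_n.-1) (l : 'I_n) : F :=
  (if l == adj_lo i then qh else 1) * (if l == adj_hi i then qh^-1 else 1).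

Lemma KalphaE i j l : Kalpha qh i j l = kap i j * (l == j)%:R.
Proof.
by rewrite /Kalpha /Keps mulmx_diag !mxE mulr_natr [l == j]eq_sym.
Qed.

Lemma KalphaVE i j l : KalphaV qh i j l = (kap i j)^-1 * (l == j)%:R.
Proof.
rewrite /KalphaV /Keps mulmx_diag !mxE mulr_natr [l == j]eq_sym; congr (_ *+ _).
by rewrite /kap invfM; do 2 case: ifP => _; rewrite ?invr1 ?invrK.
Qed.

Lemma ev_coprod i a b (x : tens F n m) s :
  ev (coprod qh m i (delta_mx a b) x) s = e_act (kap i) a b (ev x) s.
Proof.
have [sz|sz] := boolP (size s == m); last first.
  by rewrite ev_size // e_act0 // => u su; rewrite ev_size // su.
rewrite e_act_sum /coprod sum_lfunE ev_sum (eqP sz); apply: eq_bigr => p _.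
set J := Tuple sz; rewrite -[s in LHS]/(tval J) ev_tuple.
pose h (r : 'I_m) := if r == p then b else tnth J r.
pose c (r : 'I_m) : F := if (r < p)%N then (kap i (tnth J r))^-1 else
   if r == p then (tnth J r == a)%:R else kap i (tnth J r).
rewrite (@tens_op_monomial _ _ _ _ _ _ c h); last first.
  move=> r l; rewrite /c /h; case: ltnP => rp.
    by rewrite KalphaVE ifF //; apply/eqP => e; rewrite e ltnn in rp.
  by case: eqP => [->|_]; rewrite ?KalphaE // mxE -natrM mulnb.
have ps : (p < size s)%N by rewrite (eqP sz).
have sz' : size (take p s ++ b :: drop p.+1 s) == m.
  by rewrite size_cat /= size_drop size_takel ?(ltnW ps) //; move: ps (eqP sz); lia.
rewrite -[X in ev x X]/(tval (Tuple sz')) ev_tuple; congr (_ * x _); last first.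
  apply: eq_from_tnth => r; rewrite tnth_mktuple !(tnth_nth a) /= /h nth_cat.
  rewrite size_takel ?(ltnW ps) // -val_eqE (tnth_nth a) /=.
  case: ltngtP => [rp|rp|<-]; rewrite ?subnn //; first by rewrite nth_take.
  by rewrite -(subnSK rp) /= nth_drop subnKC.
pose c' r := if (r < p)%N then (kap i (nth a s r))^-1 else
     if r == p :> nat then (nth a s r == a)%:R else kap i (nth a s r) : F.
transitivity (\prod_(0 <= r < m) c' r).
  rewrite big_mkord; apply: eq_bigr => r _.
  by rewrite /c /c' !(tnth_nth a) -val_eqE.
rewrite (@big_cat_nat _ _ _ p) //=; last by rewrite ltnW.
rewrite [X in _ * X]big_ltn // {2}/c' ltnn eqxx mulrCA -mulrA; congr (_ * (_ * _)).
  rewrite (big_nth a) size_takel ?(ltnW ps) // !big_nat; apply: eq_bigr => r /= rp.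
  by rewrite /c' rp nth_take.
rewrite (big_nth a) size_drop (eqP sz) -{1}[p.+1]add0n big_addn !big_nat.
apply: eq_bigr => r _; rewrite /c' nth_drop [(r + _)%N]addnC.
by rewrite !ifF //; lia.
Qed.

Lemma ev_K (c : F) i (x : tens F n m) s :
  ev (tens_op (fun=> Keps c i) x) s = c ^+ count_mem i s * ev x s.
Proof.
have [sz|sz] := boolP (size s == m); last by rewrite !ev_size // mulr0.
set J := Tuple sz; have e (y : tens F n m) : ev y s = y J by exact: (ev_tuple y J).
rewrite !e.
rewrite (@tens_op_monomial _ _ _ _ _ _ (fun r => if tnth J r == i then c else 1) (tnth J)).
  congr (_ * x _); last by apply: eq_from_tnth => r; rewrite tnth_mktuple.
  rewrite -(big_tuple _ _ J xpredT (fun l => if l == i then c else 1)) /=.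
  by rewrite -big_mkcond big_const_seq iter_mulr_1.
by move=> r l; rewrite !mxE mulr_natr [l == _]eq_sym.
Qed.

End Generators.
End Coproduct.

(** * Commutation of the two actions *)

Section Commutation.
Variables (F : fieldType) (n : nat) (q qh : F) (q0 : q != 0) (hqh : qh ^+ 2 = q).
Local Notation R m := (rn (@Rcheck F n m q)).
Local Notation dq := (q - q^-1).

Lemma qh_neq0 : qh != 0.
Proof. by apply: contra_neq q0 => e; rewrite -hqh e expr0n. Qed.

(** The entries of Rcheck at the words c d and d c; written without a case distinction, the action
    can be pulled through the linear operation [e_act]. *)
Definition Rdiag (c d : 'I_n) : F :=
  (if c == d then q else 0) + (if (d < c)%N then dq else 0).
Definition Roff (c d : 'I_n) : F := if c == d then 0 else 1.

Lemma ev_RcheckE m k (x : tens F n m) A c d C : size A = k ->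
  ev (R m k x) (A ++ c :: d :: C) =
  Rdiag c d * ev x (A ++ c :: d :: C) + Roff c d * ev x (A ++ d :: c :: C).
Proof.
move=> sA; rewrite ev_Rcheck // /Rdiag /Roff.
by case: eqP => [->|_]; case: ifP => _; ring.
Qed.

(** Commutation on two tensor factors, read off at the word c d. As a and b are neighbours, any
    other letter compares in the same way with both, which leaves finitely many cases. *)
Lemma Rcheck_e_act2 (i : 'I_n.-1) a b (h : 'I_n -> 'I_n -> F) c d :
  (a = adj_lo i /\ b = adj_hi i) \/ (a = adj_hi i /\ b = adj_lo i) ->
  (c == a)%:R * kap qh i d * (Rdiag b d * h b d + Roff b d * h d b)
  + (kap qh i c)^-1 * (d == a)%:R * (Rdiag c b * h c b + Roff c b * h b c)
  = Rdiag c d * ((c == a)%:R * kap qh i d * h b d + (kap qh i c)^-1 * (d == a)%:R * h c b)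
  + Roff c d * ((d == a)%:R * kap qh i c * h b c + (kap qh i d)^-1 * (c == a)%:R * h d b).
Proof.
move=> hab; have qh0 := qh_neq0.
have nab : a != b.
  by have := adj_lo_neq_hi i; case: hab => -[-> ->] //; rewrite eq_sym.
have ord (l : 'I_n) : l != a -> l != b -> (l < a)%N = (l < b)%N /\ (a < l)%N = (b < l)%N.
  by case: hab => -[-> ->]; rewrite -!val_eqE /=; lia.
have kab : kap qh i b = (kap qh i a)^-1.
  rewrite /kap; case: hab => -[-> ->]; rewrite !eqxx.
    by rewrite [_ == adj_lo i]eq_sym (negPf (adj_lo_neq_hi i)) mul1r mulr1.
  by rewrite [adj_hi i == _]eq_sym (negPf (adj_lo_neq_hi i)) mul1r mulr1 invrK.
have kother (l : 'I_n) : l != a -> l != b -> kap qh i l = 1.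
  rewrite /kap; case: hab => -[-> ->] /negPf n1 /negPf n2.
    by rewrite n1 n2 mulr1.
  by rewrite n1 n2 mulr1.
have ka0 : kap qh i a != 0.
  by rewrite /kap; do 2 case: ifP => _; rewrite ?mulr1 ?mul1r ?mulf_neq0 ?invr_eq0 ?oner_neq0.
have nba : b != a by rewrite eq_sym.
have [->|nca] := eqVneq c a; have [->|nda] := eqVneq d a.
- rewrite /Rdiag /Roff !eqxx (negPf nab) (negPf nba) ltnn.
  case: hab => -[-> ->] /=.
    rewrite ltnSn ifF; last by lia.
    rewrite /kap !eqxx (negPf (adj_lo_neq_hi i)) -hqh ?mul1r ?mulr1 ?invrK; by field.
  rewrite ltnSn ifF; last by lia.
  rewrite /kap !eqxx [adj_hi i == _]eq_sym (negPf (adj_lo_neq_hi i)) -hqh ?mul1r ?mulr1 ?invrK; by field.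
- have [->|ndb] := eqVneq d b; last first.
    have [o1 o2] := ord _ nda ndb; rewrite (kother _ nda ndb).
    rewrite /Rdiag /Roff ?eqxx !(eq_sym _ d) (negPf nda) (negPf ndb) o1 invr1 /=; ring.
  rewrite kab /Rdiag /Roff !eqxx (negPf nab) ltnn.
  case: hab => -[-> ->] /=.
    rewrite ifF; last by lia.
    rewrite /kap !eqxx (negPf (adj_lo_neq_hi i)) -hqh ?mul1r ?mulr1 ?invrK; by field.
  rewrite ltnSn.
  rewrite /kap !eqxx [adj_hi i == _]eq_sym (negPf (adj_lo_neq_hi i)) -hqh ?mul1r ?mulr1 ?invrK; by field.
- have [->|ncb] := eqVneq c b; last first.
    have [o1 o2] := ord _ nca ncb; rewrite (kother _ nca ncb).
    rewrite /Rdiag /Roff ?eqxx (negPf nca) (negPf ncb) o2 invr1 /=; ring.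
  rewrite kab /Rdiag /Roff !eqxx (negPf nba) ltnn.
  case: hab => -[-> ->] /=.
    rewrite ltnSn.
    rewrite /kap !eqxx (negPf (adj_lo_neq_hi i)) -hqh ?mul1r ?mulr1 ?invrK; by field.
  rewrite ifF; last by lia.
  rewrite /kap !eqxx [adj_hi i == _]eq_sym (negPf (adj_lo_neq_hi i)) -hqh ?mul1r ?mulr1 ?invrK; by field.
- by rewrite /=; ring.
Qed.

(** Where E or F acts on another factor, the factors k and k + 1 carry the same K or K^-1, a scalar
    symmetric in their two letters. The other two terms are [Rcheck_e_act2]. *)
Lemma coprod_Rcheck (i : 'I_n.-1) m k a b (x : tens F n m) :
  (a = adj_lo i /\ b = adj_hi i) \/ (a = adj_hi i /\ b = adj_lo i) ->
  coprod qh m i (delta_mx a b) (R m k x) = R m k (coprod qh m i (delta_mx a b) x).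
Proof.
move=> hab; have [hk|hk] := ltnP k m.-1; last first.
  by rewrite !rn_out // !zero_lfunE linear0.
apply: ev_ext => s ss; have [|A [c [d [C [-> sA]]]]] := @split2 _ s k; first by lia.
rewrite ev_RcheckE // !ev_coprod.
rewrite !e_act_cat -[c :: d :: C]/([:: c; d] ++ C) -[d :: c :: C]/([:: d; c] ++ C).
rewrite !e_act_cat /= !big_cons !big_nil /=.
rewrite (@e_act_ext _ _ _ _ _ _ (fun u => Rdiag c d * ev x (u ++ c :: d :: C) + Roff c d * ev x (u ++ d :: c :: C)) A); last first.
  by move=> u su; rewrite ev_RcheckE // su.
rewrite (@e_act_ext _ _ _ _ _ _ (fun u => Rdiag c d * ev x (A ++ c :: d :: u) + Roff c d * ev x (A ++ d :: c :: u)) C); last first.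
  by move=> u su; rewrite ev_RcheckE.
rewrite !e_actD !e_actZ !ev_RcheckE //.
have := Rcheck_e_act2 (fun c d => ev x (A ++ c :: d :: C)) c d hab.
set u1 := e_act _ _ _ _ _; set u2 := e_act _ _ _ _ _; set u3 := e_act _ _ _ _ _; set u4 := e_act _ _ _ _ _.
set p1 := bigop.body _ _ _; set p2 := bigop.body _ _ _.
rewrite !mulr1 !mulr0 !addr0.
set X1 := ev _ _; set X2 := ev _ _; set X3 := ev _ _; set X4 := ev _ _.
by move=> E; rewrite -[X in _ + X = _]mulrA in E; rewrite E !invfM; ring.
Qed.

Lemma K_Rcheck (c : F) i m k (x : tens F n m) :
  tens_op (fun=> Keps c i) (R m k x) = R m k (tens_op (fun=> Keps c i) x).
Proof.
have [hk|hk] := ltnP k m.-1; last by rewrite !rn_out // !zero_lfunE linear0.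
apply: ev_ext => s ss; have [|A [d [e [C [-> sA]]]]] := @split2 _ s k; first by lia.
rewrite ev_RcheckE // !ev_K ev_RcheckE // !count_cat /=.
by rewrite !exprD; ring.
Qed.

End Commutation.

(** * The contravariant form *)

Section DotForm.
Variables (F : fieldType) (n m : nat).
Implicit Types x y z : tens F n m.

(** Symmetric and bilinear, not Hermitian: nothing excludes isotropic vectors, and non-degeneracy on
    a subspace has to be proved. *)
Definition dot x y : F := \sum_J x J * y J.

Lemma dotC x y : dot x y = dot y x.
Proof. by apply: eq_bigr => J _; rewrite mulrC. Qed.

Lemma dotDl x y z : dot (x + y) z = dot x z + dot y z.
Proof. by rewrite -big_split; apply: eq_bigr => J _; rewrite ffunE mulrDl. Qed.

Lemma dotZl a x z : dot (a *: x) z = a * dot x z.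
Proof. by rewrite mulr_sumr; apply: eq_bigr => J _; rewrite ffunE mulrA. Qed.

Lemma dotDr x y z : dot z (x + y) = dot z x + dot z y.
Proof. by rewrite dotC dotDl !(dotC z). Qed.

Lemma dotZr a x z : dot z (a *: x) = a * dot z x.
Proof. by rewrite dotC dotZl dotC. Qed.

Lemma dot0l x : dot 0 x = 0.
Proof. by rewrite -[X in dot X](scale0r 0) dotZl mul0r. Qed.

Lemma dot0r x : dot x 0 = 0.
Proof. by rewrite dotC dot0l. Qed.

Lemma dotNl x y : dot (- x) y = - dot x y.
Proof. by rewrite -scaleN1r dotZl mulN1r. Qed.

Lemma dotNr x y : dot x (- y) = - dot x y.
Proof. by rewrite dotC dotNl dotC. Qed.

Lemma dot_suml I (r : seq I) P (f : I -> tens F n m) y :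
  dot (\sum_(i <- r | P i) f i) y = \sum_(i <- r | P i) dot (f i) y.
Proof. by elim/big_rec2: _ => [|i u v _ <-]; rewrite ?dot0l ?dotDl. Qed.

Lemma dot_sumr I (r : seq I) P (f : I -> tens F n m) y :
  dot y (\sum_(i <- r | P i) f i) = \sum_(i <- r | P i) dot y (f i).
Proof. by rewrite dotC dot_suml; apply: eq_bigr => i _; rewrite dotC. Qed.

Lemma dot_basis x J : dot x (tens_basis F J) = x J.
Proof.
rewrite /dot (bigD1 J) //= big1 ?addr0 ?ffunE ?eqxx ?mulr1 // => K nK.
by rewrite ffunE (negPf nK) mulr0.
Qed.

Definition adjoint (f g : 'End(tens F n m)) := forall x y, dot (f x) y = dot x (g y).

Lemma adjoint_tens_op A B : (forall r, B r = (A r)^T) -> adjoint (tens_op A) (tens_op B).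
Proof.
move=> hB x y; rewrite /dot !lfunE /=.
under eq_bigr do rewrite ffunE mulr_suml.
rewrite exchange_big /=; apply: eq_bigr => K _; rewrite ffunE mulr_sumr.
apply: eq_bigr => J _.
rewrite [\prod_(r < m) B r _ _](eq_bigr (fun r => A r (tnth J r) (tnth K r))).
  by ring.
by move=> r _; rewrite hB mxE.
Qed.

Lemma adjoint_add f f' g g' : adjoint f g -> adjoint f' g' -> adjoint (f + f') (g + g').
Proof. by move=> h h' x y; rewrite !add_lfunE dotDl dotDr h h'. Qed.

Lemma adjoint_scale a f g : adjoint f g -> adjoint (a *: f) (a *: g).
Proof. by move=> h x y; rewrite !scale_lfunE dotZl dotZr h. Qed.

Lemma adjoint_sum I (r : seq I) (P : pred I) (f g : I -> 'End(tens F n m)) :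
  (forall i, P i -> adjoint (f i) (g i)) ->
  adjoint (\sum_(i <- r | P i) f i) (\sum_(i <- r | P i) g i).
Proof.
move=> h x y; rewrite !sum_lfunE dot_suml dot_sumr.
by apply: eq_bigr => i Pi; apply: h.
Qed.

Lemma Kalpha_trmx (qh : F) i : (Kalpha qh i)^T = Kalpha qh (n := n) i.
Proof. by rewrite /Kalpha /Keps mulmx_diag tr_diag_mx. Qed.

Lemma KalphaV_trmx (qh : F) i : (KalphaV qh i)^T = KalphaV qh (n := n) i.
Proof. by rewrite /KalphaV /Keps mulmx_diag tr_diag_mx. Qed.

Lemma adjoint_coprod (qh : F) i a b :
  adjoint (coprod (n := n) qh m i (delta_mx a b)) (coprod qh m i (delta_mx b a)).
Proof.
rewrite /coprod; apply: adjoint_sum => p _; apply: adjoint_tens_op => r.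
by case: ifP => _; [|case: ifP => _]; rewrite ?trmx_delta ?Kalpha_trmx ?KalphaV_trmx.
Qed.

Lemma adjoint_K (c : F) i : adjoint (tens_op (fun=> Keps c i)) (tens_op (fun=> Keps c i)).
Proof. by apply: adjoint_tens_op => r; rewrite tr_diag_mx. Qed.

Lemma adjoint_tens_op2 k i j i' j' : adjoint (tens_op2 k (delta_mx i j) (delta_mx i' j'))
   (tens_op2 (m := m) k (delta_mx j i) (delta_mx j' i')).
Proof.
apply: adjoint_tens_op => r.
by case: ifP => _; [|case: ifP => _]; rewrite ?trmx_delta ?tr_scalar_mx.
Qed.

Lemma adjoint_Rcheck (q : F) k : adjoint (Rcheck n q k) (Rcheck n q k).
Proof.
rewrite /Rcheck; apply: adjoint_add; first apply: adjoint_add.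
- by apply: adjoint_scale; apply: adjoint_sum => i _; apply: adjoint_tens_op2.
- rewrite [X in adjoint _ X](exchange_big_dep xpredT) //=.
  apply: adjoint_sum => i _; rewrite [X in adjoint _ X](eq_bigl (fun j => i != j)); last by move=> j; rewrite eq_sym.
  by apply: adjoint_sum => j _; apply: adjoint_tens_op2.
- apply: adjoint_scale; apply: adjoint_sum => i _; apply: adjoint_sum => j _.
  exact: adjoint_tens_op2.
Qed.

Lemma adjoint_rn (q : F) k : adjoint (rn (Rcheck n q) k) (rn (Rcheck n q) k).
Proof.
have [/rn_ord[i ->]|h] := ltnP k m.-1; first by rewrite rnE; apply: adjoint_Rcheck.
by rewrite rn_out // => x y; rewrite !zero_lfunE dot0l dot0r.
Qed.

Lemma adjoint_jm (q : F) k : adjoint (jm (Rcheck n q) k) (jm (Rcheck n q) k).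
Proof.
elim: k => [|k IH] x y /=; first by rewrite !id_lfunE.
by rewrite -/(jm _ k) !comp_lfunE adjoint_rn IH adjoint_rn.
Qed.

End DotForm.

(** * Fitting's lemma *)

Section LinearAlgebra.
Variables (K : fieldType) (V : vectType K).

(** The images of U under the powers of f decrease and are constant from the N-th on, so the N-th
    iterate at x is the 2N-th iterate at some z in U. *)
Lemma fitting_step (f : 'End(V)) (U : {vspace V}) N : (f @: U <= U)%VS ->
  (\dim {:V} <= N)%N ->
  forall x, x \in U -> exists2 z, z \in U & iter N f (x - iter N f z) = 0.
Proof.
move=> fU dN.
pose im k := iter k (fun W => f @: W)%VS U.
have im_sub k : (im k.+1 <= im k)%VS by elim: k => [|k IH] //=; exact: limgS.
have stab k : (\dim (im k) + k <= \dim U)%N \/ im k.+1 = im k.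
  elim: k => [|k [IH|IH]]; [by left; rewrite addn0| |by right; apply: (congr1 (fun W => f @: W)%VS IH)].
  have [e|ne] := eqVneq (im k.+1) (im k); first by right; apply: (congr1 (fun W => f @: W)%VS e).
  left; suff : (\dim (im k.+1) < \dim (im k))%N by lia.
  rewrite ltn_neqAle dimvS // andbT; apply: contra ne => /eqP e.
  by rewrite eqEdim im_sub e leqnn.
have stabN : im N.+1 = im N.
  case: (stab N) => // h; have d0 : \dim (im N) = 0%N.
    by have := dimvS (subvf U); lia.
  apply/eqP; rewrite eqEdim im_sub d0 leq0n andbT; by [].
have stab2 k : im (k + N)%N = im N by elim: k => //= k ->.
have imP k x : reflect (exists2 z, z \in U & x = iter k f z) (x \in im k).
  apply: (iffP idP); elim: k x => [|k IH] x /=.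
  - by exists x.
  - by move=> /memv_imgP[y /IH[z zU ->] ->]; exists z.
  - by case=> z zU ->.
  - by case=> z zU ->; apply: memv_img; apply: IH; exists z.
move=> x xU; have : iter N f x \in im N by apply/imP; exists x.
rewrite -(stab2 N) => /imP[z zU e]; exists z => //.
have iterB k u v : iter k f (u - v) = iter k f u - iter k f v.
  by elim: k => //= k ->; rewrite linearB.
by rewrite iterB e -iterD subrr.
Qed.

End LinearAlgebra.

Section QPowers.
Variables (F : fieldType) (q : F) (q0 : q != 0) (hq : forall k : nat, (0 < k)%N -> q ^+ k != 1).

Lemma expq_inj (a b : int) : q ^ a = q ^ b -> a = b.
Proof.
have key (c : int) : q ^ c = 1 -> c = 0.
  case: c => [[//|k]|k] e.
    by have := hq (ltn0Sn k); rewrite -e eqxx.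
  have := hq (ltn0Sn k); rewrite -[_ ^+ _]invrK.
  by rewrite -[(_ ^+ _)^-1]/(q ^ (Negz k)) e invr1 eqxx.
move=> e; apply/eqP; rewrite -subr_eq0; apply/eqP/key.
by rewrite expfzDr // e -expfzDr // subrr expr0z.
Qed.

End QPowers.

Lemma ex_maxord (n : nat) (P : pred 'I_n) : (exists i, P i) ->
  exists2 j, P j & forall i : 'I_n, (j < i)%N -> ~~ P i.
Proof.
case=> i0 Pi0; case: (arg_maxnP (fun i : 'I_n => i : nat) Pi0) => j Pj jmax.
by exists j => // i ji; apply: contraL ji => /jmax; rewrite -leqNgt.
Qed.

(* A sequence r of row indices grows a diagram box by box; box number k is put
   at the end of row r k. *)
Section RowWords.
Variable r : nat -> nat.

Definition rshape (k j : nat) : nat := count_mem j [seq r i | i <- iota 0 k].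

Lemma rshapeS k j : rshape k.+1 j = (rshape k j + (r k == j))%N.
Proof. by rewrite /rshape -addn1 iotaD map_cat count_cat /= addn0. Qed.

Definition rcontent (k : nat) : int := (rshape k (r k))%:Z - (r k)%:Z.

(** The lattice word condition: all diagrams up to step m are partitions. *)
Definition rlattice m := forall k, (k <= m)%N -> forall j, (rshape k j.+1 <= rshape k j)%N.

(** The ends of the rows of a partition have distinct contents, as row length minus row index
    strictly decreases. *)
Lemma rshape_inj m k i j : rlattice m -> (k <= m)%N ->
  (rshape k i)%:Z - i%:Z = (rshape k j)%:Z - j%:Z -> i = j.
Proof.
move=> lat km.
have mono a d : (rshape k (a + d) <= rshape k a)%N.
  by elim: d => [|d IH]; rewrite ?addn0 // addnS (leq_trans (lat _ km _)).
wlog ij : i j / (i <= j)%N.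
  by move=> h e; have [/h|/ltnW/h] := leqP i j; [|symmetry]; auto.
move=> e; have := mono i (j - i)%N; rewrite subnKC // => h; lia.
Qed.

End RowWords.

(** * Jucys-Murphy elements and the last letter of a word *)

Section LastLetter.
Variables (F : fieldType) (n m : nat).
Implicit Types (x : tens F n m.+1) (s : seq 'I_n).

Definition slr l x : tens F n m := mk m (fun s => ev x (rcons s l)).

Lemma ev_slr l x s : ev (slr l x) s = ev x (rcons s l).
Proof.
rewrite ev_mk; case: eqP => // /eqP h; rewrite ev_size // size_rcons.
by move: h; lia.
Qed.

Lemma slr_eq0 x : (forall l, slr l x = 0) -> x = 0.
Proof.
move=> h; apply: ev_ext => s; case/lastP: s => // s l _.
by rewrite -ev_slr h !ev0.
Qed.

End LastLetter.

Section HighestWeight.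
Variables (F : fieldType) (n : nat) (q qh : F) (q0 : q != 0).
Hypotheses (hq : forall k : nat, (0 < k)%N -> q ^+ k != 1) (hqh : qh ^+ 2 = q).
Local Notation R m := (rn (@Rcheck F n m q)).
Local Notation Y m := (jm (@Rcheck F n m q)).
Local Notation dq := (q - q^-1).

Lemma rn_support m k (x : tens F n m) (P : seq 'I_n -> Prop) :
  (forall s t, perm_eq s t -> P s -> P t) ->
  (forall s, ev x s != 0 -> P s) -> forall s, ev (R m k x) s != 0 -> P s.
Proof.
move=> hP hx s; have [hk|hk] := ltnP k m.-1; last by rewrite rn_out // zero_lfunE ev0 eqxx.
have [ss|ss] := eqVneq (size s) m; last by rewrite ev_size ?eqxx.
have [|A [c [d [C [-> sA]]]]] := @split2 _ s k; first by lia.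
rewrite ev_RcheckE //.
have [e1|n1] := eqVneq (ev x (A ++ c :: d :: C)) 0; last by move=> _; apply: hx.
have [e2|n2] := eqVneq (ev x (A ++ d :: c :: C)) 0.
  by rewrite e1 e2 !mulr0 addr0 eqxx.
move=> _; apply: hP (hx _ n2).
by apply/seq.permP => p; rewrite !count_cat /=; lia.
Qed.

Lemma jm_support m k (x : tens F n m) (P : seq 'I_n -> Prop) :
  (forall s t, perm_eq s t -> P s -> P t) ->
  (forall s, ev x s != 0 -> P s) -> forall s, ev (Y m k x) s != 0 -> P s.
Proof.
move=> hP; elim: k x => [|k IH] x hx; first by rewrite /= id_lfunE.
by rewrite jmS; apply: rn_support => //; apply: IH; apply: rn_support.
Qed.

Section Slices.
Variable m : nat.
Implicit Types (x : tens F n m.+1) (s A B : seq 'I_n).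

Lemma slr_rn k l x : (k.+1 < m)%N -> slr l (R m.+1 k x) = R m k (slr l x).
Proof.
move=> hk; apply: ev_ext => s ss.
have [|A [c [d [C [-> sA]]]]] := @split2 _ s k; first by lia.
by rewrite ev_slr !ev_RcheckE // !ev_slr !rcons_cat /= ev_RcheckE.
Qed.

Lemma slr_jm k l x : (k < m)%N -> slr l (Y m.+1 k x) = Y m k (slr l x).
Proof.
elim: k x => [|k IH] x hk; first by rewrite /= !id_lfunE.
by rewrite !jmS slr_rn // IH ?(ltnW hk) // slr_rn.
Qed.

(** [Lop] and [Dop] are the two halves of y_(k+1) = T_k ... T_1 T_1 ... T_k: the first carries a
    letter to the front of the word, the second carries it back. *)
Fixpoint Lop k x := if k is k'.+1 then Lop k' (R m.+1 k' x) else x.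
Fixpoint Dop k x := if k is k'.+1 then R m.+1 k' (Dop k' x) else x.

Lemma jm_Dop_Lop k x : Y m.+1 k x = Dop k (Lop k x).
Proof.
elim: k x => [|k IH] x; first by rewrite /= id_lfunE.
by rewrite jmS IH.
Qed.

(** No letter is below z, so the correction term of Rcheck never occurs; z passes through A at the
    cost of a factor q for every equal letter. *)
Lemma Lop_first k x (z : 'I_n) A B : (z : nat) = 0%N -> size A = k ->
  ev (Lop k x) (z :: A ++ B) = q ^+ count_mem z A * ev x (A ++ z :: B).
Proof.
move=> z0; elim: k x A B => [|k IH] x A B; first by move/size0nil->; rewrite expr0 mul1r.
case/lastP: A => // A a; rewrite size_rcons => -[sA].
rewrite /= cat_rcons IH // ev_Rcheck // z0 ltn0 addr0 cat_rcons.
rewrite -cats1 count_cat /= addn0 exprD -mulrA eq_sym; congr (_ * _).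
by case: eqP => [->|_]; rewrite ?expr1 ?expr0 ?mul1r.
Qed.

(** A correction term of Rcheck at a letter i >= j is an evaluation with a letter larger than i in
    its place, and such evaluations vanish. *)
Lemma Dop_top k X (j : 'I_n) A B (i : 'I_n) : (forall (i : 'I_n) s, (j < i)%N -> ev X (i :: s) = 0) ->
  size A = k -> (j <= i)%N ->
  ev (Dop k X) (A ++ i :: B) = (i == j)%:R * q ^+ count_mem j A * ev X (j :: A ++ B).
Proof.
move=> hX; elim: k A B i => [|k IH] A B i.
  move/size0nil-> => ji /=; rewrite expr0 mulr1.
  have [->|nij] := eqVneq i j; first by rewrite mul1r.
  by rewrite mul0r hX // ltn_neqAle ji andbT eq_sym.
case/lastP: A => // A b; rewrite size_rcons => -[sA] ji.
rewrite /= !cat_rcons ev_Rcheck // -cats1 count_cat /= addn0.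
rewrite (IH A (b :: B) i) //.
have [->|nbi] := eqVneq b i.
  rewrite ltnn addr0 IH //; case: eqP => [->|_]; last by rewrite !mul0r mulr0.
  by rewrite addn1 exprS !mul1r mulrA.
have Hb : (i < b)%N -> ev (Dop k X) (A ++ b :: i :: B) = 0.
  move=> ib; rewrite (IH A (i :: B) b) ?(leq_trans ji (ltnW ib)) //.
  by rewrite -val_eqE /= gtn_eqF ?mul0r // (leq_ltn_trans ji ib).
have -> : (if (i < b)%N then dq * ev (Dop k X) (A ++ b :: i :: B) else 0) = 0.
  by case: ifP => // /Hb ->; rewrite mulr0.
rewrite addr0; have [eij|nij] := eqVneq i j; last by rewrite !mul0r.
by rewrite -eij (negPf nbi) addn0.
Qed.

End Slices.
End HighestWeight.

Lemma count_rcons (T : eqType) (a b : T) s :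
  count_mem a (rcons s b) = ((b == a) + count_mem a s)%N.
Proof. by rewrite -cats1 count_cat /= addn0 addnC. Qed.

(** * Highest weight vectors in generalized eigenspaces *)

Section HighestWeightVectors.
Variables (F : fieldType) (n : nat) (q qh : F) (q0 : q != 0).
Hypotheses (hq : forall k : nat, (0 < k)%N -> q ^+ k != 1) (hqh : qh ^+ 2 = q).
Local Notation R m := (rn (@Rcheck F n m q)).
Local Notation Y m := (jm (@Rcheck F n m q)).

Variable k : nat.

Definition small m (x : tens F n m) :=
  forall s, ev x s != 0 -> all (fun l : 'I_n => l < k)%N s.

Definition has_weight (nu : nat -> nat) m (x : tens F n m) :=
  forall s, ev x s != 0 -> forall i : 'I_n, (i < k)%N -> count_mem i s = nu i.

Definition E_killed m (x : tens F n m) :=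
  forall i : 'I_n.-1, (i.+1 < k)%N -> Uq_E qh m i x = 0.

(** Differs from [highest_weight_vector] in that zero is allowed, the weight is a condition on the
    support, and only letters of gl_k occur; this makes the notion stable under linear combinations,
    Jucys-Murphy operators and removal of the last letter. *)
Definition is_hwv nu m (x : tens F n m) := [/\ small x, has_weight nu x & E_killed x].

(** Generalized eigenvectors, because the operators are not known to be diagonalizable. *)
Definition gen_eigen (c : nat -> int) m (x : tens F n m) :=
  forall j, (j < m)%N -> exists N, iter N (fun y => Y m j y - q ^ (2 * c j) *: y) x = 0.

Lemma E_rn (i : 'I_n.-1) m j x : Uq_E qh m i (R m j x) = R m j (Uq_E qh m i x).
Proof. by apply: (coprod_Rcheck q0 hqh); left. Qed.

Lemma F_rn (i : 'I_n.-1) m j x : Uq_F qh m i (R m j x) = R m j (Uq_F qh m i x).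
Proof. by apply: (coprod_Rcheck q0 hqh); right. Qed.

Lemma small_perm : forall s t : seq 'I_n, perm_eq s t ->
  all (fun l : 'I_n => l < k)%N s -> all (fun l : 'I_n => l < k)%N t.
Proof. by move=> s t /perm_all ->. Qed.

Lemma weight_perm nu : forall s t : seq 'I_n, perm_eq s t ->
  (forall i : 'I_n, (i < k)%N -> count_mem i s = nu i) ->
  (forall i : 'I_n, (i < k)%N -> count_mem i t = nu i).
Proof. by move=> s t /seq.permP e h i ik; rewrite -e h. Qed.

Lemma hwv_rn nu m j x : is_hwv nu x -> is_hwv nu (R m j x).
Proof.
move=> [h1 h2 h3]; split.
- exact: (rn_support q0 small_perm h1).
- exact: (rn_support q0 (@weight_perm nu) h2).
- by move=> i ik; rewrite E_rn h3 // linear0.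
Qed.

Lemma hwv_jm nu m j x : is_hwv nu x -> is_hwv nu (Y m j x).
Proof.
elim: j x => [|j IH] x h; first by rewrite /= id_lfunE.
by rewrite jmS; do !apply/hwv_rn/IH/hwv_rn.
Qed.

Lemma hwvB nu m (x y : tens F n m) a : is_hwv nu x -> is_hwv nu y -> is_hwv nu (x - a *: y).
Proof.
move=> [h1 h2 h3] [g1 g2 g3].
have key s : ev (x - a *: y) s != 0 -> ev x s != 0 \/ ev y s != 0.
  rewrite evD evN evZ; have [->|] := eqVneq (ev x s) 0; last by left.
  by have [->|] := eqVneq (ev y s) 0; [rewrite mulr0 oppr0 addr0 eqxx|right].
split.
- by move=> s /key[]; [apply: h1|apply: g1].
- by move=> s /key[]; [apply: h2|apply: g2].
- by move=> i ik; rewrite linearB linearZ /= h3 ?g3 // scaler0 subr0.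
Qed.

Section TopSlice.
Variable m : nat.
Implicit Types (x : tens F n m.+1) (nu : nat -> nat).

Lemma qh0 : qh != 0. Proof. exact: qh_neq0 q0 hqh. Qed.

Lemma kap_lo (i : 'I_n.-1) : kap qh i (adj_lo i) = qh.
Proof. by rewrite /kap eqxx (negPf (adj_lo_neq_hi i)) mulr1. Qed.

Lemma kap0 (i : 'I_n.-1) l : kap qh i l != 0.
Proof.
have h := qh0; rewrite /kap.
by do 2 case: ifP => _; rewrite ?mulr1 ?mul1r ?mulf_neq0 ?invr_eq0 ?oner_neq0.
Qed.

Lemma prod_kap (i : 'I_n.-1) (s : seq 'I_n) :
  \prod_(j <- s) kap qh i j = qh ^ ((count_mem (adj_lo i) s)%:Z - (count_mem (adj_hi i) s)%:Z).
Proof.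
have h := qh0; elim: s => [|l s IH]; first by rewrite big_nil.
rewrite big_cons IH /= !PoszD.
have -> : kap qh i l = qh ^ ((l == adj_lo i)%:Z - (l == adj_hi i)%:Z).
  rewrite /kap; case: eqP => [->|_]; first by rewrite (negPf (adj_lo_neq_hi i)) mulr1.
  by case: eqP => _; rewrite mul1r.
by rewrite -expfzDr //; congr (_ ^ _); lia.
Qed.

Lemma prod_kap0 (i : 'I_n.-1) (s : seq 'I_n) : \prod_(j <- s) kap qh i j != 0.
Proof. by rewrite prod_kap expfz_neq0 // qh0. Qed.

Lemma slr_E x (i : 'I_n.-1) l : E_killed x -> (i.+1 < k)%N ->
  forall s, kap qh i l * ev (Uq_E qh m i (slr l x)) s =
  - ((\prod_(j <- s) kap qh i j)^-1 * ((l == adj_lo i)%:R * ev x (rcons s (adj_hi i)))).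
Proof.
move=> hE ik s; have := ev_coprod qh i (adj_lo i) (adj_hi i) x (rcons s l).
rewrite -/(Uq_E qh m.+1 i) hE // ev0 e_act_rcons => /esym/eqP.
rewrite addr_eq0 => /eqP <-; rewrite ev_coprod; congr (_ * _).
by apply: e_act_ext => u _; rewrite ev_slr.
Qed.

Lemma sll_E x (i : 'I_n.-1) : E_killed x -> (i.+1 < k)%N ->
  forall s, (\prod_(j <- s) kap qh i j) * ev x (adj_hi i :: s) =
  - (qh^-1 * e_act (kap qh i) (adj_lo i) (adj_hi i) (fun u => ev x (adj_lo i :: u)) s).
Proof.
move=> hE ik s; have := ev_coprod qh i (adj_lo i) (adj_hi i) x (adj_lo i :: s).
rewrite -/(Uq_E qh m.+1 i) hE // ev0 /= eqxx mul1r kap_lo => /esym/eqP.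
by rewrite addr_eq0 => /eqP ->.
Qed.

Lemma hwv_Lop nu j x : is_hwv nu x -> is_hwv nu (Lop q j x).
Proof. by elim: j x => [|j IH] x h //=; apply/IH/hwv_rn. Qed.

(* Both x and Lx are highest weight vectors, so their consecutive components
   are related by the E_a; this determines Lx from its first component. *)
Lemma Lop_slice nu x (a : 'I_n) s : is_hwv nu x -> (a < k)%N ->
  ev (Lop q m x) (a :: s) = q ^ ((nu a)%:Z - 1 - 2 * a%:Z) * ev x (rcons s a).
Proof.
move=> hx; case: a => a an /= ak; elim: a an ak s => [|a IH] an ak s.
  have [ss|ss] := eqVneq (size s) m; last first.
    by rewrite !ev_size ?mulr0 // ?size_rcons /=; move: ss; lia.
  have := @Lop_first _ _ q m m x (Ordinal an) s [::] erefl ss; rewrite cats0 cats1 => ->.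
  have [->|nz] := eqVneq (ev x (rcons s (Ordinal an))) 0; first by rewrite !mulr0.
  have [_ /(_ _ nz (Ordinal an) ak) e _] := hx.
  rewrite -e count_rcons eqxx add1n; congr (_ * _).
  by rewrite -[q ^+ _]/(q ^ (Posz _)); congr (_ ^ _); lia.
have ha : (a < n.-1)%N by lia.
pose i := Ordinal ha.
have elo : Ordinal (ltnW an) = adj_lo i by apply: val_inj.
have ehi : Ordinal an = adj_hi i by apply: val_inj.
have {}IH t := IH (ltnW an) (ltnW ak) t.
rewrite ehi; rewrite elo in IH.
have [_ _ hEx] := hx; have [_ _ hEL] := hwv_Lop m hx.
have P0 := prod_kap0 i s; have h0 := qh0.
have aki : (i.+1 < k)%N by []. have := slr_E (adj_lo i) hEx aki s; rewrite kap_lo eqxx mul1r.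
have := sll_E hEL aki s.
rewrite (@e_act_ext _ _ _ _ _ _ (fun u => q ^ ((nu a)%:Z - 1 - 2 * a%:Z) * ev (slr (adj_lo i) x) u)); last first.
  by move=> u _; rewrite IH ev_slr.
rewrite e_actZ -ev_coprod -/(Uq_E qh m i).
set E := ev _ s; set X := ev (Lop _ _ _) _; set x' := ev x _; set P := bigop.body _ _ _.
set Q := q ^ _ => e1 e2.
have {}P0 : P != 0 := P0.
(* Passing from a to a + 1 multiplies the constant by q^-1 P^-2, where P^2 = q^(nu a - nu (a + 1) +
   1); this turns the exponent nu a - 1 - 2 a into the one for a + 1. *)
have -> : X = Q * (q^-1 * P ^- 2) * x'.
  apply: (mulfI P0); rewrite e1 -hqh.
  have -> : E = - (qh^-1 * (P^-1 * x')) by rewrite -mulrN -e2 mulKf.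
  by field; rewrite P0 h0.
have [->|nz] := eqVneq x' 0; first by rewrite !mulr0.
congr (_ * _); have [_ hw _] := hx.
have := hw _ nz (adj_lo i) (ltnW ak); have := hw _ nz (adj_hi i) ak.
rewrite !count_rcons eqxx [adj_hi i == _]eq_sym (negPf (adj_lo_neq_hi i)) add0n add1n.
move=> c1 c2.
have -> : P ^+ 2 = q ^ ((count_mem (adj_lo i) s)%:Z - (count_mem (adj_hi i) s)%:Z).
  by rewrite /P prod_kap expr2 -expfzMl -expr2 hqh.
rewrite invr_expz -exprN1 /Q -!expfzDr //; congr (_ ^ _).
have {}c1 : (count_mem (adj_hi i) s).+1 = nu a.+1 by rewrite c1.
have {}c2 : (count_mem (adj_lo i) s) = nu a by rewrite c2.
by lia.
Qed.

End TopSlice.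
Lemma slrB m l (x y : tens F n m.+1) a : slr l (x - a *: y) = slr l x - a *: slr l y.
Proof. by apply: ev_ext => s ss; rewrite !(evD, evN, evZ, ev_slr). Qed.

Lemma slr0 m (l : 'I_n) : slr l (0 : tens F n m.+1) = 0.
Proof. by apply: ev_ext => s ss; rewrite !(ev0, ev_slr). Qed.

Section TopSlice.
Variables (m : nat) (nu : nat -> nat) (j : 'I_n).
Hypothesis jk : (j < k)%N.
Implicit Types x : tens F n m.+1.

Definition above x := forall i : 'I_n, (j < i)%N -> slr i x = 0.

Lemma Lop_above x (i : 'I_n) s : is_hwv nu x -> above x -> (j < i)%N ->
  ev (Lop q m x) (i :: s) = 0.
Proof.
move=> hx ab ji; have [ik|ik] := ltnP i k.
  by rewrite (Lop_slice _ hx ik) -ev_slr ab // ev0 mulr0.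
apply/eqP; apply: contraT => nz.
by have [/(_ _ nz) /= /andP[]] := hwv_Lop m hx; rewrite ltnNge ik.
Qed.

Lemma jm_above x : is_hwv nu x -> above x -> above (Y m.+1 m x).
Proof.
move=> hx ab i ji; apply: ev_ext => s ss; rewrite ev_slr jm_Dop_Lop -cats1 ev0.
rewrite (@Dop_top _ _ q m m _ j s [::] i (fun i' t => @Lop_above x i' t hx ab) ss (ltnW ji)).
by rewrite -val_eqE /= gtn_eqF // !mul0r.
Qed.

(** On the largest last letter j the two halves contribute q^(nu j - 1 - 2 j) and q^(nu j - 1). The
    product is q^2 to the power of the content of the box at the end of row j of nu. *)
Lemma jm_top x : is_hwv nu x -> above x ->
  slr j (Y m.+1 m x) = q ^ (2 * ((nu j)%:Z - 1 - j%:Z)) *: slr j x.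
Proof.
move=> hx ab; apply: ev_ext => s ss; rewrite evZ !ev_slr jm_Dop_Lop -{1}cats1.
rewrite (@Dop_top _ _ q m m _ j s [::] j (fun i' t => @Lop_above x i' t hx ab) ss (leqnn j)).
rewrite eqxx mul1r cats0 (Lop_slice _ hx jk) mulrA.
have [->|nz] := eqVneq (ev x (rcons s j)) 0; first by rewrite !mulr0.
have [_ /(_ _ nz j jk) e _] := hx; rewrite -e count_rcons eqxx.
by congr (_ * _); rewrite -[q ^+ _]/(q ^ (Posz _)) -expfzDr //; congr (_ ^ _); lia.
Qed.

Lemma iter_jm_top x a N : is_hwv nu x -> above x ->
  slr j (iter N (fun y => Y m.+1 m y - a *: y) x) =
  (q ^ (2 * ((nu j)%:Z - 1 - j%:Z)) - a) ^+ N *: slr j x.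
Proof.
move=> hx ab.
have h i : is_hwv nu (iter i (fun y => Y m.+1 m y - a *: y) x) /\
    above (iter i (fun y => Y m.+1 m y - a *: y) x).
  elim: i => [|i [h1 h2]] //=; split; first by apply: hwvB => //; apply: (hwv_jm).
  by move=> l jl; rewrite slrB jm_above // h2 // scaler0 subr0.
elim: N => [|N IH] /=; first by rewrite expr0 scale1r.
have [h1 h2] := h N; rewrite slrB jm_top // IH -scalerBl scalerA exprS.
by [].
Qed.

(** By E_i x = 0, applying E_i to the slice at j gives a multiple of the slice at a larger letter,
    and those vanish. *)
Lemma slr_hwv x : is_hwv nu x -> above x ->
  is_hwv (fun i => nu i - (i == j))%N (slr j x).
Proof.
move=> [h1 h2 h3] ab; split.
- by move=> s; rewrite ev_slr => /h1; rewrite all_rcons => /andP[].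
- move=> s; rewrite ev_slr => /h2 h i ik; rewrite -h // count_rcons -val_eqE eq_sym /=.
  by rewrite addKn.
- move=> i ik; apply: ev_ext => s ss; apply: (mulfI (kap0 i j)).
  rewrite (slr_E j h3 ik) ev0 mulr0; have [e|_] := eqVneq j (adj_lo i); last by rewrite mul0r mulr0 oppr0.
  by rewrite mul1r -ev_slr ab ?ev0 ?mulr0 ?oppr0 // e /=.
Qed.

End TopSlice.

Lemma iter_slr c m l j N (x : tens F n m.+1) : (j < m)%N ->
  slr l (iter N (fun y => Y m.+1 j y - c *: y) x) =
  iter N (fun y => Y m j y - c *: y) (slr l x).
Proof. by move=> jm; elim: N => //= N IH; rewrite slrB (slr_jm q0) // IH. Qed.

Lemma gen_eigen_slr c m l (x : tens F n m.+1) : gen_eigen c x -> gen_eigen c (slr l x).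
Proof.
move=> h j jm; have [N e] := h j (ltnW jm).
by exists N; rewrite -iter_slr // e slr0.
Qed.

Lemma ex_top m (x : tens F n m.+1) : x != 0 -> exists2 j : 'I_n, slr j x != 0 & above j x.
Proof.
move=> nz; have [|j jnz jmax] := @ex_maxord _ (fun l => slr l x != 0).
  apply/existsP; apply: contraT; rewrite negb_exists => /forallP h.
  by case/eqP: nz; apply: slr_eq0 => l; apply/eqP; have := h l; rewrite negbK.
by exists j => // i /jmax; rewrite negbK => /eqP.
Qed.

Lemma hwv_slr_neq0 m nu j (x : tens F n m.+1) : is_hwv nu x -> slr j x != 0 ->
  (j < k)%N /\ (0 < nu j)%N.
Proof.
move=> [h1 h2 _]; have [/existsP[s nz] _|z] := boolP [exists s : m.-tuple 'I_n, ev x (rcons s j) != 0].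
  have jk : (j < k)%N by have := h1 _ nz; rewrite all_rcons => /andP[].
  by split=> //; rewrite -(h2 _ nz _ jk) count_rcons eqxx.
case/eqP; apply: ev_ext => s /eqP ss; rewrite ev_slr ev0; apply/eqP.
by have := z; rewrite negb_exists => /forallP/(_ (Tuple ss)); rewrite negbK.
Qed.

Variable r : nat -> nat.

(** The eigenvalue on the top slice determines the content of the box that the last letter adds to
    [rshape r m], and the content determines its row. *)
Lemma hwv_top m nu (x : tens F n m.+1) (j : 'I_n) : rlattice r m.+1 -> is_hwv nu x ->
  gen_eigen (rcontent r) x -> slr j x != 0 -> above j x ->
  (forall i : 'I_n, (i < k)%N -> (nu i - (i == j))%N = rshape r m i) ->
  r m = j /\ forall i : 'I_n, (i < k)%N -> nu i = rshape r m.+1 i.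
Proof.
move=> lat hx gx nz ab IH; have [jk nuj] := hwv_slr_neq0 hx nz.
have [N] := gx m (ltnSn m) => e.
have := iter_jm_top jk (q ^ (2 * rcontent r m)) N hx ab.
rewrite e slr0 => /esym/eqP; rewrite scaler_eq0 (negPf nz) orbF expf_eq0 subr_eq0.
case/andP=> _ /eqP/(expq_inj q0 hq) e2.
have e3 := IH j jk; rewrite eqxx subn1 in e3.
have rj : r m = j.
  apply: (rshape_inj lat (leqnSn m)); rewrite -e3; move: e2; rewrite /rcontent; lia.
split=> // i ik; rewrite rshapeS -IH // rj.
have -> : ((j : nat) == i) = (i == j) by rewrite -val_eqE eq_sym.
by have [->|_] := eqVneq i j; lia.
Qed.

Lemma hwv_shape m nu (x : tens F n m) : rlattice r m -> x != 0 -> is_hwv nu x ->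
  gen_eigen (rcontent r) x -> forall i : 'I_n, (i < k)%N -> nu i = rshape r m i.
Proof.
elim: m nu x => [|m IH] nu x lat nz hx gx.
  move=> i ik; have [_ hw _] := hx; rewrite -(hw [::]) //.
  by apply: contraNneq nz => e; apply/eqP; apply: ev_ext => s /size0nil ->; rewrite e ev0.
have [j jnz ab] := ex_top nz.
have lat' : rlattice r m by move=> a am; apply: lat; apply: leqW.
have [jk _] := hwv_slr_neq0 hx jnz.
have := IH _ _ lat' jnz (slr_hwv hx ab) (gen_eigen_slr j gx).
by case/(hwv_top lat hx gx jnz ab).
Qed.

Lemma iter_shiftB m i c N (x y : tens F n m) a :
  iter N (fun u => Y m i u - c *: u) (x - a *: y) =
  iter N (fun u => Y m i u - c *: u) x - a *: iter N (fun u => Y m i u - c *: u) y.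
Proof.
elim: N => //= N ->; rewrite linearB linearZ /= !scalerBr !scalerA (mulrC c a).
by rewrite !opprB addrACA [RHS]addrACA; congr (_ + _); rewrite addrC.
Qed.

Lemma iter_shift0 m i c N : iter N (fun u => Y m i u - c *: u) (0 : tens F n m) = 0.
Proof. by elim: N => //= N ->; rewrite linear0 scaler0 subr0. Qed.

Lemma gen_eigenB c m (x y : tens F n m) a : gen_eigen c x -> gen_eigen c y ->
  gen_eigen c (x - a *: y).
Proof.
move=> hx hy j jm; have [N eN] := hx j jm; have [M eM] := hy j jm.
exists (N + M)%N; rewrite iter_shiftB addnC iterD eN iter_shift0 sub0r.
by rewrite addnC iterD eM iter_shift0 scaler0 oppr0.
Qed.

Lemma is_hwv_ext (nu nu' : nat -> nat) m (x : tens F n m) :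
  (forall i : 'I_n, (i < k)%N -> nu i = nu' i) -> is_hwv nu x -> is_hwv nu' x.
Proof.
by move=> e [h1 h2 h3]; split=> // s nz i ik; rewrite -e // (h2 s).
Qed.

(** Both vectors have the top letter r (m - 1), and by induction their top slices are proportional.
    The difference y - a x has no slice at this letter any more, although a non-zero vector of this
    kind would have its top slice there. *)
Lemma hwv_uniq m nu nu' (x y : tens F n m) : rlattice r m -> x != 0 ->
  is_hwv nu x -> is_hwv nu' y -> gen_eigen (rcontent r) x -> gen_eigen (rcontent r) y ->
  exists a, y = a *: x.
Proof.
elim: m nu nu' x y => [|m IH] nu nu' x y lat nz hx hy gx gy.
  have x0 : ev x [::] != 0.
    by apply: contraNneq nz => e; apply/eqP; apply: ev_ext => s /size0nil ->; rewrite e ev0.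
  exists (ev y [::] / ev x [::]); apply: ev_ext => s /size0nil ->.
  by rewrite evZ divfK.
have lat' : rlattice r m by move=> a am; apply: lat; apply: leqW.
have top mu (z : tens F n m.+1) j : is_hwv mu z -> gen_eigen (rcontent r) z ->
    slr j z != 0 -> above j z -> r m = j.
  move=> hz gz jnz ab; have [jk _] := hwv_slr_neq0 hz jnz.
  have := hwv_shape lat' jnz (slr_hwv hz ab) (gen_eigen_slr j gz).
  by case/(hwv_top lat hz gz jnz ab).
have [->|ynz] := eqVneq y 0; first by exists 0; rewrite scale0r.
have {}hy : is_hwv nu y.
  apply: (is_hwv_ext _ hy) => i ik.
  by rewrite (hwv_shape lat ynz hy gy) // (hwv_shape lat nz hx gx).
have [j jnz ab] := ex_top nz; have ej := top _ _ _ hx gx jnz ab.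
have [j' jnz' ab'] := ex_top ynz; have ej' := top _ _ _ hy gy jnz' ab'.
have {ej' jnz'}ejj : j' = j by apply: val_inj; rewrite /= -ej'.
rewrite {}ejj in ab'; have [jk _] := hwv_slr_neq0 hx jnz.
have [a ea] := IH _ _ _ _ lat' jnz (slr_hwv hx ab) (slr_hwv hy ab')
  (gen_eigen_slr j gx) (gen_eigen_slr j gy).
exists a; apply/eqP; rewrite -subr_eq0; apply: contraT => znz.
have [l lnz abl] := ex_top znz.
have el := top _ _ _ (hwvB a hy hx) (gen_eigenB a gy gx) lnz abl.
have elj : l = j by apply: val_inj; rewrite /= -el.
by move: lnz; rewrite elj slrB ea subrr eqxx.
Qed.

End HighestWeightVectors.

Lemma ex_support (F : fieldType) n m (x : tens F n m) : x != 0 -> exists s, ev x s != 0.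
Proof.
have [/existsP[s h] _|] := boolP [exists s : m.-tuple 'I_n, ev x s != 0]; first by exists s.
rewrite negb_exists => /forallP h /eqP[]; apply: ev_ext => s /eqP ss.
by rewrite ev0; apply/eqP; have := h (Tuple ss); rewrite negbK.
Qed.

(** * Weight vectors and the existence of highest weight vectors *)

Section Restriction.
Variables (F : fieldType) (n m : nat).
Implicit Types x y : tens F n m.

Definition prj_fun (P : pred (seq 'I_n)) x : tens F n m :=
  [ffun J : m.-tuple 'I_n => if P J then x J else 0].

Fact prj_is_linear P : linear (prj_fun P).
Proof.
move=> a u w; apply/ffunP => J; rewrite !ffunE; case: ifP => // _.
by rewrite scaler0 addr0.
Qed.

HB.instance Definition _ P :=
  GRing.isLinear.Build F (tens F n m) (tens F n m) *:%R (prj_fun P) (prj_is_linear P).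

Definition prj P : 'End(tens F n m) := linfun (prj_fun P).

Lemma ev_prj P x s : ev (prj P x) s = if P s then ev x s else 0.
Proof.
rewrite lfunE /=; have [h|h] := boolP (size s == m); last by rewrite !ev_size // if_same.
by rewrite -[s]/(tval (Tuple h)) !ev_tuple ffunE.
Qed.

Lemma dot_prjr (P : pred (seq 'I_n)) x y : (forall s, ev x s != 0 -> P s) -> dot x (prj P y) = dot x y.
Proof.
move=> hx; apply: eq_bigr => J _; rewrite -!ev_tuple ev_prj.
have [->|/hx ->//] := eqVneq (ev x J) 0.
by rewrite !mul0r.
Qed.

End Restriction.

Lemma e_act_support (F : fieldType) n (kp : 'I_n -> F) a b g s : e_act kp a b g s != 0 ->
  exists A B, s = A ++ a :: B /\ g (A ++ b :: B) != 0.
Proof.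
elim: s g => [|l s IH] g /=; first by rewrite eqxx.
have [e|nz] := eqVneq (e_act kp a b (fun u => g (l :: u)) s) 0.
  rewrite e mulr0 addr0; case: (l =P a) => [->|_]; last by rewrite !mul0r eqxx.
  rewrite mul1r mulf_eq0 negb_or => /andP[_ nz].
  by exists [::], s.
by move=> _; have [A [B [-> h]]] := IH _ nz; exists (l :: A), B.
Qed.

Section WeightVectors.
Variables (F : fieldType) (n : nat) (qh : F) (k : nat).
Local Notation is_hwv nu x := (is_hwv qh k nu x).
Local Notation small x := (small k x).
Local Notation lsum s := (sumn [seq val (i : 'I_n) | i <- s]).

Variable m : nat.
Implicit Types (x y z u : tens F n m) (W : {vspace tens F n m}).

Lemma small_coprod i (a b : 'I_n) x : (a < k)%N -> small x -> small (coprod qh m i (delta_mx a b) x).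
Proof.
move=> ak hx s; rewrite ev_coprod => /e_act_support[A [B [-> /hx]]].
by rewrite !all_cat /= ak => /and3P[-> _ ->].
Qed.

Lemma small_E (i : 'I_n.-1) x : (i.+1 < k)%N -> small x -> small (Uq_E qh m i x).
Proof. by move=> ik; apply: small_coprod; rewrite /= ltnW. Qed.

Lemma small_F (i : 'I_n.-1) x : (i.+1 < k)%N -> small x -> small (Uq_F qh m i x).
Proof. by move=> ik; apply: small_coprod. Qed.

Lemma small_K c i x : small x -> small (tens_op (fun=> Keps c i) x).
Proof.
by move=> hx s; rewrite ev_K mulf_eq0 negb_or => /andP[_ /hx].
Qed.

Definition has_lsum N x := forall s, ev x s != 0 -> lsum s = N.

Lemma weight_E (i : 'I_n.-1) nu x : has_weight k nu x ->
  has_weight k (fun l => nu l + (l == i) - (l == i.+1))%N (Uq_E qh m i x).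
Proof.
move=> hw s; rewrite ev_coprod => /e_act_support[A [B [-> /hw e]]] l lk; rewrite -e //.
rewrite !count_cat /= -!val_eqE /= !(eq_sym (val l)).
by do 2 case: eqP => ? //=; lia.
Qed.

Lemma lsum_E (i : 'I_n.-1) N x s : has_lsum N x -> ev (Uq_E qh m i x) s != 0 -> (lsum s).+1 = N.
Proof.
move=> hl; rewrite ev_coprod => /e_act_support[A [B [-> /hl]]].
by rewrite !map_cat !sumn_cat /=; lia.
Qed.

(** Each E_i lowers the sum of the letters by one, so repeated application ends. The bound on N'
    serves [hwv_norm]. *)
Lemma ex_hwv_below W : 
  (forall i : 'I_n.-1, (i.+1 < k)%N -> forall x, x \in W -> Uq_E qh m i x \in W) ->
  forall N x nu, x \in W -> x != 0 -> small x -> has_weight k nu x -> has_lsum N x ->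
  exists u nu' N', [/\ u \in W, u != 0, is_hwv nu' u, has_lsum N' u & (N' <= N)%N].
Proof.
move=> hW; elim/ltn_ind => N IH x nu xW nz hs hw hl.
have [/forallP h|] := boolP [forall i : 'I_n.-1, (i.+1 < k)%N ==> (Uq_E qh m i x == 0)].
  exists x, nu, N; split=> //; split=> // i ik.
  by apply/eqP; have := h i; rewrite ik.
rewrite negb_forall => /existsP[i]; rewrite negb_imply => /andP[ik nzE].
have lE := @lsum_E i N x ^~ hl.
have N0 : (0 < N)%N.
  rewrite lt0n; apply: contraNneq nzE => N0; apply/eqP; apply: ev_ext => s _.
  by rewrite ev0; apply/eqP; apply: contraT => /lE; rewrite N0.
have [||||u [nu' [N' [h1 h2 h3 h4 h5]]]] :=
   IH N.-1 _ (Uq_E qh m i x) (fun l => nu l + (l == i) - (l == i.+1))%N (hW _ ik _ xW) nzE.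
- by lia.
- exact: small_E.
- exact: weight_E.
- by move=> s /lE <-.
by exists u, nu', N'; split=> //; lia.
Qed.

End WeightVectors.

Section Weights.
Variables (F : fieldType) (n : nat) (q qh : F) (q0 : q != 0).
Hypotheses (hq : forall k : nat, (0 < k)%N -> q ^+ k != 1) (hqh : qh ^+ 2 = q).
Local Notation R m := (rn (@Rcheck F n m q)).

Lemma qh_inj (a b : nat) : qh ^+ a = qh ^+ b -> a = b.
Proof.
move=> e; have : q ^ a%:Z = q ^ b%:Z.
  by rewrite -hqh -[LHS]exprM -[RHS]exprM ![(2 * _)%N]mulnC !exprM e.
by case/(expq_inj q0 hq).
Qed.

Lemma rn_prj m j (P : pred (seq 'I_n)) (x : tens F n m) : (forall s t, perm_eq s t -> P s = P t) ->
  prj F m P (R m j x) = R m j (prj F m P x).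
Proof.
move=> hP; have [hk|hk] := ltnP j m.-1; last by rewrite !rn_out // !zero_lfunE linear0.
apply: ev_ext => s ss; have [|A [c [d [C [-> sA]]]]] := @split2 _ s j; first by lia.
rewrite ev_RcheckE // !ev_prj ev_RcheckE // (hP (A ++ d :: c :: C) (A ++ c :: d :: C)).
  by case: ifP => _; rewrite ?mulr0 ?addr0.
by apply/seq.permP => p; rewrite !count_cat /=; lia.
Qed.

Variables (k m : nat).

(** If two words of the support contain i differently often, then K_i minus a scalar removes one of
    them and keeps the other. The support shrinks until all its words have one weight. *)
Lemma ex_weight_vector (W : {vspace tens F n m}) : (forall i : 'I_n, (i < k)%N -> forall x : tens F n m, x \in W -> Uq_K qh m i x \in W) ->
  forall x : tens F n m, x \in W -> x != 0 ->
  exists y nu, [/\ y \in W, y != 0 & has_weight k nu y].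
Proof.
move=> hW x; have [N] := ubnP #|[set J | x J != 0]|; elim: N x => // N IH x le xW nz.
have [J0 xJ0] : exists J, x J != 0.
  apply/existsP; apply: contraT; rewrite negb_exists => /forallP h.
  by case/eqP: nz; apply/ffunP => J; rewrite ffunE; apply/eqP; have := h J; rewrite negbK.
have [/forallP h|] := boolP [forall J, (x J != 0) ==>
   [forall i : 'I_n, (i < k)%N ==> (count_mem i (val J) == count_mem i (val J0))]].
  exists x, (fun i => count (fun l : 'I_n => (l : nat) == i) (val J0)); split=> // s nzs i ik.
  have ss : size s == m by apply: contraR nzs => ?; rewrite ev_size.
  have := h (Tuple ss); rewrite -ev_tuple nzs /= => /forallP/(_ i); rewrite ik => /eqP e.
  by apply: (etrans e); apply: eq_count => l /=; rewrite -val_eqE.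
rewrite negb_forall => /existsP[J1]; rewrite negb_imply => /andP[xJ1].
rewrite negb_forall => /existsP[i]; rewrite negb_imply => /andP[ik ne].
pose c := qh ^+ count_mem i (val J0); pose y := Uq_K qh m i x - c *: x.
have yE J : y J = (qh ^+ count_mem i (val J) - c) * x J.
  by rewrite /y -!ev_tuple evD evN evZ ev_K mulrBl.
apply: (IH y).
- have : [set J | y J != 0] \proper [set J | x J != 0].
    apply/properP; split; last by exists J0; rewrite !inE ?xJ0 // yE subrr mul0r eqxx.
    by apply/subsetP => J; rewrite !inE yE mulf_eq0 negb_or => /andP[].
  by move/proper_card => h; move: le; rewrite ltnS => /(leq_trans h).
- by rewrite memvB ?memvZ // hW.
- apply: contraNneq ne => /ffunP/(_ J1); rewrite yE ffunE => /eqP.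
  by rewrite mulf_eq0 (negPf xJ1) orbF subr_eq0 => /eqP/qh_inj ->.
Qed.

End Weights.

(** * Simplicity of the joint generalized eigenspaces *)

Section GenEigenspace.
Variables (F : fieldType) (n : nat) (q qh : F) (q0 : q != 0).
Hypotheses (hq : forall k : nat, (0 < k)%N -> q ^+ k != 1) (hqh : qh ^+ 2 = q).
Local Notation R m := (rn (@Rcheck F n m q)).
Local Notation Y m := (jm (@Rcheck F n m q)).
Variable k : nat.
Local Notation is_hwv nu x := (is_hwv qh k nu x).
Local Notation small x := (small k x).
Local Notation letters := (fun s : seq 'I_n => all (fun l : 'I_n => l < k)%N s).
Variable m : nat.
Implicit Types (x y z u : tens F n m) (W : {vspace tens F n m}).

Variable r : nat -> nat.
Hypothesis lat : rlattice r m.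

Definition ysh j : 'End(tens F n m) := Y m j - q ^ (2 * rcontent r j) *: \1%VF.

(** At least the dimension, as Fitting's lemma requires, and positive, so that true eigenvectors are
    killed by [ypow]. *)
Definition gexp : nat := (\dim {:tens F n m}).+1.

Definition ypow j : 'End(tens F n m) := iter gexp (fun f => ysh j \o f)%VF \1%VF.

Lemma yshE j x : ysh j x = Y m j x - q ^ (2 * rcontent r j) *: x.
Proof. by rewrite /ysh !lfun_simp. Qed.

Lemma ypowE j x : ypow j x = iter gexp (ysh j) x.
Proof.
rewrite /ypow; elim: gexp => [|N IH] /=; first by rewrite id_lfunE.
by rewrite comp_lfunE IH.
Qed.

Lemma ypow_ysh j x : ypow j x = iter gexp.-1 (ysh j) (ysh j x).
Proof. by rewrite ypowE /gexp iterSr. Qed.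

(** Joint generalized eigenspace of the first t operators, restricted to words with all letters
    below k; the kernel of the projection expresses [small] as a subspace. *)
Definition Gt t : {vspace tens F n m} :=
  (lker (prj F m (predC letters)) :&: \bigcap_(j < t) lker (ypow j))%VS.

Lemma memGt t x : reflect (small x /\ forall j, (j < t)%N -> ypow j x = 0) (x \in Gt t).
Proof.
apply: (iffP idP).
  rewrite memv_cap memv_ker => /andP[/eqP e]; rewrite memvE => /subv_bigcapP h; split.
    move=> s nz; apply: contraNT nz => nl.
    by have := congr1 (fun y => ev y s) e; rewrite ev_prj /= nl ev0 => ->.
  by move=> j jt; have := h (Ordinal jt) isT; rewrite -memvE memv_ker => /eqP.
case=> hs hy; rewrite memv_cap memv_ker; apply/andP; split.
  apply/eqP; apply: ev_ext => s _; rewrite ev_prj ev0 /=; case: ifP => // nl.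
  by apply/eqP; apply: contraT => /hs; rewrite (negPf nl).
by rewrite memvE; apply/subv_bigcapP => j _; rewrite -memvE memv_ker; apply/eqP; apply: hy.
Qed.

Lemma jm_commute (h : 'End(tens F n m)) : (forall j x, h (R m j x) = R m j (h x)) ->
  forall j x, h (Y m j x) = Y m j (h x).
Proof.
move=> hR j; elim: j => [|j IH] x; first by rewrite /= !id_lfunE.
by rewrite !jmS !hR IH hR.
Qed.

Lemma ysh_commute (h : 'End(tens F n m)) : (forall j x, h (Y m j x) = Y m j (h x)) ->
  forall j x, h (ysh j x) = ysh j (h x).
Proof. by move=> hY j x; rewrite !yshE linearB linearZ /= hY. Qed.

Lemma ypow_commute (h : 'End(tens F n m)) : (forall j x, h (Y m j x) = Y m j (h x)) ->
  forall j x, h (ypow j x) = ypow j (h x).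
Proof.
move=> hY j x; rewrite !ypowE; elim: gexp => //= N IH.
by rewrite (ysh_commute hY) IH.
Qed.

Lemma Gt_stable t (h : 'End(tens F n m)) : (forall j x, h (Y m j x) = Y m j (h x)) ->
  (forall x, small x -> small (h x)) -> forall x, x \in Gt t -> h x \in Gt t.
Proof.
move=> hR hs x /memGt[h1 h2]; apply/memGt; split; first exact: hs.
by move=> j jt; rewrite -(ypow_commute hR) h2 // linear0.
Qed.

Lemma ysh_Y j i x : ysh j (Y m i x) = Y m i (ysh j x).
Proof. by rewrite !yshE linearB [X in _ = _ - X]linearZ /= (jm_comm q0 (Rcheck_hecke n q0 m)). Qed.

Lemma small_jm j x : small x -> small (Y m j x).
Proof. exact: (jm_support q0 (@small_perm n k)). Qed.

Lemma small_ysh j x : small x -> small (ysh j x).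
Proof.
move=> h s; rewrite yshE evD evN evZ; have [e|/h//] := eqVneq (ev x s) 0.
by rewrite e mulr0 oppr0 addr0; apply: small_jm.
Qed.

Lemma Gt_ysh t j x : x \in Gt t -> ysh j x \in Gt t.
Proof. by apply: Gt_stable => [i y|y]; [apply: ysh_Y|apply: small_ysh]. Qed.

(** Only a decomposition modulo the images of the [ypow j] is stated, not that the sum is direct:
    each application pairs it with something that annihilates these images. *)
Lemma fitting t x : small x ->
  exists g, g \in Gt t /\ exists z : nat -> tens F n m, x - g = \sum_(j < t) ypow j (z j).
Proof.
move=> hs; elim: t => [|t [g [gG [z ez]]]].
  exists x; split; first by apply/memGt.
  by exists (fun=> 0); rewrite subrr big_ord0.
have [||w wG ew] := @fitting_step _ _ (ysh t) (Gt t) gexp _ _ g gG.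
- by apply/subvP => _ /memv_imgP[y yG ->]; apply: Gt_ysh.
- exact: leqnSn.
have wG' : ypow t w \in Gt t.
  by rewrite ypowE; elim: gexp => //= N; apply: Gt_ysh.
exists (g - ypow t w); split.
  have /memGt[h1 h2] : g - ypow t w \in Gt t by rewrite memvB.
  apply/memGt; split=> // j; rewrite ltnS leq_eqVlt => /orP[/eqP->|/h2//].
  by rewrite ypowE [in X in _ - X]ypowE.
exists (fun j => if j == t then w else z j); rewrite big_ord_recr /= eqxx opprB addrCA addrC ez.
by congr (_ + _); apply: eq_bigr => j _; rewrite ltn_eqF.
Qed.

Definition G := Gt m.

Lemma adjoint_ypow j : adjoint (ypow j) (ypow j).
Proof.
have ysh_adj : adjoint (ysh j) (ysh j).
  by move=> x y; rewrite !yshE dotDl dotDr dotNl dotNr dotZl dotZr adjoint_jm.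
move=> x y; rewrite !ypowE; elim: gexp x y => //= N IH x y.
by rewrite ysh_adj IH -iterSr.
Qed.

(** Every basis word is an element of G plus images of the self-adjoint operators [ypow j], and
    these kill x; so all coefficients of x vanish. *)
Lemma G_nondeg x : x \in G -> (forall y, y \in G -> dot x y = 0) -> x = 0.
Proof.
move=> /memGt[hs hy] ox; apply/ffunP => J; rewrite ffunE -ev_tuple.
apply/eqP; apply: contraT => nz.
have sJ : small (tens_basis F J).
  by move=> s; rewrite ev_basis; case: (s =P J) => [->|_]; [rewrite (hs _ nz)|rewrite eqxx].
have [g [gG [z ez]]] := fitting m sJ.
case/eqP: nz; rewrite ev_tuple -dot_basis -[tens_basis F J](subrK g) dotDr (ox g gG) addr0 ez.
rewrite dot_sumr big1 // => j _.
by rewrite -adjoint_ypow hy // dot0l.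
Qed.

Lemma G_gen_eigen x : x \in G -> gen_eigen q (rcontent r) x.
Proof.
move=> /memGt[_ hy] j jm; exists gexp; rewrite -(hy j jm) ypowE.
by apply: eq_iter => y; rewrite yshE.
Qed.

Lemma eigen_in_G x : small x -> (forall j, (j < m)%N -> Y m j x = q ^ (2 * rcontent r j) *: x) ->
  x \in G.
Proof.
move=> hs hy; apply/memGt; split=> // j jm; rewrite ypow_ysh yshE hy // subrr.
by elim: (gexp.-1) => //= N ->; rewrite linear0.
Qed.

Lemma Y_gen h : Uq_gl qh k h -> forall j x, h (Y m j x) = Y m j (h x).
Proof.
case=> i ik; apply: jm_commute => j x.
- exact: (E_rn q0 hqh).
- exact: (F_rn q0 hqh).
- exact: (K_Rcheck q0).
- exact: (K_Rcheck q0).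
Qed.

Lemma small_gen h : Uq_gl qh k h -> forall x, small x -> small (h x).
Proof.
case=> i ik x hx; first exact: small_E; first exact: small_F; exact: small_K.
Qed.

Lemma G_stable h : Uq_gl qh k h -> forall x, x \in G -> h x \in G.
Proof. by move=> hh; apply: Gt_stable; [apply: Y_gen|apply: small_gen]. Qed.

Lemma adjoint_gen (h : 'End(tens F n m)) : Uq_gl qh k h -> exists2 h' : 'End(tens F n m), Uq_gl qh k h' & adjoint h h'.
Proof.
case=> i ik.
- by exists (Uq_F qh m i); [apply: Uq_gl_F|apply: adjoint_coprod].
- by exists (Uq_E qh m i); [apply: Uq_gl_E|apply: adjoint_coprod].
- by exists (Uq_K qh m i); [apply: Uq_gl_K|apply: adjoint_K].
- by exists (Uq_KV qh m i); [apply: Uq_gl_KV|apply: adjoint_K].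
Qed.

Definition wsum (nu : nat -> nat) := (\sum_(i < n | (i < k)%N) i * nu i)%N.

Lemma weight_lsum nu x : small x -> has_weight k nu x -> has_lsum (wsum nu) x.
Proof.
move=> hs hw s nz; rewrite /wsum.
transitivity (\sum_(i < n | (i < k)%N) i * count_mem i s)%N; last first.
  by apply: eq_bigr => i ik; rewrite (hw s).
have {nz}sk := hs _ nz; elim: s sk => [|l s IH] /= => [_|/andP[lk /IH ->]].
  by rewrite big1 // => i _; rewrite muln0.
under [RHS]eq_bigr do rewrite mulnDr.
rewrite big_split /=; congr (_ + _)%N.
rewrite (bigD1 l) //= eqxx muln1 big1 ?addn0 // => i /andP[_ /negPf].
by rewrite eq_sym => ->; rewrite muln0.
Qed.

Lemma stable_mem W : stable_sub (Uq_gl qh k) W <->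
  forall h, Uq_gl qh k h -> forall x, x \in W -> h x \in W.
Proof.
split=> [h f hf x xW|h f hf]; first by apply: (subvP (h f hf)); apply: memv_img.
by apply/subvP => _ /memv_imgP[x xW ->]; apply: h.
Qed.

Lemma ex_hwv W : stable_sub (Uq_gl qh k) W -> (W <= G)%VS -> W != 0%VS ->
  exists u nu, [/\ u \in W, u != 0 & is_hwv nu u].
Proof.
move=> /stable_mem hW WG nzW.
have [x xW nx] : exists2 x, x \in W & x != 0.
  by exists (vpick W); rewrite ?memv_pick // vpick0.
have [i ik y|y [nu [yW ny wy]]] := ex_weight_vector q0 hq hqh _ xW nx (k := k).
  by apply: hW; apply: Uq_gl_K.
have sy : small y by have /(subvP WG)/memGt[] := yW.
have hE (i : 'I_n.-1) : (i.+1 < k)%N -> forall z, z \in W -> Uq_E qh m i z \in W.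
  by move=> ik; apply: hW; apply: Uq_gl_E.
have [u [nu' [N' [uW nu0 hu _ _]]]] := ex_hwv_below hE yW ny sy wy (weight_lsum sy wy).
by exists u, nu'.
Qed.

Lemma hwv_G_uniq u u' nu nu' : u \in G -> u' \in G -> u != 0 -> is_hwv nu u -> is_hwv nu' u' ->
  exists a, u' = a *: u.
Proof.
by move=> /G_gen_eigen gu /G_gen_eigen gu' nz hu hu'; apply: (hwv_uniq q0 hq hqh lat nz hu hu').
Qed.

Definition weight_pred (nu : nat -> nat) : pred (seq 'I_n) := fun s =>
  [forall i : 'I_n, (i < k)%N ==> (count_mem i s == nu i)].

(** Vectors of other weights are orthogonal to u. A vector of G of weight nu is itself killed by all
    E_i, since raising it would lead to a highest weight vector with a smaller sum of letters,
    whereas all highest weight vectors of G have the same weight; by uniqueness it is a multiple of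
    u. If u were isotropic, it would be orthogonal to all of G. *)
Lemma hwv_norm u nu : u \in G -> u != 0 -> is_hwv nu u -> dot u u != 0.
Proof.
move=> uG nz hu; have nz' := nz; apply: contraNneq nz => uu; apply/eqP; apply: G_nondeg => // y yG.
have [su wu Eu] := hu; pose P := weight_pred nu.
have PP s : P s -> forall i : 'I_n, (i < k)%N -> count_mem i s = nu i.
  by move=> /forallP h i ik; have := h i; rewrite ik => /eqP.
have Pu s : ev u s != 0 -> P s.
  by move=> nzs; apply/forallP => i; apply/implyP => ik; rewrite (wu s).
rewrite -(dot_prjr _ Pu); set z := prj _ _ P y.
have Pperm s t : perm_eq s t -> P s = P t.
  by move/seq.permP => e; apply: eq_forallb => i; rewrite e.
have zG : z \in G.
  apply: Gt_stable yG; first by apply: jm_commute => j x; apply: (rn_prj q0).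
  by move=> x hx s; rewrite ev_prj; case: ifP => [_ /hx|_]; rewrite ?eqxx.
have sz : small z by have /memGt[] := zG.
have wz : has_weight k nu z.
  by move=> s; rewrite ev_prj; case: ifP => [/PP//|_]; rewrite eqxx.
suff hz : is_hwv nu z.
  by have [a ->] := hwv_G_uniq uG zG nz' hu hz; rewrite dotZr uu mulr0.
split=> // i ik; apply/eqP; apply: contraT => nzE.
have EG : Uq_E qh m i z \in G by apply: G_stable => //; apply: Uq_gl_E.
have lz := weight_lsum sz wz.
have hE (j : 'I_n.-1) : (j.+1 < k)%N -> forall y, y \in G -> Uq_E qh m j y \in G.
  by move=> jk y'; apply: G_stable; apply: Uq_gl_E.
have lEz : has_lsum (wsum nu).-1 (Uq_E qh m i z) by move=> s /(lsum_E lz) <-.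
have [u' [nu' [N' [uG' nu0 hu' lu' le]]]] :=
  ex_hwv_below hE EG nzE (small_E ik sz) (weight_E wz) lEz.
have [su' wu' _] := hu'.
have [s nzs] := ex_support nu0.
have := weight_lsum su' wu' nzs; rewrite (lu' _ nzs).
have -> : wsum nu' = wsum nu.
  apply: eq_bigr => j jk; congr (_ * _)%N.
  by rewrite (hwv_shape q0 hq hqh lat nu0 hu' (G_gen_eigen uG')) // (hwv_shape q0 hq hqh lat nz' hu (G_gen_eigen uG)).
have [t /(lsum_E lz) et] := ex_support nzE.
by move=> e; move: le; rewrite e -et ltnn.
Qed.

Lemma hwv_shape_G u nu : u \in G -> u != 0 -> is_hwv nu u ->
  forall i : 'I_n, (i < k)%N -> nu i = rshape r m i.
Proof.
by move=> uG nz hu; apply: (hwv_shape q0 hq hqh lat nz hu); exact: G_gen_eigen.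
Qed.

Lemma stable_G : stable_sub (Uq_gl qh k) G.
Proof. by apply/stable_mem => h hh x; apply: (G_stable). Qed.

(** A non-zero W contains the highest weight vector u. Its orthogonal complement Z in G is stable
    because the adjoints of generators are generators; were Z non-zero, it would contain u as well,
    contrary to (u, u) being non-zero. *)
Lemma simple_subG W : stable_sub (Uq_gl qh k) W -> (W <= G)%VS -> W = 0%VS \/ W = G.
Proof.
move=> sW WG; have [->|nzW] := eqVneq W 0%VS; [by left|right].
have [u [nu [uW nu0 hu]]] := ex_hwv sW WG nzW.
have uG := subvP WG _ uW; have nuu := hwv_norm uG nu0 hu.
pose b := vbasis W.
pose phi (x : tens F n m) : 'rV[F]_(\dim W) := \row_i dot x b`_i.
have phi_lin : linear phi.
  by move=> a x y; apply/rowP => i; rewrite !mxE dotDl dotZl.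
pose phiL := GRing.isLinear.Build _ _ _ _ phi phi_lin.
pose Phi : {linear tens F n m -> 'rV[F]_(\dim W)} := HB.pack phi phiL.
have PhiE x i : linfun Phi x 0 i = dot x b`_i by rewrite lfunE /= mxE.
have orth x : x \in lker (linfun Phi) -> forall w, w \in W -> dot x w = 0.
  rewrite memv_ker => /eqP e w wW.
  rewrite (coord_vbasis wW) dot_sumr big1 // => i _.
  by rewrite dotZr -PhiE e mxE mulr0.
pose Z := (G :&: lker (linfun Phi))%VS.
have ZP x : reflect (x \in G /\ forall w, w \in W -> dot x w = 0) (x \in Z).
  apply: (iffP idP) => [|[xG ox]]; first by rewrite memv_cap => /andP[-> /orth].
  rewrite memv_cap xG memv_ker; apply/eqP/rowP => i; rewrite PhiE mxE ox //.
  by apply: vbasis_mem; rewrite mem_nth // size_tuple.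
have sZ : stable_sub (Uq_gl qh k) Z.
  apply/stable_mem => h hh x /ZP[xG ox]; apply/ZP; split; first exact: (G_stable).
  move=> w wW; have [h' hh' adj] := adjoint_gen hh.
  by rewrite adj ox //; have /stable_mem := sW; apply.
have Z0 : Z = 0%VS.
  apply/eqP; apply: contraT => nzZ.
  have [u' [nu' [uZ nu0' hu']]] := ex_hwv sZ (capvSl _ _) nzZ.
  have /ZP[uG' ou'] := uZ; have [a ea] := hwv_G_uniq uG' uG nu0' hu' hu.
  by move: nuu; rewrite {1}ea dotZl ou' ?mulr0 ?eqxx.
(* With Z = 0 the pairing with a basis of W is injective on G, which bounds dim G by dim W. *)
apply/eqP; rewrite eqEdim WG -(limg_ker_dim (linfun Phi) G) -/Z Z0 dimv0 add0n.
by rewrite (leq_trans (dimvS (subvf _))) // dimvf dim_matrix mul1r.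
Qed.

Lemma G_simple : G != 0%VS -> simple_highest_weight qh k (rshape r m) G.
Proof.
move=> nzG; split; first by split=> //; [exact: stable_G|exact: simple_subG].
have [u [nu [uG nu0 hu]]] := ex_hwv stable_G (subvv _) nzG.
have [su wu Eu] := hu; exists u => //; split=> // i ik.
apply: ev_ext => s _; rewrite ev_K evZ.
have [->|nz] := eqVneq (ev u s) 0; first by rewrite !mulr0.
by rewrite (wu s) // (hwv_shape_G uG nu0 hu).
Qed.

(** Schur's lemma over any field: the eigenvalue is found on the line of highest weight vectors,
    which X preserves, and the eigenspace is a submodule. *)
Lemma G_scalar (X : 'End(tens F n m)) : G != 0%VS ->
  (forall h, Uq_gl qh k h -> forall x, X (h x) = h (X x)) ->
  (forall x, x \in G -> X x \in G) ->
  exists s, forall g, g \in G -> X g = s *: g.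
Proof.
move=> nzG hX XG.
have [u [nu [uG nu0 hu]]] := ex_hwv stable_G (subvv _) nzG.
have hXu : is_hwv nu (X u).
  have [su wu Eu] := hu; split.
  - by have /memGt[] := XG u uG.
  - move=> s nzs i ik; apply: (qh_inj q0 hq hqh).
    have : Uq_K qh m i (X u) = qh ^+ nu i *: X u.
      rewrite -hX; last exact: Uq_gl_K.
      rewrite -linearZ; congr (X _); apply: ev_ext => t _; rewrite ev_K evZ.
      by have [->|nz] := eqVneq (ev u t) 0; [rewrite !mulr0|rewrite (wu t)].
    move/(congr1 (fun x => ev x s)); rewrite ev_K evZ; exact: mulIf.
  - by move=> i ik; rewrite -hX ?Eu ?linear0 //; apply: Uq_gl_E.
have [s es] := hwv_G_uniq uG (XG u uG) nu0 hu hXu.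
exists s; pose W := (G :&: lker (X - s *: \1%VF))%VS.
have WP x : (x \in W) = (x \in G) && (X x == s *: x).
  by rewrite memv_cap memv_ker !lfun_simp subr_eq0.
have sW : stable_sub (Uq_gl qh k) W.
  apply/stable_mem => h hh x; rewrite !WP => /andP[xG /eqP e].
  by rewrite (G_stable) //= hX // e linearZ.
have [W0|WG] := simple_subG sW (capvSl _ _).
  by move: nu0; rewrite -memv0 -W0 WP uG es eqxx.
by move=> g; rewrite -WG WP => /andP[_ /eqP].
Qed.

End GenEigenspace.

(** * Homomorphisms and isotypic components *)

Section Isotypic.
Variables (F : fieldType) (n : nat) (qh : F) (k : nat).

Definition Uq_hom m m' (f : 'Hom(tens F n m, tens F n m')) :=
  [/\ forall i : 'I_n.-1, (i.+1 < k)%N -> forall x, f (Uq_E qh m i x) = Uq_E qh m' i (f x),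
      forall i : 'I_n.-1, (i.+1 < k)%N -> forall x, f (Uq_F qh m i x) = Uq_F qh m' i (f x),
      forall i : 'I_n, (i < k)%N -> forall x, f (Uq_K qh m i x) = Uq_K qh m' i (f x) &
      forall i : 'I_n, (i < k)%N -> forall x, f (Uq_KV qh m i x) = Uq_KV qh m' i (f x)].

Lemma Uq_hom_gen m m' (f : 'Hom(tens F n m, tens F n m')) : Uq_hom f ->
  (forall h', Uq_gl qh k h' -> exists2 h, Uq_gl qh k h & forall x, f (h x) = h' (f x)) /\
  (forall h, Uq_gl qh k h -> exists2 h', Uq_gl qh k h' & forall x, f (h x) = h' (f x)).
Proof.
move=> [hE hF hK hKV]; split=> h [] i ik.
- by exists (Uq_E qh m i) => [|x]; [apply: Uq_gl_E|apply: hE].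
- by exists (Uq_F qh m i) => [|x]; [apply: Uq_gl_F|apply: hF].
- by exists (Uq_K qh m i) => [|x]; [apply: Uq_gl_K|apply: hK].
- by exists (Uq_KV qh m i) => [|x]; [apply: Uq_gl_KV|apply: hKV].
- by exists (Uq_E qh m' i) => [|x]; [apply: Uq_gl_E|apply: hE].
- by exists (Uq_F qh m' i) => [|x]; [apply: Uq_gl_F|apply: hF].
- by exists (Uq_K qh m' i) => [|x]; [apply: Uq_gl_K|apply: hK].
- by exists (Uq_KV qh m' i) => [|x]; [apply: Uq_gl_KV|apply: hKV].
Qed.

(** The preimage in W of a submodule of the image is 0 or W, and the submodule is the image of this
    preimage. *)
Lemma img_simple m m' (f : 'Hom(tens F n m, tens F n m')) nu W : Uq_hom f ->
  simple_highest_weight qh k nu W ->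
  (f @: W)%VS = 0%VS \/ simple_highest_weight qh k nu (f @: W)%VS.
Proof.
move=> hf [[nzW sW minW] [u uW [nu0 Eu Ku]]].
have [->|nz] := eqVneq (f @: W)%VS 0%VS; [by left|right].
have pre W' : stable_sub (Uq_gl qh k) W' -> (W' <= f @: W)%VS ->
    (W :&: f @^-1: W')%VS = 0%VS \/ (W :&: f @^-1: W')%VS = W.
  move=> sW' W'W; apply: minW; last exact: capvSl.
  apply/stable_mem => h hh x; rewrite !memv_cap -!memv_preim => /andP[xW fx].
  have [h' hh' e] := (Uq_hom_gen hf).2 _ hh.
  by have /stable_mem -> := sW; rewrite //= e; have /stable_mem -> := sW'.
have st0 : stable_sub (Uq_gl qh k) (0%VS : {vspace tens F n m'}).
  by apply/stable_mem => h _ x; rewrite !memv0 => /eqP->; rewrite linear0.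
split; last first.
  exists (f u); first exact: memv_img.
  have [hE hF hK hKV] := hf; split.
  - apply: contra_neq nu0 => fu0; have [e|e] := pre _ st0 (sub0v _).
      by apply/eqP; rewrite -memv0 -e memv_cap uW -memv_preim fu0 memv0 eqxx.
    case/eqP: nz; apply/eqP; rewrite -subv0; apply/subvP => _ /memv_imgP[x xW ->].
    by move: xW; rewrite -{1}e memv_cap -memv_preim => /andP[].
  - by move=> i ik; rewrite -hE // Eu // linear0.
  - by move=> i ik; rewrite -hK // Ku // linearZ.
split=> // [|W' sW' W'W].
  apply/stable_mem => h' hh' _ /memv_imgP[x xW ->].
  have [h hh <-] := (Uq_hom_gen hf).1 _ hh'.
  by apply: memv_img; move/stable_mem: sW; apply.
have [e|e] := pre _ sW' W'W; [left|right].
  apply/eqP; rewrite -subv0; apply/subvP => y yW'.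
  have /memv_imgP[x xW ey] := subvP W'W _ yW'.
  suff : x \in (W :&: f @^-1: W')%VS by rewrite e memv0 ey => /eqP->; rewrite linear0 mem0v.
  by rewrite memv_cap xW -memv_preim -ey.
apply: subv_anti; rewrite W'W; apply/subvP => _ /memv_imgP[x xW ->].
by move: xW; rewrite -{1}e memv_cap -memv_preim => /andP[].
Qed.

Lemma in_isotypic0 m nu : in_isotypic qh k nu (0 : tens F n m).
Proof. by exists [::] => //; rewrite mem0v. Qed.

Lemma in_isotypicD m nu (x y : tens F n m) : in_isotypic qh k nu x ->
  in_isotypic qh k nu y -> in_isotypic qh k nu (x + y).
Proof.
move=> [Ws hWs xW] [Ws' hWs' yW]; exists (Ws ++ Ws').
  by move=> W; rewrite mem_cat => /orP[/hWs|/hWs'].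
by rewrite big_cat memv_add.
Qed.

Lemma in_isotypicZ m nu a (x : tens F n m) : in_isotypic qh k nu x ->
  in_isotypic qh k nu (a *: x).
Proof. by move=> [Ws hWs xW]; exists Ws => //; rewrite memvZ. Qed.

Lemma in_isotypic_simple m nu W (x : tens F n m) : simple_highest_weight qh k nu W -> x \in W ->
  in_isotypic qh k nu x.
Proof.
move=> hW xW; exists [:: W]; last by rewrite big_seq1.
by move=> W'; rewrite inE => /eqP->.
Qed.

Lemma in_isotypic_ind m nu (P : tens F n m -> Prop) : P 0 -> (forall x y, P x -> P y -> P (x + y)) ->
  (forall W x, simple_highest_weight qh k nu W -> x \in W -> P x) ->
  forall x, in_isotypic qh k nu x -> P x.
Proof.
move=> P0 PD PW x [Ws]; elim: Ws x => [|W Ws IH] x hWs.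
  by rewrite big_nil memv0 => /eqP->.
rewrite big_cons => /memv_addP[y yW [z zW ->]]; apply: PD.
  by apply: PW yW; apply: hWs; rewrite inE eqxx.
by apply: IH zW => W' hW'; apply: hWs; rewrite inE hW' orbT.
Qed.

Lemma in_isotypic_img m m' (f : 'Hom(tens F n m, tens F n m')) nu x : Uq_hom f ->
  in_isotypic qh k nu x -> in_isotypic qh k nu (f x).
Proof.
move=> hf; move: x; apply: (@in_isotypic_ind _ _ (fun x => in_isotypic qh k nu (f x))) => [|x y hx hy|W x hW xW].
- by rewrite linear0; apply: in_isotypic0.
- by rewrite linearD; apply: in_isotypicD.
have [e|h] := img_simple hf hW; last by apply: in_isotypic_simple h _; apply: memv_img.
have : f x \in (f @: W)%VS by apply: memv_img.
by rewrite e memv0 => /eqP->; apply: in_isotypic0.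
Qed.

Lemma in_isotypic_ext m (nu nu' : nat -> nat) (x : tens F n m) :
  (forall i : 'I_n, (i < k)%N -> nu i = nu' i) -> in_isotypic qh k nu x -> in_isotypic qh k nu' x.
Proof.
move=> e [Ws hWs xW]; exists Ws => // W /hWs[h1 [u uW [h2 h3 h4]]]; split=> //.
by exists u => //; split=> // i ik; rewrite -e // h4.
Qed.

(* W0 is isomorphic to one of the summands through which x is isotypic. *)
Lemma simple_in_isotypic m nu (W0 : {vspace tens F n m}) :
  simple_sub (Uq_gl qh k) W0 -> (exists2 x, x \in W0 & x != 0 /\ in_isotypic qh k nu x) ->
  exists2 u, u \in W0 & highest_weight_vector qh k nu u.
Proof.
move=> [nz0 s0 min0] [x xW0 [nzx [Ws hWs xWs]]].
have stS (Ws' : seq {vspace tens F n m}) : (forall W, W \in Ws' -> simple_highest_weight qh k nu W) ->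
    stable_sub (Uq_gl qh k) (\sum_(W <- Ws') W)%VS.
  elim: Ws' => [|W Ws' IH] hW; apply/stable_mem => h hh y.
    by rewrite big_nil !memv0 => /eqP->; rewrite linear0.
  rewrite big_cons => /memv_addP[a aW [b bW ->]]; rewrite linearD memv_add //.
    have [[_ sW _] _] : simple_highest_weight qh k nu W by apply: hW; rewrite inE eqxx.
    by move/stable_mem: sW; apply.
  have /IH/stable_mem : forall W', W' \in Ws' -> simple_highest_weight qh k nu W'.
    by move=> W' hW'; apply: hW; rewrite inE hW' orbT.
  by apply.
elim: Ws x xW0 nzx hWs xWs => [|W Ws IH] x xW0 nzx hWs xWs.
  by move: xWs; rewrite big_nil memv0 (negPf nzx).
have hW : simple_highest_weight qh k nu W by apply: hWs; rewrite inE eqxx.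
have hWs' W' : W' \in Ws -> simple_highest_weight qh k nu W'.
  by move=> h; apply: hWs; rewrite inE h orbT.
set S := (\sum_(W <- Ws) W)%VS; have sS := stS _ hWs'; rewrite -/S in sS.
have capst (A B : {vspace tens F n m}) : stable_sub (Uq_gl qh k) A -> stable_sub (Uq_gl qh k) B ->
   stable_sub (Uq_gl qh k) (A :&: B)%VS.
  move=> /stable_mem hA /stable_mem hB; apply/stable_mem => h hh y.
  by rewrite !memv_cap => /andP[/hA-> // /hB->].
have [cap0|cap0] := min0 _ (capst _ _ s0 sS) (capvSl _ _); last first.
  have xS : x \in S by move: xW0; rewrite -{1}cap0 memv_cap => /andP[].
  by apply: (IH x).
have [[nzW sW minW] [u uW [nu0 Eu Ku]]] := hW.
pose Z := (W :&: (W0 + S))%VS.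
have addst (A B : {vspace tens F n m}) : stable_sub (Uq_gl qh k) A -> stable_sub (Uq_gl qh k) B ->
   stable_sub (Uq_gl qh k) (A + B)%VS.
  move=> /stable_mem hA /stable_mem hB; apply/stable_mem => h hh y.
  by move/memv_addP=> [a aA [b bB ->]]; rewrite linearD memv_add ?hA ?hB.
have [capS|capS] := minW _ (capst _ _ sW sS) (capvSl _ _); last first.
  have WS : (W <= S)%VS by rewrite -{1}capS capvSr.
  apply: (IH x) => //; move: xWs; rewrite big_cons -/S => /memv_addP[a aW [b bS ->]].
  by rewrite memvD // (subvP WS).
have [Z0|ZW] := minW _ (capst _ _ sW (addst _ _ s0 sS)) (capvSl _ _).
  move: xWs; rewrite big_cons -/S => /memv_addP[a aW [b bS ex]].
  have aZ : a \in (W :&: (W0 + S))%VS.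
    rewrite memv_cap aW; apply/memv_addP; exists x => //; exists (- b); first by rewrite memvN.
    by rewrite ex addrK.
  move: aZ; rewrite Z0 memv0 => /eqP a0.
  have : x \in (W0 :&: S)%VS by rewrite memv_cap xW0 ex a0 add0r.
  by rewrite cap0 memv0 (negPf nzx).
(* Now S meets both W0 and W trivially while W lies in W0 + S. The component g of u in W0 is the
   vector sought: E_i g and K_i g - q^(nu i / 2) g lie in W0 and in S, hence vanish. *)
have : u \in (W0 + S)%VS by move: uW; rewrite -{1}ZW memv_cap => /andP[].
move/memv_addP=> [g gW0 [z zS eu]].
have key y : y \in W0 -> y \in S -> y = 0.
  by move=> y0 yS; apply/eqP; rewrite -memv0 -cap0 memv_cap y0.
have /stable_mem hs0 := s0; have /stable_mem hsS := sS.
exists g => //; split.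
- apply: contra_neq nu0 => g0; apply/eqP.
  by rewrite -memv0 -capS memv_cap uW eu g0 add0r.
- move=> i ik; apply: key; first by apply: hs0 => //; apply: Uq_gl_E.
  have -> : Uq_E qh m i g = - Uq_E qh m i z.
    by have /eqP := Eu i ik; rewrite eu linearD addr_eq0 => /eqP.
  by rewrite memvN; apply: hsS => //; apply: Uq_gl_E.
- move=> i ik; apply/eqP; rewrite -subr_eq0; apply/eqP; apply: key.
    by rewrite memvB ?memvZ //; apply: hs0 => //; apply: Uq_gl_K.
  have -> : Uq_K qh m i g - qh ^+ nu i *: g = - (Uq_K qh m i z - qh ^+ nu i *: z).
    have /eqP := Ku i ik; rewrite eu linearD scalerDr => /eqP e.
    by apply/eqP; rewrite -addr_eq0 addrACA -opprD e subrr.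
  by rewrite memvN memvB ?memvZ //; apply: hsS => //; apply: Uq_gl_K.
Qed.

End Isotypic.

(** * Standard tableaux, contents and exchanges of neighbouring entries *)

Section BoxGeometry.
Variables (m : nat) (la : seq nat).
Hypothesis hla : is_partition_of m la.
Local Notation box := (box la).
Local Notation row b := (box_row b).
Local Notation col b := (box_col b).
Implicit Types b : box.

Lemma box_eq b b' : row b = row b' -> col b = col b' -> b = b'.
Proof.
case: b b' => i j [i' j']; rewrite /box_row /box_col /= => /val_inj e; subst i'.
by move=> /val_inj ->.
Qed.

Lemma box_ex i j : (i < size la)%N -> (j < nth 0%N la i)%N -> exists b, row b = i /\ col b = j.
Proof.
move=> hi hj; exists (existT _ (Ordinal hi) (Ordinal (hj : (j < nth 0%N la (Ordinal hi))%N)) : box).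
by [].
Qed.

Lemma part_mono i j : (i <= j)%N -> (nth 0%N la j <= nth 0%N la i)%N.
Proof.
move=> ij; have [h|h] := ltnP j (size la); last by rewrite (nth_default _ h).
have /and3P[so _ _] := hla; have [->//|ne] := eqVneq i j.
apply: (sorted_ltn_nth _ _ so) => //; rewrite ?inE; try lia.
by move=> a b c /= ? ?; lia.
Qed.

Lemma box_below i j b : (i <= row b)%N -> (j <= col b)%N -> exists b', row b' = i /\ col b' = j.
Proof.
move=> hi hj; apply: box_ex; first by apply: leq_ltn_trans hi (ltn_ord (tag b)).
apply: leq_trans (part_mono hi); apply: leq_ltn_trans hj (ltn_ord (tagged b)).
Qed.

Lemma card_box : #|{: box}| = m.
Proof.
have /and3P[_ _ /eqP <-] := hla.
rewrite card_tagged !sumnE big_map big_enum [RHS](big_nth 0%N) big_mkord /=.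
by apply: eq_big => [i|i _]; rewrite ?card_ord.
Qed.

Section Tableau.
Variable T : syt la m.
Local Notation t := (val T).

Lemma syt_inj : injective t.
Proof. by have /and3P[/injectiveP] := valP T. Qed.

Lemma syt_row b b' : row b = row b' -> (col b < col b')%N -> (t b < t b')%N.
Proof.
have /and3P[_ /forallP h _] := valP T; move=> e l; have /forallP/(_ b') := h b.
by rewrite e eqxx l.
Qed.

Lemma syt_col b b' : col b = col b' -> (row b < row b')%N -> (t b < t b')%N.
Proof.
have /and3P[_ _ /forallP h] := valP T; move=> e l; have /forallP/(_ b') := h b.
by rewrite e eqxx l.
Qed.

Lemma syt_codom k : k \in codom t.
Proof. by apply: (inj_card_onto syt_inj); rewrite card_box card_ord. Qed.

Definition tb k : box := iinv (syt_codom k).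

Lemma tbK k : t (tb k) = k.
Proof. exact: f_iinv. Qed.

Lemma tK b : tb (t b) = b.
Proof. by apply: syt_inj; rewrite tbK. Qed.

Lemma syt_diag b b' : (row b < row b')%N -> (col b < col b')%N -> ((t b).+1 < t b')%N.
Proof.
move=> hr hc; have [d [dr dc]] := @box_below (row b') (col b) b' (leqnn _) (ltnW hc).
have h1 : (t b < t d)%N by apply: syt_col; rewrite ?dc ?dr.
have h2 : (t d < t b')%N by apply: syt_row; rewrite ?dc ?dr.
exact: leq_ltn_trans h1 h2.
Qed.

Lemma content_diag b b' : content b = content b' ->
  b = b' \/ ((row b < row b')%N /\ (col b < col b')%N) \/ ((row b' < row b)%N /\ (col b' < col b)%N).
Proof.
rewrite /content => e.
have [e1|e1|e1] := ltngtP (row b) (row b').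
- by right; left; split=> //; lia.
- by right; right; split=> //; lia.
- by left; apply: box_eq => //; lia.
Qed.

End Tableau.

(** Boxes of equal content form a diagonal, along which both fillings increase; by induction on k
    the entry k is in the same box of both. The filling [g] is only required to increase towards the
    lower right, because a standard tableau with i and i + 1 exchanged need not be standard. *)
Lemma syt_of_contents (T : syt la m) (g : box -> 'I_m) : injective g ->
  (forall b b', (row b < row b')%N -> (col b < col b')%N -> (g b < g b')%N) ->
  (forall b b', g b = val T b' -> content b = content b') -> forall b, val T b = g b.
Proof.
move=> ginj gdiag gc.
have gonto k : k \in codom g by apply: (inj_card_onto ginj); rewrite card_box card_ord.
suff key N : forall k : 'I_m, (k < N)%N -> forall b, (g b = k) <-> (val T b = k).
  by move=> b; apply/(key m (g b) (ltn_ord _)).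
elim: N => // N IH k; rewrite ltnS leq_eqVlt => /orP[/eqP kN|]; last exact: IH.
have eb : iinv (gonto k) = tb T k.
  set b := iinv _; set b' := tb T k.
  have gb : g b = k by apply: f_iinv. have tb' : val T b' = k by apply: tbK.
  have [//|[[hr hc]|[hr hc]]] := @content_diag b b' (gc _ _ (etrans gb (esym tb'))).
    have := syt_diag T hr hc; rewrite tb' => h.
    have hN : (val T b < N)%N by rewrite -kN; lia.
    have [_ /(_ erefl)] := IH _ hN b.
    by rewrite gb => e; move: h; rewrite -e; lia.
  have := gdiag _ _ hr hc; rewrite gb => h.
  have hN : (g b' < N)%N by rewrite -kN.
  have [/(_ erefl) e _] := IH _ hN b'.
  by move: h; rewrite -e tb' ltnn.
move=> b; split=> e.
  have -> : b = iinv (gonto k) by apply: ginj; rewrite f_iinv.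
  by rewrite eb tbK.
have -> : b = tb T k by apply: (@syt_inj T); rewrite tbK.
by rewrite -eb f_iinv.
Qed.

Section Swap.
Variables (T : syt la m) (i : 'I_m.-1).
Local Notation b0 := (tb T (adj_lo i)).
Local Notation b1 := (tb T (adj_hi i)).

Definition swap_fun : {ffun box -> 'I_m} := [ffun b => adj_tperm i (val T b)].

(** Defaults to T when the exchange does not give a standard tableau. *)
Definition swap_syt : syt la m := insubd T swap_fun.

Definition swappable := (row b0 != row b1) && (col b0 != col b1).

Lemma adj_pair b b' : (val T b, val T b') = (adj_lo i, adj_hi i) -> b = b0 /\ b' = b1.
Proof. by case=> e e'; rewrite -e -e' !tK. Qed.

Lemma swap_is_syt : swappable -> is_syt swap_fun.
Proof.
move=> /andP[nr nc]; apply/and3P; split.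
- by apply/injectiveP => b b'; rewrite !ffunE => /perm_inj/syt_inj.
- apply/forallP => b; apply/forallP => b'; apply/implyP => /andP[/eqP er lc].
  rewrite !ffunE; apply: adj_tperm_lt; first exact: syt_row.
  by apply: contra_neq nr => /adj_pair[<- <-].
- apply/forallP => b; apply/forallP => b'; apply/implyP => /andP[/eqP er lc].
  rewrite !ffunE; apply: adj_tperm_lt; first exact: syt_col.
  by apply: contra_neq nc => /adj_pair[<- <-].
Qed.

Lemma swap_sytE b : swappable -> val swap_syt b = adj_tperm i (val T b).
Proof. by move/swap_is_syt => h; rewrite /swap_syt val_insubd h ffunE. Qed.

Lemma swap_content_neq : content b0 != content b1.
Proof.
apply/eqP => /content_diag[e|[[hr hc]|[hr hc]]].
- by have := adj_lo_neq_hi i; rewrite -(tbK T (adj_lo i)) e tbK eqxx.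
- by have := syt_diag T hr hc; rewrite !tbK /=; lia.
- by have := syt_diag T hr hc; rewrite !tbK /=; lia.
Qed.

Lemma swappable_content : swappable ->
  content b1 != content b0 + 1 /\ content b1 != content b0 - 1.
Proof.
move=> /andP[/eqP nr /eqP nc]; have h0 := tbK T (adj_lo i); have h1 := tbK T (adj_hi i).
have [hr|hr|//] := ltngtP (row b0) (row b1); have [hc|hc|//] := ltngtP (col b0) (col b1).
- by have := syt_diag T hr hc; rewrite h0 h1 /=; lia.
- by split; rewrite /content; lia.
- by split; rewrite /content; lia.
- by have := syt_diag T hr hc; rewrite h0 h1 /=; lia.
Qed.

Lemma row_content : row b0 = row b1 -> (content b0 < content b1)%R.
Proof.
move=> er; have h0 := tbK T (adj_lo i); have h1 := tbK T (adj_hi i).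
have [hc|hc|hc] := ltngtP (col b0) (col b1); first by rewrite /content er; lia.
- by have := syt_row T (esym er) hc; rewrite h0 h1 /=; lia.
- have := congr1 (val T) (box_eq er hc); rewrite h0 h1 => /(congr1 val) /=; lia.
Qed.

Lemma col_content : col b0 = col b1 -> (content b1 < content b0)%R.
Proof.
move=> er; have h0 := tbK T (adj_lo i); have h1 := tbK T (adj_hi i).
have [hc|hc|hc] := ltngtP (row b0) (row b1); first by rewrite /content er; lia.
- by have := syt_col T (esym er) hc; rewrite h0 h1 /=; lia.
- have := congr1 (val T) (box_eq hc er); rewrite h0 h1 => /(congr1 val) /=; lia.
Qed.

End Swap.

(** Induction on the length of the permutation [g T] taking the entries of T to those of T'. At a
    descent i, the boxes of i and i + 1 are filled in opposite orders by T and T', so they share no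
    row or column; monotonicity of c gives i and i + 1 the same colour. *)
Lemma swap_connected (c : nat -> nat) (P : syt la m -> Prop) :
  (forall i j, (i <= j)%N -> (c i <= c j)%N) ->
  (forall (T : syt la m) (i : 'I_m.-1), c i = c i.+1 -> swappable T i -> P T -> P (swap_syt T i)) ->
  forall T T' : syt la m, (forall b, c (val T b) = c (val T' b)) -> P T -> P T'.
Proof.
move=> cm step T T' cl.
pose g (T : syt la m) := perm (inj_comp (@syt_inj T') (can_inj (tbK T))).
have gE U k : g U k = val T' (tb U k) by rewrite permE.
have [N] := ubnP (perm_length (g T)); elim: N T cl => // N IH T cl le PT.
have [/existsP[i desc]|] := boolP [exists i, (g T (adj_hi i) < g T (adj_lo i))%N]; last first.
  rewrite negb_exists => /forallP h.
  have g1 : g T = 1%g by apply: perm_no_descent => i; rewrite leqNgt h.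
  suff -> : T' = T by [].
  apply/val_inj/ffunP => b; have := gE T (val T b).
  by rewrite g1 perm1 tK => <-.
have h0 := tbK T (adj_lo i); have h1 := tbK T (adj_hi i); rewrite !gE in desc.
have nsw : swappable T i.
  apply/andP; split; apply/eqP => e.
    have [hc|hc|hc] := ltngtP (col (tb T (adj_lo i))) (col (tb T (adj_hi i))).
    - by have := syt_row T' e hc; lia.
    - by have := syt_row T (esym e) hc; rewrite h0 h1 /=; lia.
    - by move: desc; rewrite (box_eq e hc) ltnn.
  have [hc|hc|hc] := ltngtP (row (tb T (adj_lo i))) (row (tb T (adj_hi i))).
  - by have := syt_col T' e hc; lia.
  - by have := syt_col T (esym e) hc; rewrite h0 h1 /=; lia.
  - by move: desc; rewrite (box_eq hc e) ltnn.
have ci : c i = c i.+1.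
  have e0 := cl (tb T (adj_lo i)); have e1 := cl (tb T (adj_hi i)).
  have := cm _ _ (ltnW desc); rewrite -e0 -e1 h0 h1 /= => le1.
  by apply/eqP; rewrite eqn_leq le1 cm.
apply: (IH (swap_syt T i)) (step _ _ ci nsw PT).
- move=> b; rewrite swap_sytE // -cl val_adj_tperm.
  by case: eqP => [->|_]; [rewrite -ci|case: eqP => [->|]].
- have -> : g (swap_syt T i) = (adj_tperm i * g T)%g.
    apply/permP => k; rewrite permM !gE; congr (val T' _).
    apply: (@syt_inj (swap_syt T i)); rewrite tbK swap_sytE // tbK.
    by rewrite /adj_tperm tpermK.
  by rewrite -ltnS -(perm_length_descent (i := i)) ?gE // (leq_trans le).
Qed.

End BoxGeometry.

Section SwapMore.
Variables (m : nat) (la : seq nat) (hla : is_partition_of m la).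
Local Notation col b := (box_col b).
Implicit Types (T : syt la m) (i : 'I_m.-1).

Lemma tb_swap_lo T i : swappable hla T i -> tb hla (swap_syt T i) (adj_lo i) = tb hla T (adj_hi i).
Proof.
move=> sw; apply: (@syt_inj _ _ (swap_syt T i)); rewrite tbK (swap_sytE _ sw) tbK.
by rewrite /adj_tperm tpermR.
Qed.

Lemma tb_swap_hi T i : swappable hla T i -> tb hla (swap_syt T i) (adj_hi i) = tb hla T (adj_lo i).
Proof.
move=> sw; apply: (@syt_inj _ _ (swap_syt T i)); rewrite tbK (swap_sytE _ sw) tbK.
by rewrite /adj_tperm tpermL.
Qed.

Lemma swappable_swap T i : swappable hla T i -> swappable hla (swap_syt T i) i.
Proof.
move=> sw; rewrite /swappable tb_swap_lo // tb_swap_hi //.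
by rewrite eq_sym (eq_sym (col _)).
Qed.

Lemma swap_sytK T i : swappable hla T i -> swap_syt (swap_syt T i) i = T.
Proof.
move=> sw; apply/val_inj/ffunP => b.
by rewrite (swap_sytE _ (swappable_swap sw)) (swap_sytE _ sw) /adj_tperm tpermK.
Qed.

Lemma swap_neq T i : swappable hla T i -> swap_syt T i != T.
Proof.
move=> sw; apply/eqP => e; have := swap_sytE (tb hla T (adj_lo i)) sw.
rewrite e tbK /adj_tperm tpermL => /eqP; rewrite (negPf (adj_lo_neq_hi i)) //.
Qed.

Lemma swap_class (c : nat -> nat) T i b : c i = c i.+1 -> swappable hla T i ->
  c (val (swap_syt T i) b) = c (val T b).
Proof.
move=> ci sw; rewrite (swap_sytE _ sw) val_adj_tperm.
by case: eqP => [->|_]; [rewrite -ci|case: eqP => [->|]].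
Qed.

Lemma sum_swap (X : pred (box la)) T i : swappable hla T i ->
  X (tb hla T (adj_lo i)) -> ~~ X (tb hla T (adj_hi i)) ->
  (\sum_(b | X b) val (swap_syt T i) b = (\sum_(b | X b) val T b).+1)%N.
Proof.
move=> sw X0 X1; rewrite (bigD1 _ X0) [in RHS](bigD1 _ X0) /= -addSn.
congr (_ + _)%N; first by rewrite (swap_sytE _ sw) tbK /adj_tperm tpermL.
apply: eq_bigr => b /andP[Xb nb]; rewrite (swap_sytE _ sw) val_adj_tperm.
case: eqP => [e|_].
  by case/eqP: nb; apply: (@syt_inj _ _ T); rewrite tbK; apply: val_inj.
case: eqP => // e; move: X1; rewrite -(_ : b = tb hla T (adj_hi i)) ?Xb //.
by apply: (@syt_inj _ _ T); rewrite tbK; apply: val_inj.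
Qed.

Lemma sum_swap' (X : pred (box la)) T i : swappable hla T i ->
  ~~ X (tb hla T (adj_lo i)) -> X (tb hla T (adj_hi i)) ->
  (\sum_(b | X b) val T b = (\sum_(b | X b) val (swap_syt T i) b).+1)%N.
Proof.
move=> sw X0 X1; rewrite -(sum_swap (swappable_swap sw)) ?swap_sytK //.
  by rewrite tb_swap_lo.
by rewrite tb_swap_hi.
Qed.

End SwapMore.

(** * Tableaux with the same coloured filling *)

Section ColumnPair.
Variables (m : nat) (la : seq nat) (hla : is_partition_of m la).
Local Notation row b := (box_row b).
Local Notation col b := (box_col b).
Implicit Types (T : syt la m) (i : 'I_m.-1).
Variable c : nat -> nat.
Hypothesis cm : forall i j : nat, (i <= j)%N -> (c i <= c j)%N.

Definition class_mates T T' := [forall b, c (val T' b) == c (val T b)].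

Lemma class_matesP T T' : reflect (forall b, c (val T' b) = c (val T b)) (class_mates T T').
Proof.
by apply: (iffP forallP) => h b; [apply/eqP/h|apply/eqP/h].
Qed.

Lemma class_swap T T' i : c i = c i.+1 -> swappable hla T' i -> class_mates T T' ->
  class_mates T (swap_syt T' i).
Proof.
by move=> ci sw /class_matesP h; apply/class_matesP => b; rewrite (swap_class _ ci sw).
Qed.

Lemma syt_le T b b' : (row b <= row b')%N -> (col b <= col b')%N -> (val T b <= val T b')%N.
Proof.
move=> lr lc; have [z [rz cz]] := @box_below m la hla (row b') (col b) b' (leqnn _) lc.
apply: (@leq_trans (val T z)).
  move: lr; rewrite leq_eqVlt => /orP[/eqP e|lt]; first by rewrite (@box_eq la b z) ?rz ?cz.
  by apply/ltnW/syt_col; rewrite ?cz ?rz.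
move: lc; rewrite leq_eqVlt => /orP[/eqP e|lt]; first by rewrite (@box_eq la z b') ?rz ?cz.
by apply/ltnW/syt_row; rewrite ?cz ?rz.
Qed.

Lemma c_between (i j k : nat) : (i <= j)%N -> (j <= k)%N -> c i = c k -> c j = c i.
Proof. by move=> h h' e; apply/eqP; rewrite eqn_leq; apply/andP; split; [rewrite e|]; exact: cm. Qed.

(* T' maximizes, within the class of T, the sum of the entries weakly to the
   right of the upper box b in its row. *)
Lemma column_pair T b b' : col b = col b' -> (row b < row b')%N ->
  c (val T b) = c (val T b') ->
  exists T' i, [/\ class_mates T T', c i = c i.+1 &
    col (tb hla T' (adj_lo i)) = col (tb hla T' (adj_hi i))].
Proof.
move=> ec lr cbb'.
(* The box d directly below b has its entry between those of b and b', hence the same colour. *)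
have [d [rd cd]] := @box_below m la hla (row b).+1 (col b) b' lr (eq_leq ec).
have lbd (U : syt la m) : (val U b < val U d)%N by apply: syt_col; rewrite ?cd ?rd.
have cbd : c (val T b) = c (val T d).
  apply/esym; apply: (c_between _ _ cbb'); first exact/ltnW/lbd.
  by apply: syt_le; rewrite ?rd ?cd ?ec.
pose X := [pred x : box la | (row x == row b) && (col b <= col x)%N].
pose S (U : syt la m) := (\sum_(x | X x) val U x)%N.
have T0 : class_mates T T by apply/class_matesP.
case: (arg_maxnP S T0) => T' clT maxT; have hcl := elimT (class_matesP _ _) clT.
have cT' : c (val T' b) = c (val T' d) by rewrite !hcl.
have nosw i : (val T' b <= i)%N -> (i.+1 <= val T' d)%N -> X (tb hla T' (adj_lo i)) ->
    swappable hla T' i -> X (tb hla T' (adj_hi i)).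
  move=> h1 h2 X0 sw; apply: contraT => X1.
  have ci : c i = c i.+1.
    by rewrite (c_between h1 _ cT') ?(ltnW h2) // (c_between _ h2 cT') // leqW.
  by have := maxT _ (class_swap ci sw clT); rewrite /= /S (sum_swap sw X0 X1) ltnn.
have adj x y : (val T' y = (val T' x).+1 :> nat) -> exists i : 'I_m.-1,
    [/\ i = val T' x :> nat, tb hla T' (adj_lo i) = x & tb hla T' (adj_hi i) = y].
  move=> e; have hx : (val T' x < m.-1)%N by have := ltn_ord (val T' y); rewrite e; lia.
  exists (Ordinal hx); split=> //; apply: (@syt_inj _ _ T'); rewrite tbK; apply: val_inj => //=.
(* By maximality the entries from that of b to the last one before that of d all lie in X. This last
   one cannot be exchanged with the entry of d, which lies outside X; being in another row, it is in
   the column of d. *)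
have chain k : (val T' b + k < val T' d)%N -> forall x, val T' x = (val T' b + k)%N :> nat -> X x.
  elim: k => [|k IH] h x.
    rewrite addn0 => /val_inj/syt_inj->; rewrite /= eqxx leqnn.
    by [].
  move=> ex; have [y ey] : exists y, val T' y = (val T' b + k)%N :> nat.
    have hy : (val T' b + k < m)%N by have := ltn_ord (val T' d); lia.
    by exists (tb hla T' (Ordinal hy)); rewrite tbK.
  have Xy : X y by apply: IH => //; lia.
  have [i [ei e0 e1]] : exists i : 'I_m.-1,
    [/\ i = val T' y :> nat, tb hla T' (adj_lo i) = y & tb hla T' (adj_hi i) = x].
    by apply: adj; rewrite ex ey addnS.
  have lxy : (val T' y < val T' x)%N by rewrite ex ey addnS.
  have [sw|] := boolP (swappable hla T' i).
    by rewrite -e1; apply: nosw sw; rewrite ?e0 //; lia.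
  move: Xy => /andP[/eqP ry cy]; rewrite negb_and !negbK e0 e1 => /orP[/eqP er|/eqP ecx].
    rewrite /X /= -er ry eqxx /=.
    have [lt|lt|e] := ltngtP (col y) (col x); [lia| |lia].
    by have := syt_row T' (esym er) lt; lia.
  have [lt|lt|e] := ltngtP (row y) (row x); first last.
  - by rewrite (box_eq e ecx) ltnn in lxy.
  - by have := syt_col T' (esym ecx) lt; lia.
  suff : (val T' d <= val T' x)%N by lia.
  by apply: syt_le; rewrite ?rd ?cd -?ecx // -ry.
have lbd' := lbd T'.
pose k := (val T' d - val T' b).-1.
have hk : (val T' b + k).+1 = val T' d by rewrite /k; lia.
have [y ey] : exists y, val T' y = (val T' b + k)%N :> nat.
  have hy : (val T' b + k < m)%N by have := ltn_ord (val T' d); lia.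
  by exists (tb hla T' (Ordinal hy)); rewrite tbK.
have Xy : X y by apply: (chain k) => //; lia.
have [i [ei e0 e1]] : exists i : 'I_m.-1,
    [/\ i = val T' y :> nat, tb hla T' (adj_lo i) = y & tb hla T' (adj_hi i) = d].
  by apply: adj; rewrite -hk ey.
have ci : c i = c i.+1.
  rewrite (@c_between (val T' b) i (val T' d)) ?(@c_between (val T' b) i.+1 (val T' d)) //; lia.
exists T', i; split=> //; rewrite e0 e1.
have nsw : ~~ swappable hla T' i.
  apply/negP => sw; have : X (tb hla T' (adj_hi i)) by apply: nosw sw; rewrite ?e0 //; lia.
  by rewrite e1 /X /= rd; case/andP => /eqP; lia.
move: Xy => /andP[/eqP ry cy]; move: nsw.
rewrite negb_and !negbK e0 e1 ry rd => /orP[/eqP|/eqP//]; lia.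
Qed.

End ColumnPair.

Lemma sorted_lt_count (s : seq nat) (k i : nat) : sorted leq s -> (i < size s)%N ->
  (nth 0%N s i < k)%N = (i < count (fun x => x < k)%N s)%N.
Proof.
elim: s i => // x s IH i sx; have ge := order_path_min leq_trans sx.
rewrite /=; have [xk|kx] := ltnP x k.
  by case: i => [|i] //= li; rewrite ltnS IH // (path_sorted sx).
have ge' y : y \in x :: s -> (k <= y)%N.
  by rewrite inE => /orP[/eqP->//|/(allP ge)]; apply: leq_trans.
move=> li; rewrite add0n; have -> : count (fun x => x < k)%N s = 0%N.
  apply/eqP; rewrite -leqn0 leqNgt -has_count; apply/hasPn => y ys.
  by rewrite -leqNgt ge' // inE ys orbT.
by rewrite ltn0 ltnNge -/(nth 0%N (x :: s) i) ge' ?mem_nth.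
Qed.

(** * Subtableaux and Gelfand-Tsetlin patterns *)

Section RowWord.
Variables (m : nat) (la : seq nat) (hla : is_partition_of m la).
Local Notation row b := (box_row b).
Local Notation col b := (box_col b).
Implicit Types (T : syt la m) (b : box la).

(* The first p letters of this word encode the subtableau T|_p, which has shape
   [rshape (rword T) p]. *)
Definition rword T (k : nat) : nat :=
  if insub k is Some k' then row (tb hla T k') else 0%N.

Lemma rwordE T b : rword T (val T b) = row b.
Proof. by rewrite /rword valK tK. Qed.

Lemma rshape_card T p j : (p <= m)%N ->
  rshape (rword T) p j = #|[set b : box la | (row b == j) && (val T b < p)%N]|.
Proof.
elim: p => [|p IH] lp.
  by apply/esym/eqP; rewrite cards_eq0; apply/eqP/setP => b; rewrite !inE ltn0 andbF.
rewrite rshapeS IH ?(ltnW lp) // [RHS](cardsD1 (tb hla T (Ordinal lp))) inE tbK ltnSn andbT addnC.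
have -> : rword T p = row (tb hla T (Ordinal lp)) by rewrite /rword insubT.
congr (_ + _)%N.
apply: eq_card => b; rewrite !inE ltnS ltn_neqAle andbCA; congr (_ && _).
by rewrite -[in RHS](inj_eq (@syt_inj _ _ T)) tbK -val_eqE.
Qed.

(** The map [up] sends a box of row j + 1 to the box above it, whose entry is smaller. *)
Lemma rword_lattice T : rlattice (rword T) m.
Proof.
move=> p lp j; rewrite !rshape_card //.
pose up b := odflt b [pick z | (row z == j) && (col z == col b)].
have upP b : row b = j.+1 -> row (up b) = j /\ col (up b) = col b.
  move=> rb; rewrite /up; case: pickP => [z /andP[/eqP-> /eqP->]//|h].
  have [|z [rz cz]] := @box_below m la hla j (col b) b _ (leqnn _); first by rewrite rb.
  by have := h z; rewrite rz cz !eqxx.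
rewrite -(@card_in_imset _ _ up) => [|b b'].
  apply/subset_leq_card/subsetP => _ /imsetP[b + ->]; rewrite !inE => /andP[/eqP rb lb].
  have [ru cu] := upP b rb; rewrite ru eqxx /=; apply: ltn_trans lb.
  by apply: syt_col; rewrite ?ru ?rb.
rewrite !inE => /andP[/eqP rb _] /andP[/eqP rb' _] e.
by apply: box_eq; rewrite ?rb ?rb' // -(upP b rb).2 -(upP b' rb').2 e.
Qed.

Lemma rshape_col T b : rshape (rword T) (val T b) (row b) = col b.
Proof.
rewrite rshape_card ?(ltnW (ltn_ord _)) //.
pose g (j : 'I_(col b)) := odflt b [pick z | (row z == row b) && (col z == j)].
have gP j : row (g j) = row b /\ col (g j) = j.
  rewrite /g; case: pickP => [z /andP[/eqP-> /eqP->]//|h].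
  have [z [rz cz]] := @box_below m la hla (row b) j b (leqnn _) (ltnW (ltn_ord j)).
  by have := h z; rewrite rz cz !eqxx.
rewrite -[RHS]card_ord -(@card_imset _ _ g) => [|j j' e]; last first.
  by apply: val_inj; rewrite /= -(gP j).2 -(gP j').2 e.
apply: eq_card => z; rewrite !inE; apply/andP/imsetP => [[/eqP rz lz]|[j _ ->]].
  have cz : (col z < col b)%N.
    rewrite ltnNge; apply/negP; rewrite leq_eqVlt => /orP[/eqP e|lt].
      by rewrite (box_eq rz (esym e)) ltnn in lz.
    by have := syt_row T (esym rz) lt; lia.
  by exists (Ordinal cz) => //; apply: box_eq; rewrite ?(gP _).1 ?(gP _).2.
split; first by rewrite (gP j).1.
by apply: syt_row; rewrite ?(gP _).1 ?(gP _).2.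
Qed.

Lemma rcontent_rword T b : rcontent (rword T) (val T b) = content b.
Proof. by rewrite /rcontent rwordE rshape_col. Qed.

Lemma rshape_mono (r : nat -> nat) (p p' j : nat) : (p <= p')%N -> (rshape r p j <= rshape r p' j)%N.
Proof.
move=> h; rewrite -(subnKC h); elim: (p' - p)%N => [|d IH]; first by rewrite addn0.
by rewrite addnS rshapeS (leq_trans IH) ?leq_addr.
Qed.

Lemma lt_rshape T p b : (p <= m)%N -> (val T b < p)%N = (col b < rshape (rword T) p (row b))%N.
Proof.
move=> lp; apply/idP/idP => [lt|].
  have := rshape_mono (rword T) (row b) lt; rewrite rshapeS rshape_col rwordE eqxx.
  by rewrite addn1.
apply: contraLR; rewrite -!leqNgt => le.
by have := rshape_mono (rword T) (row b) le; rewrite rshape_col.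
Qed.

Section Pattern.
Variables (n : nat) (I : m.-tuple 'I_n).
Hypothesis hI : sorted leq (map val I).

Definition cut (k : nat) : nat := count (fun i : 'I_n => (i < k)%N) I.

Lemma cut_le k : (cut k <= m)%N.
Proof. by rewrite -[X in (_ <= X)%N](size_tuple I) count_size. Qed.

Lemma lt_cut k (i : 'I_m) : (tnth I i < k)%N = (i < cut k)%N.
Proof.
have li : (i < size I)%N by rewrite size_tuple.
have := @sorted_lt_count _ k i hI; rewrite size_map => /(_ li).
by rewrite (nth_map (tnth I i)) // -tnth_nth count_map => ->.
Qed.

(** Because I is sorted, the letters below k occupy its first [cut k] positions. *)
Lemma gt_patternE T k j : gt_pattern (theta I T) k j = rshape (rword T) (cut k) j.
Proof.
rewrite rshape_card ?cut_le //; apply: eq_card => b; rewrite !inE ffunE.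
by rewrite lt_cut.
Qed.

Lemma theta_eq T T' :
  (forall k, (k <= n)%N -> forall b, (val T' b < cut k)%N = (val T b < cut k)%N) ->
  forall b, tnth I (val T' b) = tnth I (val T b).
Proof.
move=> h b; have e k : (k <= n)%N -> (tnth I (val T' b) < k)%N = (tnth I (val T b) < k)%N.
  by move=> kn; rewrite !lt_cut h.
apply: val_inj; apply/eqP; rewrite eqn_leq -ltnS e ?ltnS ?leqnn ?ltn_ord //=.
by rewrite -ltnS -e ?ltnS ?leqnn ?ltn_ord.
Qed.

End Pattern.
End RowWord.

(** * Fixing the last letters of a word *)

Section Slices.
Variables (F : fieldType) (n m p : nat) (B : seq 'I_n).
Hypothesis sB : (p + size B = m)%N.

Definition slice_fun (x : tens F n m) : tens F n p := mk p (fun s => ev x (s ++ B)).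
Definition append_fun (y : tens F n p) : tens F n m :=
  mk m (fun s => if drop p s == B then ev y (take p s) else 0).

Fact slice_is_linear : linear slice_fun.
Proof. by move=> a x y; apply/ffunP => J; rewrite !ffunE evD evZ. Qed.

Fact append_is_linear : linear append_fun.
Proof.
move=> a x y; apply/ffunP => J; rewrite !ffunE evD evZ.
by case: ifP => _ //; rewrite scaler0 addr0.
Qed.

HB.instance Definition _ := GRing.isLinear.Build F (tens F n m) (tens F n p) *:%R
  slice_fun slice_is_linear.
HB.instance Definition _ := GRing.isLinear.Build F (tens F n p) (tens F n m) *:%R
  append_fun append_is_linear.

Definition slice : 'Hom(tens F n m, tens F n p) := linfun slice_fun.
Definition append : 'Hom(tens F n p, tens F n m) := linfun append_fun.

Lemma ev_slice x s : ev (slice x) s = ev x (s ++ B).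
Proof.
rewrite lfunE /= ev_mk; case: eqP => // /eqP h; rewrite ev_size // size_cat.
by move: h sB; clear; lia.
Qed.

Lemma ev_append y s t : size s = p -> ev (append y) (s ++ t) = if t == B then ev y s else 0.
Proof.
move=> ss; rewrite lfunE /= ev_mk size_cat ss drop_size_cat // take_size_cat //.
by case: (t =P B) => [->|_]; [rewrite sB eqxx|case: ifP].
Qed.

Lemma size_split (s : seq 'I_n) : size s = m -> exists s1 s2, s = s1 ++ s2 /\ size s1 = p.
Proof.
move=> ss; exists (take p s), (drop p s); rewrite cat_take_drop size_takel //.
by rewrite ss -sB leq_addr.
Qed.

Section JucysMurphy.
Variables (q : F) (q0 : q != 0).

Lemma slice_rn j x : (j.+1 < p)%N ->
  slice (rn (@Rcheck F n m q) j x) = rn (@Rcheck F n p q) j (slice x).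
Proof.
move=> jp; apply: ev_ext => s ss.
have [|A [c [d [C [-> sA]]]]] := @split2 _ s j; first by rewrite ss.
by rewrite ev_slice ev_RcheckE // !ev_slice -!catA /= ev_RcheckE.
Qed.

Lemma slice_jm j x : (j < p)%N ->
  slice (jm (@Rcheck F n m q) j x) = jm (@Rcheck F n p q) j (slice x).
Proof.
elim: j x => [|j IH] x jp; first by rewrite /= !id_lfunE.
by rewrite !jmS slice_rn // IH ?(ltnW jp) // slice_rn.
Qed.

Lemma append_rn j y : (j.+1 < p)%N ->
  append (rn (@Rcheck F n p q) j y) = rn (@Rcheck F n m q) j (append y).
Proof.
move=> jp; apply: ev_ext => s /size_split[s1 [s2 [-> ss]]].
have [|A [c [d [C [es sA]]]]] := @split2 _ s1 j; first by rewrite ss.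
rewrite es in ss *; have ss' : size (A ++ d :: c :: C) = p by move: ss; rewrite !size_cat.
rewrite ev_append // ev_RcheckE // -catA /= ev_RcheckE //.
rewrite -[A ++ c :: d :: C ++ s2]/(A ++ (c :: d :: C) ++ s2) -[A ++ d :: c :: C ++ s2]/(A ++ (d :: c :: C) ++ s2).
by rewrite !catA !ev_append //; case: ifP => // _; rewrite !mulr0 addr0.
Qed.

Lemma append_jm j y : (j < p)%N ->
  append (jm (@Rcheck F n p q) j y) = jm (@Rcheck F n m q) j (append y).
Proof.
elim: j y => [|j IH] y jp; first by rewrite /= !id_lfunE.
by rewrite !jmS append_rn // IH ?(ltnW jp) // append_rn.
Qed.

End JucysMurphy.

Section Inert.
Variables (qh : F) (k : nat).
Hypothesis hB : all (fun l : 'I_n => (k <= l)%N) B.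

Lemma inert_notin (a : 'I_n) : (a < k)%N -> a \notin B.
Proof. by move=> ak; apply/negP => /(allP hB); rewrite leqNgt ak. Qed.

Lemma e_act_notin (kp : 'I_n -> F) a b g s : a \notin s -> e_act kp a b g s = 0.
Proof.
move=> h; apply/eqP; apply: contraNT h => /e_act_support[A [B' [-> _]]].
by rewrite mem_cat inE eqxx orbT.
Qed.

Lemma prod_kap_inert (i : 'I_n.-1) : (i.+1 < k)%N -> \prod_(j <- B) kap qh i j = 1.
Proof.
move=> ik; rewrite big1_seq // => l /= lB; rewrite /kap.
rewrite !ifF ?mulr1 //; apply/eqP => e; move: lB; rewrite e; apply/negP/inert_notin => //.
exact: ltnW.
Qed.

Lemma slice_coprod (i : 'I_n.-1) (a b : 'I_n) x : (i.+1 < k)%N -> (a < k)%N ->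
  slice (coprod qh m i (delta_mx a b) x) = coprod qh p i (delta_mx a b) (slice x).
Proof.
move=> ik ak; apply: ev_ext => s _; rewrite ev_slice !ev_coprod e_act_cat.
rewrite prod_kap_inert // mul1r (e_act_notin _ _ _ (inert_notin ak)) mulr0 addr0.
by apply: e_act_ext => u _; rewrite ev_slice.
Qed.

Lemma append_coprod (i : 'I_n.-1) (a b : 'I_n) y : (i.+1 < k)%N -> (b < k)%N ->
  append (coprod qh p i (delta_mx a b) y) = coprod qh m i (delta_mx a b) (append y).
Proof.
move=> ik bk; apply: ev_ext => s /size_split[s1 [s2 [-> ss]]].
rewrite ev_append // !ev_coprod e_act_cat.
have -> : e_act (kap qh i) a b (fun u => ev (append y) (s1 ++ u)) s2 = 0.
  apply/eqP; apply: contraT => /e_act_support[A [B' [_]]]; rewrite ev_append //.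
  case: (_ =P B) => [e _|_]; last by rewrite eqxx.
  by have := inert_notin bk; rewrite -e mem_cat inE eqxx orbT.
rewrite mulr0 addr0; case: eqP => [->|ne]; last first.
  rewrite e_act0 ?mulr0 // => u su; rewrite ev_append ?su //.
  by case: eqP => // e.
rewrite prod_kap_inert // mul1r; apply: e_act_ext => u su.
by rewrite ev_append ?su // eqxx.
Qed.

Lemma slice_K c (i : 'I_n) x : (i < k)%N ->
  slice (tens_op (fun=> Keps c i) x) = tens_op (fun=> Keps c i) (slice x).
Proof.
move=> ik; apply: ev_ext => s _; rewrite ev_slice !ev_K ev_slice count_cat.
by rewrite (count_memPn (inert_notin ik)) addn0.
Qed.

Lemma append_K c (i : 'I_n) y : (i < k)%N ->
  append (tens_op (fun=> Keps c i) y) = tens_op (fun=> Keps c i) (append y).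
Proof.
move=> ik; apply: ev_ext => s /size_split[s1 [s2 [-> ss]]].
rewrite ev_append // !ev_K ev_append // count_cat; case: eqP => [->|_]; last by rewrite mulr0.
by rewrite (count_memPn (inert_notin ik)) addn0.
Qed.

(** All letters of B are at least k, and for U_q(gl_k) such letters are inert: E_i and F_i kill them
    and the K_i fix them. *)
Lemma slice_hom : Uq_hom qh k slice.
Proof.
split=> i ik x; [apply: slice_coprod => //|apply: slice_coprod => //|exact: slice_K|exact: slice_K].
exact: ltnW.
Qed.

Lemma append_hom : Uq_hom qh k append.
Proof.
split=> i ik x; [apply: append_coprod => //|apply: append_coprod => //|exact: append_K|exact: append_K].
exact: ltnW.
Qed.

End Inert.
End Slices.

(** * The number of small letters on isotypic components *)

Section LetterCount.
Variables (F : fieldType) (n : nat) (q qh : F) (q0 : q != 0).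
Hypotheses (hq : forall k : nat, (0 < k)%N -> q ^+ k != 1) (hqh : qh ^+ 2 = q).
Variables (k m : nat).
Local Notation low s := (count (fun l : 'I_n => (l < k)%N) s).
Local Notation P N := (prj F m (fun s => low s == N)).

Lemma low_sum (s : seq 'I_n) : low s = (\sum_(i < n | (i < k)%N) count_mem i s)%N.
Proof.
elim: s => [|l s IH]; first by rewrite big1.
rewrite /= IH big_split /=; congr (_ + _)%N.
rewrite big_mkcond (bigD1 l) //= eqxx big1 ?addn0 => [|i ni]; first by case: ifP.
by rewrite eq_sym (negPf ni) if_same.
Qed.

Lemma e_act_low (kp : 'I_n -> F) (a b : 'I_n) g (s : seq 'I_n) N : (a < k)%N -> (b < k)%N ->
  e_act kp a b (fun u => if low u == N then g u else 0) s =
  if low s == N then e_act kp a b g s else 0.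
Proof.
move=> ak bk; rewrite !e_act_sum.
have e (p : 'I_(size s)) : nth a s p = a ->
    low (take p s ++ b :: drop p.+1 s) = low s.
  move=> ea; rewrite -[in RHS](cat_take_drop p s) (@drop_nth _ a p s) // !count_cat /= ea.
  by rewrite ak bk.
case: ifP => h; last rewrite big1 // => p _.
  apply: eq_bigr => p _; case: (nth a s p =P a) => [/e->|_]; first by rewrite h.
  by rewrite !mul0r.
by case: (nth a s p =P a) => [/e->|_]; [rewrite h mulr0|rewrite !mul0r].
Qed.

Lemma prj_low_hom N : Uq_hom qh k (P N).
Proof.
have co (i : 'I_n.-1) (a b : 'I_n) (x : tens F n m) : (a < k)%N -> (b < k)%N ->
    P N (coprod qh m i (delta_mx a b) x) = coprod qh m i (delta_mx a b) (P N x).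
  move=> ak bk; apply: ev_ext => s _; rewrite ev_prj !ev_coprod -e_act_low //.
  by apply: e_act_ext => u _; rewrite ev_prj.
split=> i ik x.
- by apply: co => //; apply: ltnW.
- by apply: co => //; apply: ltnW.
- by apply: ev_ext => s _; rewrite ev_prj !ev_K ev_prj; case: ifP; rewrite ?mulr0.
- by apply: ev_ext => s _; rewrite ev_prj !ev_K ev_prj; case: ifP; rewrite ?mulr0.
Qed.

Lemma K_eigen_weight (nu : nat -> nat) (u : tens F n m) :
  (forall i : 'I_n, (i < k)%N -> Uq_K qh m i u = qh ^+ nu i *: u) -> has_weight k nu u.
Proof.
move=> Ku s nz i ik; apply: (qh_inj q0 hq hqh); apply: (mulIf nz).
by rewrite -ev_K -/(Uq_K qh m i) Ku // evZ.
Qed.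

(** U_q(gl_k) preserves the number of letters below k, so a simple submodule containing one vector
    with exactly N such letters in each word consists of such vectors; the highest weight vector is
    one, N being the sum of its weight. *)
Lemma isotypic_low (nu : nat -> nat) (x : tens F n m) s : in_isotypic qh k nu x -> ev x s != 0 ->
  low s = (\sum_(i < n | (i < k)%N) nu i)%N.
Proof.
set N := (\sum_(i < n | _) _)%N => hx.
suff e : P N x = x by rewrite -{1}e ev_prj; case: (_ =P N) => // _; rewrite eqxx.
move: x hx; apply: in_isotypic_ind => [|x y ex ey|W x [[_ sW minW] [u uW [nu0 _ Ku]]] xW].
- by rewrite linear0.
- by rewrite linearD /= ex ey.
pose W' := (W :&: lker (P N - \1%VF))%VS.
have memW' y : (y \in W') = (y \in W) && (P N y == y).
  by rewrite memv_cap memv_ker add_lfunE opp_lfunE id_lfunE subr_eq0.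
have uW' : u \in W'.
  rewrite memW' uW; apply/eqP/ev_ext => t _; rewrite ev_prj; case: eqP => // ns.
  apply/esym/eqP; apply: contra_notT ns => nz; rewrite low_sum.
  by apply: eq_bigr => i ik; apply: K_eigen_weight nz _ ik.
have sW' : stable_sub (Uq_gl qh k) W'.
  apply/stable_mem => h hh y; rewrite !memW' => /andP[yW /eqP ey].
  rewrite ((stable_mem qh k W).1 sW h hh y yW) /=; apply/eqP.
  have [hE hF hK hKV] := prj_low_hom N.
  by case: hh => i ik; rewrite ?hE ?hF ?hK ?hKV // ey.
have [W0|eW] := minW W' sW' (capvSl _ _).
  by move: uW'; rewrite W0 memv0 (negPf nu0).
by move: xW; rewrite -eW memW' => /andP[_ /eqP].
Qed.

End LetterCount.

Lemma c_la_neq0 (F : fieldType) (q : F) (la : seq nat) : q != 0 ->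
  (forall k : nat, (0 < k)%N -> q ^+ k != 1) -> c_la q la != 0.
Proof.
move=> q0 hq; have qV k : (0 < k)%N -> q ^+ k - q ^- k != 0.
  move=> k0; rewrite subr_eq0; apply/eqP => e.
  have := hq (k + k)%N; rewrite addn_gt0 k0 exprD {2}e mulfV ?expf_neq0 // eqxx.
  by move/(_ isT).
apply/prodf_neq0 => b _; rewrite mulf_neq0 ?expfz_neq0 // /qint mulf_neq0 //.
  by apply/qV/card_gt0P; exists b; rewrite inE eqxx leqnn.
by rewrite invr_eq0; have := qV 1%N isT; rewrite !expr1.
Qed.

(** * The seminormal form on the Young basis *)

Section YoungModule.
Variables (F : fieldType) (q : F) (q0 : q != 0).
Hypothesis (hq : forall k : nat, (0 < k)%N -> q ^+ k != 1).
Variables (m : nat) (la : seq nat) (hla : is_partition_of m la).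
Variables (V : vectType F) (rho : 'I_m.-1 -> 'End(V)) (v : syt la m -> V).
Hypothesis hV : young_module q rho v.
Local Notation dq := (q - q^-1).
Local Notation row b := (box_row b).
Local Notation col b := (box_col b).
Local Notation TT := (hecke_T rho).
Implicit Types (T U : syt la m) (b : box la) (i : 'I_m.-1) (s : 'S_m).

Let hH : hecke_module q rho. Proof. by case: hV. Qed.

Definition ycoord T : 'Hom(V, F^o) :=
  linfun (coord (codom_tuple v) (enum_rank T) : V -> F^o).

Lemma codom_tuple_nth T : (codom_tuple v)`_(enum_rank T) = v T.
Proof.
have h : (enum_rank T < size (enum (syt la m)))%N by rewrite -cardE.
rewrite /= /image_mem (nth_map T) ?nth_enum_rank //.
Qed.

Lemma ycoordE T x : ycoord T x = coord (codom_tuple v) (enum_rank T) x.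
Proof. by rewrite lfunE. Qed.

Lemma ycoord_v T T' : ycoord T (v T') = (T == T')%:R.
Proof.
have [_ _ bas _] := hV.
rewrite ycoordE -codom_tuple_nth coord_free ?(basis_free bas) //.
by rewrite eq_sym (inj_eq enum_rank_inj).
Qed.

Lemma ycoord_sum x : x = \sum_T ycoord T x *: v T.
Proof.
have [_ _ bas _] := hV; rewrite {1}(coord_basis bas (memvf x)).
rewrite (reindex (@enum_rank (syt la m))) /=; last first.
  by apply: onW_bij; exact: enum_rank_bij.
by apply: eq_bigr => T _; rewrite ycoordE codom_tuple_nth.
Qed.

Lemma ycoord_eq0 x : (forall T, ycoord T x = 0) -> x = 0.
Proof. by move=> h; rewrite [x]ycoord_sum big1 // => T _; rewrite h scale0r. Qed.

Lemma young_lin_eq0 (phi : V -> F^o) : linear phi -> (forall T, phi (v T) = 0) ->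
  forall x, phi x = 0.
Proof.
move=> lphi h x; rewrite [x]ycoord_sum; elim/big_rec: _ => [|T y _ ey].
  by have := lphi (-1) 0 0; rewrite scaler0 addr0 scaleN1r addNr.
by rewrite lphi ey h scaler0 addr0.
Qed.

Lemma v_neq0 T : v T != 0.
Proof.
by apply/eqP => e; have := ycoord_v T T; rewrite e linear0 eqxx => /esym/eqP; rewrite oner_eq0.
Qed.

Lemma jm_v T b : jm rho (val T b) (v T) = q ^ (2 * content b) *: v T.
Proof.
have [_ _ _ /(_ T b)] := hV.
by rewrite (jucys_murphyE q0 hH).
Qed.

Lemma ycoord_jm T b x : ycoord T (jm rho (val T b) x) = q ^ (2 * content b) * ycoord T x.
Proof.
rewrite [x]ycoord_sum !linear_sum mulr_sumr; apply: eq_bigr => T' _ /=.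
rewrite !linearZ /= -[in jm _ _ _](tbK hla T' (val T b)) jm_v linearZ /= ycoord_v.
have [->|_] := eqVneq T T'; last by rewrite ![_ *: 0]scaler0 mulr0.
by rewrite tK; exact: mulrCA.
Qed.

Section Action.
Variables (T : syt la m) (i : 'I_m.-1).
Local Notation b0 := (tb hla T (adj_lo i)).
Local Notation b1 := (tb hla T (adj_hi i)).
Local Notation al := (q ^ (2 * content b0)).
Local Notation be := (q ^ (2 * content b1)).

Let be_al : be - al != 0.
Proof.
rewrite subr_eq0; apply/eqP => /(expq_inj q0 hq) e.
by have /eqP[] := swap_content_neq hla T i; lia.
Qed.

(** The value for which [x'] becomes an eigenvector of both y_i and y_(i+1), with the two
    eigenvalues of v_T exchanged; by [jm_shift] it is the diagonal coefficient of the seminormal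
    form. *)
Definition young_gamma : F := dq * be / (be - al).

Let x' := rho i (v T) - young_gamma *: v T.

Let jm_lo : jm rho i (v T) = al *: v T.
Proof. by have := jm_v T b0; rewrite tbK. Qed.

Let jm_hi : jm rho i.+1 (v T) = be *: v T.
Proof. by have := jm_v T b1; rewrite tbK. Qed.

Let im : (i < m.-1)%N := ltn_ord i.

Lemma jm_x'_hi : jm rho i.+1 x' = al *: x'.
Proof.
rewrite /x' linearB linearZ /= -[rho i]rnE -/(jm _ _).
have := jm_shift q0 hH (v T) im; rewrite /= => ->.
rewrite -/(jm rho i.+1) jm_hi jm_lo linearZ /= scalerBr !scalerA -addrA; congr (_ + _).
rewrite -scalerBl -scaleNr; congr (_ *: _).
by rewrite /young_gamma; move: be_al; move: al be => a b nz; field; rewrite nz q0.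
Qed.

Lemma jm_x'_lo : jm rho i x' = be *: x'.
Proof.
rewrite /x' linearB linearZ /= -[rho i]rnE jm_lo.
have e : jm rho i (rn rho i (v T)) = rn rho i (jm rho i.+1 (v T)) - dq *: jm rho i.+1 (v T).
  rewrite jmS (rn_quad q0 hH) // addrK.
  by [].
rewrite e jm_hi linearZ /= scalerBr !scalerA -addrA; congr (_ + _).
rewrite -!scaleNr -scalerDl; congr (_ *: _).
by rewrite /young_gamma; move: be_al; move: al be => a b nz; field; rewrite nz q0.
Qed.

(** Comparing eigenvalues, T'' has the contents of T with those of i and i + 1 exchanged, and
    contents determine a standard tableau. If the exchange breaks a row or a column, [x'] is
    therefore zero. *)
Lemma ycoord_x' T'' : ycoord T'' x' != 0 -> forall b, val T'' b = adj_tperm i (val T b).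
Proof.
move=> nz b.
have ginj : injective (swap_fun T i).
  by move=> a a'; rewrite !ffunE => /perm_inj/syt_inj.
rewrite (@syt_of_contents m la hla T'' (swap_fun T i) ginj) ?ffunE //.
  move=> a a' hr hc; rewrite !ffunE; apply: adj_tperm_lt.
    by have := syt_diag hla T hr hc; lia.
  by apply/eqP => -[e e']; have := syt_diag hla T hr hc; rewrite e e' /=; lia.
move=> a a'; rewrite ffunE => e.
suff : jm rho (val T'' a') x' = q ^ (2 * content a) *: x'.
  move/(congr1 (ycoord T'')); rewrite ycoord_jm linearZ /= => /(mulIf nz).
  by move/(expq_inj q0 hq) => ?; lia.
have key c : val T a = c -> q ^ (2 * content a) = q ^ (2 * content (tb hla T c)).
  by move=> <-; rewrite tK.
rewrite -e val_adj_tperm; case: eqP => [e1|ne1].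
  by rewrite jm_x'_hi (key (adj_lo i)) //; apply: val_inj.
case: eqP => [e1|ne2].
  by rewrite jm_x'_lo (key (adj_hi i)) //; apply: val_inj.
rewrite /x' linearB linearZ /= -[rho i]rnE -(jm_rn q0 hH); try by apply/eqP.
by rewrite jm_v linearZ /= scalerBr !scalerA [young_gamma * _]mulrC.
Qed.

(** Then v_T is an eigenvector of T_i, so the diagonal coefficient is q or - q^-1, and either value
    fixes the difference of the contents. *)
Lemma x'_eq0 : x' = 0 -> content b1 = content b0 + 1 /\ young_gamma = q \/
   content b1 = content b0 - 1 /\ young_gamma = - q^-1.
Proof.
move=> /eqP; rewrite subr_eq0 => /eqP e.
have := rn_quad q0 hH (v T) im; rewrite !rnE e linearZ /= e !scalerA -{2}[v T]scale1r -scalerDl.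
move/eqP; rewrite -subr_eq0 -scalerBl scaler_eq0 (negPf (v_neq0 T)) orbF => /eqP e2.
have : (young_gamma - q) * (young_gamma + q^-1) = 0.
  by rewrite -e2; field.
move/eqP; rewrite mulf_eq0 subr_eq0 addr_eq0 => /orP[/eqP h|/eqP h]; [left|right]; split=> //.
- have e3 : dq * be = young_gamma * (be - al) by rewrite /young_gamma mulfVK.
  rewrite h in e3.
  have : q ^ (2 * content b1 - 1) = q ^ (2 * content b0 + 1).
    rewrite !expfzDr // exprN1 expr1z; apply/eqP; rewrite -subr_eq0; apply/eqP.
    move: al be e3 => a b e3; have e4 : dq * b - q * (b - a) = 0 by rewrite e3 subrr.
    by rewrite -[RHS]oppr0 -[in RHS]e4; ring.
  by move/(expq_inj q0 hq) => ?; lia.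
- have e3 : dq * be = young_gamma * (be - al) by rewrite /young_gamma mulfVK.
  rewrite h in e3.
  have : q ^ (2 * content b1 + 1) = q ^ (2 * content b0 - 1).
    rewrite !expfzDr // exprN1 expr1z; apply/eqP; rewrite -subr_eq0; apply/eqP.
    move: al be e3 => a b e3; have e4 : dq * b + q^-1 * (b - a) = 0 by rewrite e3; ring.
    by rewrite -[in RHS]e4; ring.
  by move/(expq_inj q0 hq) => ?; lia.
Qed.

Lemma young_row : row b0 = row b1 -> rho i (v T) = q *: v T.
Proof.
move=> er; have hc := row_content er; have x0 : x' = 0.
  apply: ycoord_eq0 => T''; apply/eqP; apply: contraT => /ycoord_x' h.
  have lt : (col b0 < col b1)%N by move: hc; rewrite /content er; lia.
  have := syt_row T'' er lt; rewrite !h !tbK /adj_tperm tpermL tpermR /=; lia.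
have [[_ e]|[e _]] := x'_eq0 x0; last by lia.
by move/eqP: x0; rewrite /x' subr_eq0 e => /eqP.
Qed.

Lemma young_col : col b0 = col b1 -> rho i (v T) = - q^-1 *: v T.
Proof.
move=> er; have hc := col_content er; have x0 : x' = 0.
  apply: ycoord_eq0 => T''; apply/eqP; apply: contraT => /ycoord_x' h.
  have lt : (row b0 < row b1)%N by move: hc; rewrite /content er; lia.
  have := syt_col T'' er lt; rewrite !h !tbK /adj_tperm tpermL tpermR /=; lia.
have [[e _]|[_ e]] := x'_eq0 x0; first by lia.
by move/eqP: x0; rewrite /x' subr_eq0 e => /eqP.
Qed.

Lemma young_swap : swappable hla T i ->
  exists d, [/\ d != 0, young_gamma != q & rho i (v T) = young_gamma *: v T + d *: v (swap_syt T i)].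
Proof.
move=> sw; have [n1 n2] := swappable_content sw.
exists (ycoord (swap_syt T i) x').
have ex : x' = ycoord (swap_syt T i) x' *: v (swap_syt T i).
  rewrite {1}[x']ycoord_sum (bigD1 (swap_syt T i)) //= big1 ?addr0 // => T'' nT.
  suff -> : ycoord T'' x' = 0 by rewrite scale0r.
  apply/eqP; apply: contraT => /ycoord_x' h; case/eqP: nT.
  by apply/val_inj/ffunP => b; rewrite h (swap_sytE _ sw).
have nz : x' != 0.
  by apply/eqP => /x'_eq0[[e _]|[e _]]; [case/eqP: n1|case/eqP: n2].
split; last by rewrite -ex addrC subrK.
- by apply: contra_neq nz => e; rewrite ex e scale0r.
apply/eqP => h; case/eqP: n1.
have e3 : dq * be = young_gamma * (be - al) by rewrite /young_gamma mulfVK.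
  rewrite h in e3.
have : q ^ (2 * content b1 - 1) = q ^ (2 * content b0 + 1).
  rewrite !expfzDr // exprN1 expr1z; apply/eqP; rewrite -subr_eq0; apply/eqP.
  move: al be e3 => a b e3; have e4 : dq * b - q * (b - a) = 0 by rewrite e3 subrr.
  by rewrite -[RHS]oppr0 -[in RHS]e4; ring.
by move/(expq_inj q0 hq) => ?; lia.
Qed.

End Action.

Local Notation f := ycoord.
Local Notation gam := young_gamma.

Lemma young_cases T i : (exists g, rho i (v T) = g *: v T) \/
  (swappable hla T i /\
   exists d, [/\ d != 0, gam T i != q & rho i (v T) = gam T i *: v T + d *: v (swap_syt T i)]).
Proof.
have [sw|] := boolP (swappable hla T i).
  by right; split=> //; apply: young_swap.
rewrite negb_and !negbK => /orP[/eqP e|/eqP e]; left.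
  by exists q; apply: (young_row e).
by exists (- q^-1); apply: (young_col e).
Qed.

Lemma ycoord_ext (g g' : 'Hom(V, F^o)) : (forall T, g (v T) = g' (v T)) -> g = g'.
Proof.
move=> h; apply/lfunP => x; rewrite (ycoord_sum x) !linear_sum.
by apply: eq_bigr => T _; rewrite !linearZ /= h.
Qed.

Lemma ycoord_rho_other T T' i : T' != T -> ~~ (swappable hla T i && (T' == swap_syt T i)) ->
  f T (rho i (v T')) = 0.
Proof.
move=> ne ns; have [[g ->]|[sw [d [_ _ ->]]]] := young_cases T' i.
  by rewrite linearZ /= ycoord_v eq_sym (negPf ne) scaler0.
rewrite linearD !linearZ /= !ycoord_v eq_sym (negPf ne) scaler0 add0r.
case: eqP => [e|_]; last by rewrite scaler0.
by case/negP: ns; rewrite e swappable_swap // (swap_sytK sw) eqxx.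
Qed.

Lemma ycoord_rho T i : swappable hla T i -> exists d, [/\ d != 0, gam T i != q &
  (f T \o rho i)%VF = gam T i *: f T + d *: f (swap_syt T i)].
Proof.
move=> sw; have sw' := swappable_swap sw; have ns := swap_neq sw.
have [d [_ g1 e1]] := young_swap sw.
have [d' [d0 _ e2]] := young_swap sw'; rewrite swap_sytK // in e2.
exists d'; split=> //; apply: ycoord_ext => T'; rewrite !lfun_simp.
have [->|nT] := eqVneq T' T.
  rewrite e1 linearD !linearZ /= !ycoord_v eqxx eq_sym (negPf ns).
  by rewrite ?(negPf ns) !scaler0.
have [->|nT'] := eqVneq T' (swap_syt T i).
  rewrite e2 linearD !linearZ /= !ycoord_v !eqxx eq_sym (negPf ns).
  by rewrite !scaler0 !add0r.
rewrite ycoord_rho_other ?negb_and ?nT' ?orbT // !ycoord_v.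
by rewrite eq_sym (negPf nT) eq_sym (negPf nT') !scaler0 addr0.
Qed.

Lemma ycoord_rho_col T i : col (tb hla T (adj_lo i)) = col (tb hla T (adj_hi i)) ->
  (f T \o rho i)%VF = - q^-1 *: f T.
Proof.
move=> e; apply: ycoord_ext => T'; rewrite !lfun_simp.
have [->|nT] := eqVneq T' T.
  by rewrite (young_col e) linearZ.
rewrite ycoord_rho_other // ?ycoord_v 1?eq_sym ?(negPf nT) ?scaler0 //.
by rewrite /swappable e eqxx andbF.
Qed.

Lemma q2_neqN1 : - q^-1 != q.
Proof.
apply/eqP => e; have := @hq 4 isT; case/eqP.
have e2 : q ^+ 2 = -1 by rewrite expr2 -{2}e mulrN mulfV.
by rewrite -[4%N]/(2 * 2)%N exprM e2 sqrrN expr1n.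
Qed.

(** * Functionals invariant under a Young subgroup *)

Section Colouring.
Variable c : nat -> nat.
Hypothesis cm : forall i j : nat, (i <= j)%N -> (c i <= c j)%N.

Definition colour_stab : pred 'S_m := fun s => [forall k, c (s k) == c k].

Lemma colour_stabP s : reflect (forall k, c (s k) = c k) (colour_stab s).
Proof. by apply: (iffP forallP) => h b; apply/eqP/h. Qed.

Lemma stab_adj s i : c i = c i.+1 -> colour_stab (adj_tperm i * s)%g = colour_stab s.
Proof.
move=> ci; have key s' : colour_stab s' -> colour_stab (adj_tperm i * s')%g.
  move/colour_stabP => h; apply/colour_stabP => k; rewrite permM h val_adj_tperm.
  by case: eqP => [->|_]; [rewrite -ci|case: eqP => [->|]].
by apply/idP/idP => [/key|/key //]; rewrite adj_tpermK.
Qed.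

Lemma stab_descent s i : colour_stab s -> (s (adj_hi i) < s (adj_lo i))%N -> c i = c i.+1.
Proof.
move=> /colour_stabP h /ltnW/cm; rewrite !h /= => le.
by apply/eqP; rewrite eqn_leq le cm.
Qed.

(** A reduced word of s uses only generators exchanging positions of equal colour, and by the
    seminormal form these lead only to tableaux with the same coloured filling. *)
Lemma stab_support s T T' : colour_stab s -> f T (TT s (v T')) != 0 ->
  forall b, c (val T b) = c (val T' b).
Proof.
have [N] := ubnP (perm_length s); elim: N s T' => // N IH s T' le hs nz.
have [/existsP[i desc]|] := boolP [exists i, (s (adj_hi i) < s (adj_lo i))%N]; last first.
  rewrite negb_exists => /forallP h.
  have s1 : s = 1%g by apply: perm_no_descent => i; rewrite leqNgt h.
  move: nz; rewrite s1 (hecke_T1 q0 hH) ycoord_v.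
  by case: (T =P T') => [->|_] //; rewrite eqxx.
have ci := stab_descent hs desc; have ls := perm_length_descent desc.
have hs' : colour_stab (adj_tperm i * s)%g by rewrite stab_adj.
have e x : TT s x = TT (adj_tperm i * s)%g (rho i x).
  rewrite -{1}[s](adj_tpermK i) (hecke_T_ascR q0 hH) //.
  by rewrite !permM /adj_tperm tpermL tpermR.
have le' : (perm_length (adj_tperm i * s)%g < N)%N by rewrite -ltnS -ls.
move: nz; rewrite e.
have [[g ->]|[sw [d [_ _ ->]]]] := young_cases T' i.
  by rewrite !linearZ /= scaler_eq0 negb_or => /andP[_ nz]; exact: IH le' hs' nz.
rewrite !linearD !linearZ /=.
have [e0|nz _] := eqVneq (f T (TT (adj_tperm i * s)%g (v T'))) 0; last exact: IH le' hs' nz.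
rewrite e0 scaler0 add0r scaler_eq0 negb_or => /andP[_ nz] b.
by rewrite (IH _ _ le' hs' nz) (swap_class _ ci sw).
Qed.

(* T_s e_I = q^(length s) e_I for s in the stabilizer of I, whence psi gives the
   coefficient of e_I in X(x, f T) e_I. *)
Definition psi T (x : V) : F :=
  \sum_(s | colour_stab s) q ^+ perm_length s * f T (TT s x).

Definition c_invariant (phi : V -> F) :=
  forall i, c i = c i.+1 -> forall x, phi (rho i x) = q * phi x.

Lemma psi_lin T : linear (psi T : V -> F^o).
Proof.
move=> a x y; rewrite /psi scaler_sumr -big_split /=; apply: eq_bigr => s _.
have -> : f T (TT s (a *: x + y)) = a * f T (TT s x) + f T (TT s y) by rewrite !linearP.
have -> : a *: (q ^+ perm_length s * f T (TT s x) : F^o) = a * (q ^+ perm_length s * f T (TT s x)) by [].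
by ring.
Qed.

(** The sum of the q^(l(s)) T_s over the Young subgroup is its q-symmetrizer, which absorbs each of
    its generators T_i as the scalar q. *)
Lemma psi_invariant T : c_invariant (psi T).
Proof.
move=> i ci x; rewrite /psi mulr_sumr.
under eq_bigr do rewrite (hecke_TR q0 hH) linearD mulrDr.
rewrite big_split /= (reindex_inj (mulgI (adj_tperm i))) /=.
rewrite (eq_bigl colour_stab); last by move=> s; rewrite /= stab_adj.
rewrite -big_split /=; apply: eq_bigr => s _; rewrite adj_tpermK.
have [desc|] := boolP (s (adj_hi i) < s (adj_lo i))%N.
  have -> : f T (dq *: TT s x) = dq * f T (TT s x) by rewrite linearZ.
  rewrite (perm_length_descent desc) exprS; by field.
rewrite descentN negbK => asc; rewrite (perm_length_ascent asc) linear0 mulr0 addr0 exprS.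
by rewrite mulrA.
Qed.

Lemma psi_support T T' : psi T (v T') != 0 -> forall b, c (val T b) = c (val T' b).
Proof.
move=> nz; have [s hs h] : exists2 s, colour_stab s & f T (TT s (v T')) != 0.
  have [/existsP[s /andP[h1 h2]]|] := boolP [exists s, colour_stab s && (f T (TT s (v T')) != 0)].
    by exists s.
  rewrite negb_exists => /forallP h; case/eqP: nz; rewrite /psi big1 // => s hs.
  by have := h s; rewrite hs negbK => /eqP->; rewrite mulr0.
exact: stab_support hs h.
Qed.

Lemma invariant_swap (phi : V -> F) T i : linear (phi : V -> F^o) -> c_invariant phi ->
  c i = c i.+1 -> swappable hla T i -> phi (v T) = 0 -> phi (v (swap_syt T i)) = 0.
Proof.
move=> lphi iphi ci sw z; have [d [d0 _ e]] := young_swap sw.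
have := iphi i ci (v T); rewrite e z mulr0 addrC lphi.
have -> : phi (gam T i *: v T) = 0.
  have p0 : phi 0 = 0 by have := lphi (-1) 0 0; rewrite scaler0 addr0 scaleN1r addNr.
  by have := lphi (gam T i) (v T) 0; rewrite addr0 p0 addr0 z => ->; rewrite scaler0.
by rewrite addr0 => /eqP; rewrite mulf_eq0 (negPf d0) => /eqP.
Qed.

(** If phi vanishes at v_T, invariance and the seminormal form make it vanish at every admissible
    exchange. Applied to differences, this shows that an invariant functional is fixed on a class of
    tableaux by one value. *)
Lemma invariant_class (phi : V -> F) T T' : linear (phi : V -> F^o) -> c_invariant phi ->
  (forall b, c (val T b) = c (val T' b)) -> phi (v T) = 0 -> phi (v T') = 0.
Proof.
move=> lphi iphi cl.
apply: (@swap_connected m la hla c (fun T => phi (v T) = 0) cm _ T T' cl).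
by move=> U i ci sw; apply: invariant_swap.
Qed.

End Colouring.

(** * Non-vanishing of the symmetrized coefficient *)

Section PsiNonzero.
Variable c : nat -> nat.
Hypothesis cm : forall i j : nat, (i <= j)%N -> (c i <= c j)%N.
Variable B : nat.
Hypothesis cB : forall i : nat, (c i <= B)%N.

(** By monotonicity the positions of this colour up to j0 form an interval. The sum is thus
    geometric, (q^(2N) - 1) / (q^2 - 1) with N >= 1 terms. *)
Lemma block_sum_neq0 j0 : \sum_(j < j0.+1 | c j == c j0) q ^+ (2 * (j0 - j)) != 0.
Proof.
pose S j0 := \sum_(j < j0.+1 | c j == c j0) q ^+ (2 * (j0 - j)).
suff [N N0 e] : exists2 N, (0 < N)%N & (q ^+ 2 - 1) * S j0 = q ^+ (2 * N) - 1.
  rewrite -/(S j0); apply: contra_eq_neq e => ->; rewrite mulr0 eq_sym subr_eq0.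
  by apply: hq; lia.
elim: j0 => [|j0 [N N0 IH]].
  by exists 1%N => //; rewrite /S big_mkcond big_ord1 /= eqxx subnn mulr1 muln1.
have SE : S j0.+1 = 1 + (if c j0 == c j0.+1 then q ^+ 2 * S j0 else 0).
  rewrite /S big_mkcond big_ord_recr /= eqxx subnn addrC; congr (_ + _).
  case: eqP => [e|ne].
    rewrite mulr_sumr -big_mkcond /= (eq_bigl (fun j : 'I_j0.+1 => c j == c j0)); last by move=> j /=; rewrite e.
    apply: eq_bigr => j _; rewrite -exprD; congr (_ ^+ _).
    by have := ltn_ord j; lia.
  apply: big1 => j _; case: eqP => // e; case: ne; apply/eqP; rewrite eqn_leq cm //= -e cm //.
  by have := ltn_ord j; lia.
rewrite SE; case: ifP => _; last by exists 1%N; rewrite // addr0 mulr1 muln1.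
exists N.+1 => //; rewrite mulrDr mulr1 mulrCA IH mulnS exprD; ring.
Qed.

(** Positions from r on get private colours above all values of c. This interpolates between an
    injective colouring at r = 0, where the stabilizer is trivial, and c itself at r = m. *)
Definition refined r (i : nat) : nat := if (i < r)%N then c i else (B.+1 + i)%N.

Lemma refined_mono r (i j : nat) : (i <= j)%N -> (refined r i <= refined r j)%N.
Proof.
move=> ij; rewrite /refined; case: ifP => h1; case: ifP => h2; have := cB i; have := cm ij; lia.
Qed.

Lemma refined_eq r (i j : nat) : refined r i = refined r j ->
  i = j \/ [/\ (i < r)%N, (j < r)%N & c i = c j].
Proof.
rewrite /refined; case: ifP => h1; case: ifP => h2; have := cB i; have := cB j => ? ? ?; try (right; split=> //; lia); left; lia.
Qed.

Variable T : syt la m.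
Hypothesis good : forall b b', col b = col b' -> (row b < row b')%N -> c (val T b) <> c (val T b').

Lemma psi_refined0 : psi (refined 0) T (v T) != 0.
Proof.
rewrite /psi (big_pred1 1%g) => [|s].
  by rewrite perm_length1 mul1r (hecke_T1 q0 hH) ycoord_v eqxx oner_eq0.
apply/colour_stabP/eqP => [h|-> k]; last by rewrite perm1.
apply/permP => k; rewrite perm1; apply: val_inj.
by have [//|[]] := refined_eq (h k).
Qed.

Section Step.
Variable r : 'I_m.
Hypothesis IHr : exists x, psi (refined r) T x != 0.
Local Notation cr := (refined r.+1).
Let beta := tb hla T r.
Let Tbeta : val T beta = r. Proof. exact: tbK. Qed.

(** The s with s j = r form a coset of the subgroup fixing r, and this subgroup is the stabilizer
    for [refined r]. *)
Definition psi_part (j : 'I_m) (x : V) : F :=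
  \sum_(s | colour_stab cr s && (s j == r)) q ^+ perm_length s * f T (TT s x).

Lemma psi_partD j (a a2 : F) x y : psi_part j (a *: x + a2 *: y) = a * psi_part j x + a2 * psi_part j y.
Proof.
rewrite /psi_part !mulr_sumr -big_split /=; apply: eq_bigr => s _.
have -> : f T (TT s (a *: x + a2 *: y)) = a * f T (TT s x) + a2 * f T (TT s y).
  by rewrite !linearD !linearZ.
by ring.
Qed.

Lemma psi_partZ j a x : psi_part j (a *: x) = a * psi_part j x.
Proof. by have := psi_partD j a 0 x x; rewrite scale0r addr0 mul0r addr0. Qed.

Lemma psi_split x : psi cr T x = \sum_j psi_part j x.
Proof.
rewrite /psi (partition_big (fun s : 'S_m => (s^-1)%g r) xpredT) //=.
apply: eq_bigr => j _; apply: eq_bigl => s; congr (_ && _).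
by apply/eqP/eqP => [<-|<-]; rewrite ?permKV ?permK.
Qed.

Lemma cr_le (j : nat) : (j <= r)%N -> cr j = c j.
Proof. by move=> h; rewrite /refined ltnS h. Qed.

Lemma psi_part_top x : psi_part r x = psi (refined r) T x.
Proof.
apply: eq_bigl => s; apply/andP/colour_stabP => [[/colour_stabP h /eqP sr] k|h].
  have [->|nk] := eqVneq k r; first by rewrite sr.
  have nsk : s k != r by rewrite -sr (inj_eq perm_inj).
  have [->//|[h1 h2 h3]] := refined_eq (h k).
  rewrite /refined !ifT //; move: nk nsk; rewrite -!val_eqE /=; lia.
have fixed (k : 'I_m) : (r <= k)%N -> s k = k.
  move=> rk; apply: val_inj; have [//|[_ h2 _]] := refined_eq (h k); lia.
split; last by rewrite fixed.
apply/colour_stabP => k; have [rk|kr] := leqP r k; first by rewrite fixed.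
have [->//|[h1 h2 h3]] := refined_eq (h k).
by rewrite !cr_le // ltnW.
Qed.

(** For [cr] the position r is the last one of its colour, so an s with s (i + 1) = r has an ascent
    at i. Precomposing it with s_i adds one to the length. *)
Lemma psi_part_step i x : (i < r)%N -> c i = c i.+1 ->
  psi_part (adj_lo i) x = q * psi_part (adj_hi i) (rho i x).
Proof.
move=> ir ci; have cri : cr i = cr i.+1 by rewrite !cr_le // ltnW.
rewrite /psi_part mulr_sumr (reindex_inj (mulgI (adj_tperm i))) /=.
apply: eq_big => [s|s].
  by rewrite stab_adj // permM /adj_tperm tpermL.
rewrite stab_adj // permM /adj_tperm tpermL -/(adj_tperm i) => /andP[/colour_stabP h /eqP sr].
have asc : (s (adj_lo i) < s (adj_hi i))%N.
  rewrite sr ltn_neqAle; apply/andP; split.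
    by rewrite -sr (inj_eq val_inj) (inj_eq perm_inj) adj_lo_neq_hi.
  by have [->|[h1 _ _]] := refined_eq (h (adj_lo i)) => //=; exact: ltnW.
by rewrite perm_length_ascent // (hecke_T_ascR q0 hH) // exprS mulrA.
Qed.

Lemma ord_adj (j : 'I_m) : (j < r)%N -> exists i : 'I_m.-1, j = adj_lo i /\ (i < r)%N.
Proof.
move=> jr; have h : (j < m.-1)%N by have := ltn_ord r; lia.
by exists (Ordinal h); split=> //; apply: val_inj.
Qed.

(** At j = r the functional is [psi (refined r) T], supported on tableaux with r in [beta] because r
    has a private colour. The generators leading from j to r leave entries below j in place. *)
Lemma psi_part_below (j : 'I_m) (T' : syt la m) : (j <= r)%N -> c j = c r -> (val T' beta < j)%N ->
  psi_part j (v T') = 0.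
Proof.
have [d] := ubnP (r - j)%N; elim: d j T' => // d IH j T' le jr cj lt.
move: jr; rewrite leq_eqVlt => /orP[/eqP/val_inj ej|jr].
  rewrite ej psi_part_top; apply/eqP; apply: contraT.
  move/(psi_support (@refined_mono r)) => /(_ beta).
  rewrite Tbeta => /refined_eq[e|[]]; last by rewrite ltnn.
  by rewrite -e ej ltnn in lt.
have [i [ej ir]] := ord_adj jr; rewrite {}ej /= in le cj lt *.
have ci1 : c i.+1 = c r by apply: (etrans (c_between cm (leqnSn i) ir cj)).
have ci : c i = c i.+1 by rewrite ci1.
rewrite psi_part_step //.
have IH' (U : syt la m) : (val U beta < i)%N -> psi_part (adj_hi i) (v U) = 0.
  by move=> lt'; apply: IH => //=; [lia|apply: leqW].
have [[g ->]|[sw [g [_ _ ->]]]] := young_cases T' i.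
  by rewrite psi_partZ IH' ?mulr0.
rewrite psi_partD !IH' ?mulr0 ?addr0 ?mulr0 //.
rewrite (swap_sytE _ sw) val_adj_tperm -[val T' beta]/(sval T' beta).
by rewrite (ltn_eqF lt) (ltn_eqF (ltn_trans lt (ltnSn i))).
Qed.

(** Exchanges raise the entry of [beta] from j to r, the unexchanged term vanishing by
    [psi_part_below]. They are possible: in T the box [beta] holds the last entry of its colour, so
    the box of i + 1 is not to its right, and no column of T repeats a colour. *)
Lemma psi_part_at (j : 'I_m) (T' : syt la m) : (j <= r)%N -> c j = c r -> class_mates cr T T' ->
  val T' beta = j -> psi_part j (v T') != 0.
Proof.
have [d] := ubnP (r - j)%N; elim: d j T' => // d IH j T' le jr cj /class_matesP cl ej0.
move: jr; rewrite leq_eqVlt => /orP[/eqP/val_inj ej|jr].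
  rewrite ej psi_part_top.
  have cl' b : refined r (val T' b) = refined r (val T b).
    have [->|nb] := eqVneq b beta; first by rewrite ej0 Tbeta ej.
    have n1 : val T b != r by rewrite -Tbeta (inj_eq (@syt_inj _ _ T)).
    have n2 : val T' b != r by rewrite -ej -ej0 (inj_eq (@syt_inj _ _ T')).
    have [->//|[h1 h2 h3]] := refined_eq (cl b).
    by rewrite /refined !ifT //; move: n1 n2 h1 h2; rewrite -!val_eqE /=; lia.
  have [x nzx] := IHr.
  have [T1 nz1] : exists T1, psi (refined r) T (v T1) != 0.
    have [/existsP//|] := boolP [exists T1, psi (refined r) T (v T1) != 0].
    rewrite negb_exists => /forallP h; case/eqP: nzx.
    apply: (young_lin_eq0 (psi_lin (refined r) T)) => T1.
    by have := h T1; rewrite negbK => /eqP.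
  apply: contra_neq (nz1); apply: (invariant_class (@refined_mono r)).
  - exact: psi_lin.
  - exact: psi_invariant.
  - by move=> b; rewrite cl' (psi_support (@refined_mono r) nz1).
have [i [ej ir]] := ord_adj jr; rewrite {}ej /= in le cj ej0 *.
have ci1 : c i.+1 = c r by apply: (etrans (c_between cm (leqnSn i) ir cj)).
have ci : c i = c i.+1 by rewrite ci1.
rewrite psi_part_step //.
have eb : tb hla T' (adj_lo i) = beta by rewrite -ej0 tK.
have h1 := tbK hla T' (adj_hi i); set ga := tb hla T' (adj_hi i) in h1.
have lt : (val T' beta < val T' ga)%N by rewrite ej0 h1 /=.
have Tga : cr (val T ga) = c i.+1 by rewrite -cl h1 cr_le.
have [Tga1 Tga2] : (val T ga <= r)%N /\ c (val T ga) = c i.+1.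
  move: Tga; rewrite /refined; case: ifP => //; have := cB i.+1; lia.
have sw : swappable hla T' i.
  rewrite /swappable eb -/ga; apply/andP; split; apply/eqP => e.
    have [hc|hc|hc] := ltngtP (col beta) (col ga).
    - by have := syt_row T e hc; rewrite Tbeta; lia.
    - by have := syt_row T' (esym e) hc; lia.
    - by rewrite (box_eq e hc) ltnn in lt.
  have [hc|hc|hc] := ltngtP (row beta) (row ga).
  - by case: (good e hc); rewrite Tbeta Tga2.
  - by have := syt_col T' (esym e) hc; lia.
  - by rewrite (box_eq hc e) ltnn in lt.
have [g [g0 _ ->]] := young_swap sw.
rewrite psi_partD [psi_part _ (v T')]psi_part_below ?ej0 //= ?mulr0 ?add0r.
rewrite !mulf_neq0 // IH //=; try lia.
  have cri : cr i = cr i.+1 by rewrite !cr_le // ltnW.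
  by apply: class_swap => //; apply/class_matesP.
by rewrite (swap_sytE _ sw) ej0 /adj_tperm tpermL.
Qed.

Lemma cr_eq (j : nat) : cr j = c r -> (j <= r)%N /\ c j = c r.
Proof. by rewrite /refined; case: ifP => //; have := cB r; lia. Qed.

Lemma psi_part_out (j : 'I_m) x : cr j != c r -> psi_part j x = 0.
Proof.
move=> h; apply: big1 => s /andP[/colour_stabP/(_ j) hs /eqP sr].
by case/eqP: h; rewrite -hs sr cr_le.
Qed.

Lemma psi_refinedS : exists x, psi cr T x != 0.
Proof.
(* Minimizing the sum over X pays off as follows: if i outside X precedes i + 1 inside X in the same
   colour, their exchange would lower the sum. *)
pose X := [pred b | (row b == row beta) && (cr (val T b) == c r)].
pose S (U : syt la m) := (\sum_(b | X b) val U b)%N.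
have T0 : class_mates cr T T by apply/class_matesP.
case: (arg_minnP S T0) => T' clT minT; have hcl := elimT (class_matesP _ _ _) clT.
pose j0 := val T' beta.
have [j0r cj0] : (j0 <= r)%N /\ c j0 = c r by apply: cr_eq; rewrite hcl Tbeta cr_le.
have Xbeta : X beta by rewrite /= eqxx Tbeta cr_le //= eqxx.
(* By minimality the entries before j0 of the same colour are in the row of beta. *)
have chain k (j : 'I_m) : (j + k = j0)%N -> c j = c r -> X (tb hla T' j).
  elim: k j => [|k IH] j e cj.
    by have -> : j = j0; [by apply: val_inj; move: e; rewrite addn0|rewrite /j0 tK].
  have jr : (j < r)%N by lia.
  have [i [ej ir]] := ord_adj jr; rewrite {j jr}ej /= in e cj *.
  have ci1 : c i.+1 = c r by apply: (etrans (c_between cm (leqnSn i) ir cj)).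
  have Xhi : X (tb hla T' (adj_hi i)) by apply: IH => //=; lia.
  have clo : cr (val T (tb hla T' (adj_lo i))) = c r by rewrite -hcl tbK cr_le // ltnW.
  apply: contraT => Xlo.
  have nrow : row (tb hla T' (adj_lo i)) != row beta by move: Xlo; rewrite /= clo eqxx andbT.
  case/andP: (Xhi) => /eqP rhi /eqP chi.
  have sw : swappable hla T' i.
    rewrite /swappable rhi nrow /=; apply/eqP => ecol.
    have [lt|lt|e'] := ltngtP (row (tb hla T' (adj_lo i))) (row (tb hla T' (adj_hi i))).
    - by case: (good ecol lt); rewrite (cr_eq clo).2 (cr_eq chi).2.
    - by have := syt_col T' (esym ecol) lt; rewrite !tbK /=; lia.
    - by rewrite e' rhi eqxx in nrow.
  have cri : cr i = cr i.+1 by rewrite !cr_le ?cj //; apply: ltnW.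
  by have := minT _ (class_swap cri sw clT); rewrite /S (sum_swap' sw Xlo Xhi) ltnn.
(* Each step gives one factor q from the ascent and one from T_i, which acts by q on two
   neighbouring entries of a row. *)
have pw k (j : 'I_m) : (j + k = j0)%N -> c j = c r ->
    psi_part j (v T') = q ^+ (2 * k) * psi_part j0 (v T').
  elim: k j => [|k IH] j e cj.
    by have -> : j = j0; [by apply: val_inj; move: e; rewrite addn0|rewrite muln0 mul1r].
  have jr : (j < r)%N by lia.
  have Xlo := chain _ _ e cj.
  have [i [ej ir]] := ord_adj jr; rewrite {j jr}ej /= in e cj Xlo *.
  have ci1 : c i.+1 = c r by apply: (etrans (c_between cm (leqnSn i) ir cj)).
  have e1 : (adj_hi i + k = j0)%N by rewrite /=; lia.
  have Xhi := chain _ _ e1 ci1.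
  have er : row (tb hla T' (adj_lo i)) = row (tb hla T' (adj_hi i)).
    by case/andP: Xlo => /eqP-> _; case/andP: Xhi => /eqP->.
  rewrite psi_part_step ?ci1 // (young_row er) psi_partZ (IH _ e1 ci1).
  by rewrite mulnS exprD expr2 !mulrA.
exists (v T'); rewrite psi_split.
(* Parts beyond j0 vanish by [psi_part_below] or for lack of the colour; those up to j0 form the
   geometric series. *)
have -> : \sum_j psi_part j (v T') =
    (\sum_(j < j0.+1 | c j == c j0) q ^+ (2 * (j0 - j))) * psi_part j0 (v T').
  rewrite mulr_suml (big_ord_widen_cond m (fun j => c j == c j0)
    (fun j => q ^+ (2 * (j0 - j)) * psi_part j0 (v T'))) ?ltn_ord //.
  rewrite [RHS]big_mkcond /=; apply: eq_bigr => j _; rewrite ltnS cj0.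
  have [cj|ncj] := eqVneq (c j) (c r); last first.
    by rewrite psi_part_out //; apply: contra_neq ncj => /cr_eq[].
  have [jj|jj] := leqP j j0; first by apply: pw; rewrite // subnKC.
  have [jr|rj] := leqP j r; first exact: psi_part_below.
  rewrite psi_part_out // /refined ltnS leqNgt rj /=; have := cB r; lia.
by rewrite mulf_neq0 ?block_sum_neq0 // psi_part_at.
Qed.

End Step.

Theorem psi_neq0 : exists x, psi c T x != 0.
Proof.
have [x nz] : exists x, psi (refined m) T x != 0.
  suff h r : (r <= m)%N -> exists x, psi (refined r) T x != 0 by exact: h.
  elim: r => [|r IH] lr; first by exists (v T); exact: psi_refined0.
  by apply: (@psi_refinedS (Ordinal lr)); apply: IH; apply: ltnW.
exists x; apply: contra_neq nz => <-; apply: eq_bigl => s.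
by apply/colour_stabP/colour_stabP => h k; have := h k; rewrite /refined !ltn_ord.
Qed.

End PsiNonzero.

(** * The matrix units applied to the word I *)

Section Multiset.
Variables (n : nat) (I : m.-tuple 'I_n).
Hypothesis hI : sorted leq (map val I).
Local Notation R := (@Rcheck F n m q).
Local Notation Y := (jm (@Rcheck F n m q)).
Local Notation X := (hecke_X rho (@Rcheck F n m q)).
Local Notation eI := (tens_basis F I).

Let hR : hecke_module q R. Proof. exact: (Rcheck_hecke n q0 m). Qed.

(** The default n keeps the colouring monotone and bounded on all natural numbers. *)
Definition colour (i : nat) : nat := if (i < m)%N then nth 0%N (map val I) i else n.

Lemma colourE (i : 'I_m) : colour i = tnth I i.
Proof.
rewrite /colour ltn_ord (tnth_nth (tnth I i)) (nth_map (tnth I i)) // size_tuple.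
exact: ltn_ord.
Qed.

Lemma colour_le (i : nat) : (colour i <= n)%N.
Proof.
rewrite /colour; case: ifP => // h; have := colourE (Ordinal h); rewrite /colour h => ->.
exact/ltnW/ltn_ord.
Qed.

Lemma colour_mono (i j : nat) : (i <= j)%N -> (colour i <= colour j)%N.
Proof.
move=> ij; have [jm|jm] := ltnP j m; last by rewrite [colour j]/colour ltnNge jm colour_le.
rewrite /colour jm (leq_ltn_trans ij jm).
have sz : size (map val I) = m by rewrite size_map size_tuple.
apply: (sorted_leq_nth leq_trans leqnn 0%N hI) => //; rewrite inE sz //.
exact: leq_ltn_trans ij jm.
Qed.

Lemma Rcheck_eI (i : 'I_m.-1) : colour i = colour i.+1 ->
  Rcheck n q i (tens_basis F I) = q *: tens_basis F I.
Proof.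
move=> ci; have ti : tnth I (adj_lo i) = tnth I (adj_hi i).
  by apply: val_inj; rewrite /= -!colourE.
rewrite -(rnE (@Rcheck F n m q)); apply: ev_ext => s ss.
have [|A [a [b [C [es sA]]]]] := @split2 _ s i; first by rewrite ss; have := ltn_ord i; lia.
rewrite es ev_Rcheck // evZ !ev_basis.
have lo (B : seq 'I_n) (a' b' : 'I_n) : (size B = i) -> (B ++ a' :: b' :: C == I) -> a' = b'.
  move=> sB /eqP e; have := tnth_nth a' I (adj_lo i); have := tnth_nth a' I (adj_hi i).
  rewrite -e -ti /= !nth_cat sB ltnn subnn ltnNge leqnSn subSnn /= => -> ->.
  by [].
have [<-|nab] := eqVneq a b; first by rewrite ltnn addr0.
rewrite (_ : (A ++ b :: a :: C == I) = false); last first.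
  by apply/negP => /lo e; case/eqP: nab; rewrite e.
rewrite (_ : (A ++ a :: b :: C == I) = false); last first.
  by apply/negP => /lo e; case/eqP: nab; rewrite e.
by rewrite !mulr0 if_same addr0.
Qed.

Lemma X_invariant x g (i : 'I_m.-1) : colour i = colour i.+1 ->
  X x (g \o rho i)%VF (tens_basis F I) = q *: X x g (tens_basis F I).
Proof.
by move=> ci; rewrite -(hecke_XR q0 hH hR) Rcheck_eI // linearZ.
Qed.

Local Notation c := colour.

Lemma X_vanish T b b' x : col b = col b' -> (row b < row b')%N ->
  c (val T b) = c (val T b') -> X x (f T) eI = 0.
Proof.
move=> ec lr cbb.
have [T' [i [/class_matesP cl ci ecol]]] := column_pair hla colour_mono ec lr cbb.
move: x; apply: (@swap_connected m la hla c (fun T => forall x, X x (f T) eI = 0)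
  colour_mono _ T' T cl) => [U j cj sw hU x|x].
  have [d [d0 _ e]] := ycoord_rho sw.
  have := X_invariant x (f U) cj; rewrite e hecke_XfD !hecke_XfZ hU !scaler0 add0r.
  by move/eqP; rewrite scaler_eq0 (negPf d0) => /eqP.
(* The column gives the eigenvalue - q^-1 and the equal letters give q; they differ because q^4 is
   not 1. *)
have := X_invariant x (f T') ci; rewrite (ycoord_rho_col ecol) hecke_XfZ => /eqP.
by rewrite -subr_eq0 -scalerBl scaler_eq0 subr_eq0 (negPf q2_neqN1) => /eqP.
Qed.

Definition wperm s : m.-tuple 'I_n := [tuple tnth I ((s^-1)%g k) | k < m].

Lemma Rcheck_basis (K : m.-tuple 'I_n) i : (tnth K (adj_lo i) <= tnth K (adj_hi i))%N ->
  exists a, R i (tens_basis F K) =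
    q ^+ a *: tens_basis F [tuple tnth K (adj_tperm i k) | k < m].
Proof.
have [|A0 [al [be [C0 [eK sA0]]]]] := @split2 _ K i; first by rewrite size_tuple; have := ltn_ord i; lia.
have lo : tnth K (adj_lo i) = al.
  by rewrite (tnth_nth al) eK nth_cat /= sA0 ltnn subnn.
have hi : tnth K (adj_hi i) = be.
  by rewrite (tnth_nth al) eK nth_cat /= sA0 ltnNge leqnSn subSnn.
have eK' : [tuple tnth K (adj_tperm i k) | k < m] = A0 ++ be :: al :: C0 :> seq _.
  have sz : size (A0 ++ be :: al :: C0) = m.
    by rewrite -(size_tuple K) [in RHS]eK !size_cat.
  apply: (@eq_from_nth _ al) => [|j]; rewrite size_tuple ?sz // => jm.
  rewrite -[nth _ _ j]/(nth _ _ (Ordinal jm)) -tnth_nth tnth_mktuple (tnth_nth al) val_adj_tperm /=.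
  rewrite eK !nth_cat sA0.
  case: eqP => [->|n1]; first by rewrite ltnn subnn ltnNge leqnSn subSnn.
  case: eqP => [->|n2]; first by rewrite ltnn subnn ltnNge leqnSn subSnn.
  case: ltnP => // ij; have -> : (j - i = (j - i.+2).+2)%N by lia.
  by [].
rewrite lo hi => albe; exists (al == be : nat).
rewrite -(rnE R); apply: ev_ext => s ss.
have [|A [a [b [C [-> sA]]]]] := @split2 _ s i; first by rewrite ss; have := ltn_ord i; lia.
rewrite ev_Rcheck // evZ !ev_basis eK eK' !eqseq_cat ?sA ?sA0 // !eqseq_cons.
case: (A == A0); case: (C == C0); rewrite ?andbF ?mulr0 ?if_same ?addr0 ?mulr0 //= ?andbT.
have [eab|nab] := eqVneq al be.
  rewrite -eab; have [->|n1] := eqVneq a b; first by rewrite ltnn addr0.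
  move: n1; have [->|n2] := eqVneq a al => n1; last by rewrite ?andbF /= !mulr0 if_same addr0.
  by rewrite ?[b == al]eq_sym (negPf n1) /= !mulr0 if_same addr0.
rewrite mul1r; have [->|n1] := eqVneq a b.
  by rewrite ltnn addr0; have [->|] := eqVneq b al; rewrite ?(negPf nab) ?andbF ?mulr0.
case: ltnP => [ba|]; last by rewrite addr0 andbC.
have [ea|_] := eqVneq a al; last by rewrite /= mulr0 addr0 andbC.
have [eb|_] := eqVneq b be; last by rewrite /= mulr0 addr0 andbC.
by move: ba; rewrite ea eb ltnNge albe.
Qed.

(** Since I increases weakly, each generator along a reduced word meets two letters in weakly
    increasing order, and there Rcheck permutes letters up to a power of q. *)
Lemma T_basis s : exists a, hecke_T R s eI = q ^+ a *: tens_basis F (wperm s).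
Proof.
have [N] := ubnP (perm_length s); elim: N s => // N IH s le.
have [/existsP[i desc]|] := boolP [exists i, ((s^-1)%g (adj_hi i) < (s^-1)%g (adj_lo i))%N]; last first.
  rewrite negb_exists => /forallP h.
  have /(congr1 (fun s => s^-1)%g) : s^-1%g = 1%g by apply: perm_no_descent => i; rewrite leqNgt h.
  rewrite invgK invg1 => ->; exists 0%N; rewrite (hecke_T1 q0 hR) scale1r; congr tens_basis.
  by apply: eq_from_tnth => k; rewrite tnth_mktuple invg1 perm1.
have eV : (s * adj_tperm i)^-1%g = (adj_tperm i * s^-1)%g by rewrite invMg adj_tpermV.
have ls : (perm_length (s * adj_tperm i)%g < N)%N.
  by rewrite -perm_lengthV eV -ltnS -(perm_length_descent desc) perm_lengthV.
have [a e] := IH _ ls.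
rewrite -(adj_tpermKr i s) (hecke_T_ascL q0 hR); last first.
  by rewrite eV !permM /adj_tperm tpermL tpermR.
rewrite e linearZ /=.
have [|a' ->] := @Rcheck_basis (wperm (s * adj_tperm i)%g) i.
  rewrite !tnth_mktuple eV !permM /adj_tperm tpermL tpermR.
  by have := colour_mono (ltnW desc); rewrite !colourE.
exists (a + a')%N; rewrite scalerA exprD; congr (_ *: tens_basis _ _).
by apply: eq_from_tnth => k; rewrite !tnth_mktuple adj_tpermKr eV permM /adj_tperm tpermK.
Qed.

Lemma T_basis_stab s : colour_stab c s -> hecke_T R s eI = q ^+ perm_length s *: eI.
Proof.
have [N] := ubnP (perm_length s); elim: N s => // N IH s le hs.
have [/existsP[i desc]|] := boolP [exists i, (s (adj_hi i) < s (adj_lo i))%N]; last first.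
  rewrite negb_exists => /forallP h.
  have -> : s = 1%g by apply: perm_no_descent => i; rewrite leqNgt h.
  by rewrite (hecke_T1 q0 hR) perm_length1 scale1r.
have ci := stab_descent colour_mono hs desc; have ls := perm_length_descent desc.
rewrite -{1}[s](adj_tpermK i) (hecke_T_ascR q0 hR); last first.
  by rewrite !permM /adj_tperm tpermL tpermR.
rewrite (Rcheck_eI ci) linearZ /= IH ?stab_adj //; last by rewrite -ltnS -ls.
by rewrite scalerA ls exprS.
Qed.

Lemma T_basis_coef s : ev (hecke_T R s eI) I = if colour_stab c s then q ^+ perm_length s else 0.
Proof.
case: ifP => [/T_basis_stab->|ns]; first by rewrite evZ ev_basis eqxx mulr1.
have [a ->] := T_basis s; rewrite evZ ev_basis; case: eqP => [e|_]; last by rewrite mulr0.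
case/colour_stabP: ns => k; rewrite !colourE; congr val.
have e' : I = wperm s by apply: val_inj.
by rewrite [in LHS]e' tnth_mktuple permK.
Qed.

Lemma stabV s : colour_stab c s^-1%g = colour_stab c s.
Proof.
have key s' : colour_stab c s' -> colour_stab c s'^-1%g.
  by move/colour_stabP => h; apply/colour_stabP => k; rewrite -{2}[k](permKV s') h.
by apply/idP/idP => [/key|/key //]; rewrite invgK.
Qed.

Lemma X_coef x T : ev (X x (f T) eI) I = psi c T x.
Proof.
rewrite hecke_XE ev_sum /psi (reindex_inj invg_inj) /= [RHS]big_mkcond /=.
apply: eq_bigr => s _; rewrite evZ invgK T_basis_coef stabV perm_lengthV.
by case: ifP => _; rewrite ?mulr0 // mulrC.
Qed.

Lemma psi_v_neq0 T : (forall b b', col b = col b' -> (row b < row b')%N ->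
    c (val T b) <> c (val T b')) -> psi c T (v T) != 0.
Proof.
move=> good; have [x nz] := psi_neq0 colour_mono colour_le good.
apply: contra_neq nz => z; apply: (young_lin_eq0 (psi_lin c T)) => T1.
apply/eqP; apply: contraT => nz; have cl := psi_support colour_mono nz.
case/eqP: nz; apply: (invariant_class colour_mono (psi_lin c T) (psi_invariant T) cl z).
Qed.

Variables (qh : F) (hqh : qh ^+ 2 = q).

Lemma jm_rword U j : (j < m)%N ->
  jm rho j (v U) = q ^ (2 * rcontent (rword hla U) j) *: v U.
Proof.
move=> jm; rewrite -[j]/(val (Ordinal jm)) -(tbK hla U (Ordinal jm)).
by rewrite rcontent_rword jm_v.
Qed.

Lemma X_eigen U j g x : (j < m)%N ->
  Y j (X (v U) g x) = q ^ (2 * rcontent (rword hla U) j) *: X (v U) g x.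
Proof. by move=> jm; rewrite (hecke_X_jmL q0 hH hR) jm_rword // hecke_XvZ. Qed.

Lemma X_kill U j x y : (j < m)%N -> X x (f U) (ysh n q m (rword hla U) j y) = 0.
Proof.
move=> lj; rewrite yshE linearB linearZ /= (hecke_X_jmR q0 hH hR).
have -> : (f U \o jm rho j)%VF = q ^ (2 * rcontent (rword hla U) j) *: f U.
  apply/lfunP => z; rewrite comp_lfunE scale_lfunE.
  rewrite -[j]/(val (Ordinal lj)) -(tbK hla U (Ordinal lj)).
  by rewrite rcontent_rword ycoord_jm.
by rewrite hecke_XfZ subrr.
Qed.

Lemma hecke_T_commute (h : 'End(tens F n m)) : (forall i x, h (R i x) = R i (h x)) ->
  forall s x, h (hecke_T R s x) = hecke_T R s (h x).
Proof.
move=> hh s x; rewrite /hecke_T; elim: (reduced_word s) => [|i w IH] /=.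
  by rewrite !id_lfunE.
by rewrite !comp_lfunE hh IH.
Qed.

Lemma X_commute (h : 'End(tens F n m)) x g : (forall i x, h (R i x) = R i (h x)) ->
  forall y, X x g (h y) = h (X x g y).
Proof.
move=> hh y; rewrite !hecke_XE linear_sum; apply: eq_bigr => s _.
by rewrite linearZ /= hecke_T_commute.
Qed.

Lemma X_hom k x g : Uq_hom qh k (X x g).
Proof.
split=> i ik y; apply: X_commute => j z; rewrite -!(rnE R).
- exact: (E_rn q0 hqh).
- exact: (F_rn q0 hqh).
- exact: K_Rcheck.
- exact: K_Rcheck.
Qed.

Section Level.
Variable k : nat.
Local Notation p := (cut I k).
Local Notation B := (drop (cut I k) I).

Lemma size_cut : (p + size B)%N = m.
Proof. by rewrite size_drop size_tuple subnKC ?cut_le. Qed.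

Lemma drop_cut : all (fun l : 'I_n => (k <= l)%N) B.
Proof.
apply/allP => l /(nthP l)[j]; rewrite size_drop size_tuple nth_drop => lj <-.
have jm : (p + j < m)%N by move: lj (cut_le I k); clear; lia.
by rewrite -[nth _ _ _](tnth_nth l I (Ordinal jm)) leqNgt (lt_cut hI) /= -leqNgt leq_addr.
Qed.

Lemma take_cut : all (fun l : 'I_n => (l < k)%N) (take p I).
Proof.
apply/allP => l /(nthP l)[j]; rewrite size_takel ?size_tuple ?cut_le // => lj.
rewrite nth_take // => <-; have jm := leq_trans lj (cut_le I k).
by rewrite -[nth _ _ _](tnth_nth l I (Ordinal jm)) (lt_cut hI).
Qed.

Let lat U : rlattice (rword hla U) p.
Proof. by move=> p' lp; apply: rword_lattice; apply: leq_trans lp (cut_le I k). Qed.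

Lemma X_isotypic U x : in_isotypic qh k (rshape (rword hla U) p) (X x (f U) eI).
Proof.
pose y0 : tens F n p := slice F m p B eI.
have eIE : append F m p B y0 = eI.
  apply: ev_ext => s ss; have [s1 [s2 [-> s1s]]] := size_split size_cut ss.
  rewrite ev_append ?size_cut // (ev_slice size_cut) !ev_basis; case: eqP => [->//|ne].
  by case: eqP => // e; case: ne; rewrite -e drop_size_cat.
have small0 : small k y0.
  move=> s; rewrite (ev_slice size_cut) ev_basis; case: (s ++ B =P I) => [e _|_]; last by rewrite eqxx.
  have -> : s = take p I; last exact: take_cut.
  rewrite -e take_size_cat //; have := congr1 size e.
  by rewrite size_cat size_tuple -{3}size_cut => /addIn.
(* The first p letters of I may be replaced by their component g in the joint generalized
   eigenspace, as [X x (f U)] kills the images of the shifted operators. *)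
have [g [gG [z ez]]] := @fitting _ _ _ q0 k p (rword hla U) p y0 small0.
have -> : X x (f U) eI = X x (f U) (append F m p B g).
  apply/eqP; rewrite -subr_eq0 -eIE -linearB -linearB /= ez !linear_sum big1 // => j _.
  rewrite ypowE /gexp iterS yshE linearB linearZ /= append_jm ?size_cut //.
  by rewrite -(yshE q (rword hla U)) X_kill // (leq_trans (ltn_ord j)) ?cut_le.
apply: in_isotypic_img (X_hom _ _ _) _.
apply: in_isotypic_img (append_hom size_cut qh drop_cut) _.
have [g0|nz] := eqVneq (G n q k p (rword hla U)) 0%VS.
  by move: gG; rewrite -/(G n q k p _) g0 memv0 => /eqP->; apply: in_isotypic0.
exact: in_isotypic_simple (G_simple q0 hq hqh (lat U) nz) gG.
Qed.

End Level.

(** * The line prescribed by a semistandard filling *)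

Section Line.

Variable T : syt la m.
Hypothesis hT : is_ssyt (theta I T).
Local Notation w := (X (v T) (f T) eI).
Local Notation psiT := (psi c T).

Lemma ssyt_col b b' : col b = col b' -> (row b < row b')%N -> (c (val T b) < c (val T b'))%N.
Proof.
case/andP: hT => _ /forallP/(_ b)/forallP/(_ b')/implyP h ec lr.
by have := h; rewrite ec eqxx lr !ffunE -!colourE; apply.
Qed.

Let good b b' : col b = col b' -> (row b < row b')%N -> c (val T b) <> c (val T b').
Proof. by move=> ec lr e; have := ssyt_col ec lr; rewrite e ltnn. Qed.

Lemma ssyt_row b : (row b <= c (val T b))%N.
Proof.
have [i] := ubnP (row b); elim: i b => // i IH b; rewrite ltnS => lb.
case: (posnP (row b)) => [->//|pos].
have [|z [rz cz]] := @box_below m la hla (row b).-1 (col b) b _ (leqnn _); first exact: leq_pred.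
have zb : (row z < row b)%N by rewrite rz prednK.
apply: leq_trans (ssyt_col cz zb); rewrite -(prednK pos) -rz ltnS.
by apply: IH; apply: leq_trans zb lb.
Qed.

Lemma psiT_neq0 : psiT (v T) != 0.
Proof. exact: (psi_v_neq0 good). Qed.

Lemma w_coef : ev w I = psiT (v T).
Proof. exact: X_coef. Qed.

Definition isotypics (x : tens F n m) :=
  forall k, (0 < k <= n)%N -> in_isotypic qh k (gt_pattern (theta I T) k) x.

Lemma isotypics_w x : isotypics (X x (f T) eI).
Proof.
move=> k _; apply: in_isotypic_ext (X_isotypic k T x) => i ik.
by rewrite (gt_patternE hla hI).
Qed.

Lemma eigen_line (x : tens F n m) : jm_eigenvector q R T x <->
  forall j, (j < m)%N -> Y j x = q ^ (2 * rcontent (rword hla T) j) *: x.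
Proof.
split=> h => [j jm|b].
  rewrite -[j]/(val (Ordinal jm)) -(tbK hla T (Ordinal jm)) rcontent_rword.
  by rewrite -(jucys_murphyE q0 hR) h.
by rewrite (jucys_murphyE q0 hR) h ?rcontent_rword.
Qed.

Lemma w_line : in_xi_line qh q (theta I T) T w.
Proof.
split; last exact: isotypics_w.
by apply/eigen_line => j jm; apply: X_eigen.
Qed.

Lemma line_scale a x : in_xi_line qh q (theta I T) T x -> in_xi_line qh q (theta I T) T (a *: x).
Proof.
move=> [h1 h2]; split=> [b|k hk]; last by apply: in_isotypicZ; apply: h2.
by rewrite linearZ /= h1 !scalerA mulrC.
Qed.

(** The isotypic conditions fix the number of letters below each k. The vector w satisfies them and
    has I in its support. *)
Lemma isotypics_support x K : isotypics x -> ev x K != 0 -> perm_eq K I.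
Proof.
move=> hx nz; pose low k := count (fun l : 'I_n => (l < k)%N).
have nzw : ev w I != 0 by rewrite w_coef psiT_neq0.
have e k : (k <= n)%N -> low k K = low k I.
  case: k => [|k] kn; first by rewrite /low !count_pred0.
  rewrite /low (isotypic_low q0 hq hqh (hx _ _) nz) //.
  by rewrite (isotypic_low q0 hq hqh (isotypics_w _ _) nzw).
have lowS (i : 'I_n) (s : seq 'I_n) : low i.+1 s = (low i s + count_mem i s)%N.
  elim: s => //= l s ->; rewrite ltnS leq_eqVlt -val_eqE /=.
  by case: ltngtP => _ /=; clear; lia.
apply/allP => i _ /=; have := lowS i K; rewrite e // lowS e 1?ltnW // => /addnI->.
exact: eqxx.
Qed.

Local Notation Gn := (G n q n m (rword hla T)).
Let lat U : rlattice (rword hla U) m. Proof. exact: rword_lattice. Qed.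

Let small_all (x : tens F n m) : small n x.
Proof. by move=> s _; apply/allP => l _; apply: ltn_ord. Qed.

(** The scalar comes from Schur's lemma. It is non-zero because w, which does not vanish, is also
    the image of the component of e_I in Gn. *)
Lemma X_scalar : exists2 s : F, s != 0 & forall g, g \in Gn -> X (v T) (f T) g = s *: g.
Proof.
have XG x : X (v T) (f T) x \in Gn.
  by apply: eigen_in_G => // j jm; apply: X_eigen.
have nzw : w != 0 by have := psiT_neq0; rewrite -w_coef; apply: contra_neq => ->; rewrite ev0.
have nzG : Gn != 0%VS.
  by apply: contra_neq nzw => e; apply/eqP; rewrite -memv0 -e XG.
have [s hs] : exists s : F, forall g, g \in Gn -> X (v T) (f T) g = s *: g.
  apply: (G_scalar q0 hq hqh (lat T) nzG) => // h hh x.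
  have [hE hF hK hKV] := X_hom n (v T) (f T).
  by case: hh => i ik; rewrite ?hE ?hF ?hK ?hKV.
exists s => //; apply: contra_neq nzw => s0.
have [g [gG [z ez]]] := @fitting _ _ _ q0 n m (rword hla T) m eI (@small_all _).
have -> : w = X (v T) (f T) g.
  apply/eqP; rewrite -subr_eq0 -linearB /= ez linear_sum big1 // => j _.
  by rewrite ypowE /gexp iterS -[LHS]/(X (v T) (f T) _) X_kill.
by rewrite hs // s0 scale0r.
Qed.

(** Both sets of boxes have the same size, so one inclusion suffices. *)
Lemma class_card U k : (forall b, (val T b < cut I k)%N -> (val U b < cut I k)%N) ->
  forall b, (val T b < cut I k)%N = (val U b < cut I k)%N.
Proof.
move=> h; pose A (U : syt la m) := [set b | (val U b < cut I k)%N].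
have cA (W : syt la m) : #|A W| = #|[set i : 'I_m | (i < cut I k)%N]|.
  rewrite -(card_imset (A W) (@syt_inj _ _ W)); apply: eq_card => i; rewrite inE.
  apply/imsetP/idP => [[b + ->]|hi]; first by rewrite inE.
  by exists (tb hla W i); rewrite ?inE tbK.
have /subset_cardP e : A T \subset A U by apply/subsetP => b; rewrite !inE; apply: h.
by move=> b; have := e (etrans (cA T) (esym (cA U))) b; rewrite !inE.
Qed.

Lemma dot_basis_ev (x : tens F n m) : dot x eI = ev x I.
Proof. by rewrite dot_basis ev_tuple. Qed.

(* The component of x along the letters >= k of I lies in the simple module
   attached to U|_(cut k), whose highest weight is the shape of U|_(cut k). *)
Lemma slice_shape U x k : (forall j, (j < m)%N ->
    Y j x = q ^ (2 * rcontent (rword hla U) j) *: x) -> isotypics x -> ev x I != 0 ->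
  (0 < k <= n)%N -> forall i : 'I_n, (i < k)%N ->
  rshape (rword hla T) (cut I k) i = rshape (rword hla U) (cut I k) i.
Proof.
move=> ex ix nz hk i ik; pose p := cut I k; pose B := drop p I.
have sB : (p + size B)%N = m := size_cut k.
pose y := slice F m p B x; pose Gp := G n q k p (rword hla U).
have nzy : y != 0.
  by apply: contra_neq nz => e; rewrite -[tval I](cat_take_drop p) -(ev_slice sB) -/y e ev0.
have latp : rlattice (rword hla U) p.
  by move=> p' lp; apply: rword_lattice; apply: leq_trans lp (cut_le I k).
have yG : y \in Gp.
  apply: eigen_in_G => [s|j jp].
    rewrite (ev_slice sB) => /(isotypics_support ix).
    rewrite -[X in perm_eq _ X](cat_take_drop p) perm_cat2r perm_sym => pe.
    exact: (small_perm pe) (take_cut k).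
  rewrite -(slice_jm sB) // ex ?linearZ //.
  exact: leq_trans jp (cut_le I k).
have nzG : Gp != 0%VS by apply: contra_neq nzy => e; apply/eqP; rewrite -memv0 -e.
have [simG _] := G_simple q0 hq hqh latp nzG.
have iy : in_isotypic qh k (gt_pattern (theta I T) k) y.
  exact: in_isotypic_img (slice_hom sB qh (drop_cut k)) (ix k hk).
have [u uG [nu0 Eu Ku]] := simple_in_isotypic simG (ex_intro2 _ _ y yG (conj nzy iy)).
rewrite -(gt_patternE hla hI); apply: (hwv_shape_G q0 hq hqh latp uG nu0) => //.
split=> //; first by have /memGt[] := uG.
exact: (K_eigen_weight q0 hq hqh Ku).
Qed.

Lemma line_uniq x : in_xi_line qh q (theta I T) T x -> exists a, x = a *: w.
Proof.
move=> [/eigen_line ex ix]; have [s s0 hs] := X_scalar.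
(* Normalized by the scalar of [X_scalar] so that v_T goes to x. *)
pose Phi u := s^-1 *: X u (f T) x.
have PhiT : Phi (v T) = x by rewrite /Phi hs ?scalerA ?mulVf ?scale1r //; apply: eigen_in_G.
have iPhi u : isotypics (Phi u).
  move=> k hk; apply: in_isotypicZ; apply: in_isotypic_img (ix k hk).
  exact: X_hom.
have PhiR i u : R i (Phi u) = Phi (rho i u).
  by rewrite /Phi linearZ /= (hecke_XL q0 hH hR).
have PhiL : forall a u u', Phi (a *: u + u') = a *: Phi u + Phi u'.
  by move=> a u u'; rewrite /Phi hecke_XvD hecke_XvZ scalerDr !scalerA mulrC.
pose phi u := ev (Phi u) I.
have phi_class U : phi (v U) != 0 -> forall b, c (val T b) = c (val U b).
  move=> nz b; rewrite !colourE; congr val; apply: (theta_eq hI) => k kn {}b.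
  case: (posnP k) => [->|k0].
    by rewrite (_ : cut I 0 = 0%N) ?ltn0 // /cut (eq_count (a2 := pred0)) ?count_pred0.
  apply: class_card => {}b lb; have hk : (0 < k <= n)%N by rewrite k0.
  (* Semistandardness puts the boxes with letters below k into the first k rows, the only ones in
     which [slice_shape] compares shapes. *)
  have lk : (row b < k)%N by apply: leq_ltn_trans (ssyt_row b) _; rewrite colourE (lt_cut hI).
  have PhiE j : (j < m)%N -> Y j (Phi (v U)) = q ^ (2 * rcontent (rword hla U) j) *: Phi (v U).
    by move=> jm; rewrite /Phi linearZ /= X_eigen // !scalerA mulrC.
  have kr : (row b < n)%N by case/andP: hk => _; apply: leq_trans.
  have := @slice_shape U _ k PhiE (iPhi _) nz hk (Ordinal kr) lk.
  by move: lb; rewrite !(lt_rshape hla) ?cut_le //= => h <-.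
(* Both functionals are invariant and vanish on the basis vectors outside the class of T; the
   constant a makes the difference vanish at v_T, hence everywhere. *)
pose a := phi (v T) / psiT (v T); pose chi u := phi u - a * psiT u.
have phiL : linear (phi : V -> F^o) by move=> b u u'; rewrite /phi PhiL evD evZ.
have psiL := psi_lin c T.
have chiL : linear (chi : V -> F^o).
  move=> b u u'; rewrite /chi phiL psiL.
  have -> : b *: (phi u - a * psiT u : F^o) = b * (phi u - a * psiT u) by [].
  have -> : b *: (phi u : F^o) = b * phi u by [].
  have -> : b *: (psiT u : F^o) = b * psiT u by [].
  by ring.
have chiR : c_invariant c chi.
  move=> i ci u; rewrite /chi (psi_invariant T ci) /phi -PhiR.
  have -> : ev (R i (Phi u)) I = q * ev (Phi u) I.
    by rewrite -!dot_basis_ev adjoint_Rcheck (Rcheck_eI ci) dotZr.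
  by ring.
have chi0 : forall u, chi u = 0.
  apply: (young_lin_eq0 chiL) => U.
  have chiT : chi (v T) = 0 by rewrite /chi /a mulfVK ?subrr // psiT_neq0.
  have [e|/phi_class cl] := eqVneq (phi (v U)) 0; last first.
    exact: (invariant_class colour_mono chiL chiR cl chiT).
  have [e'|nz] := eqVneq (psiT (v U)) 0; first by rewrite /chi e e' mulr0 subrr.
  have cl := psi_support colour_mono nz.
  exact: (invariant_class colour_mono chiL chiR cl chiT).
exists a; apply/eqP; rewrite -subr_eq0; apply/eqP.
(* All values of [Psi] are orthogonal to e_I. As [Psi] is equivariant and the generators are
   self-adjoint, they are orthogonal to every T_s e_I, that is, to every rearrangement of I, and
   nothing else occurs in their support. *)
pose Psi u := Phi u - a *: X u (f T) eI.
have PsiR i u : R i (Psi u) = Psi (rho i u).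
  by rewrite /Psi linearB /= PhiR linearZ /= (hecke_XL q0 hH hR).
have PsiI u : dot (Psi u) eI = 0.
  by rewrite dot_basis_ev evD evN [X in _ - X]evZ X_coef; apply: chi0.
have PsiK s' u : dot (Psi u) (hecke_T R s' eI) = 0.
  rewrite /hecke_T; elim: (reduced_word s') u => [|i l IH] u /=; first by rewrite id_lfunE.
  by rewrite comp_lfunE -adjoint_Rcheck PsiR IH.
have -> : x - a *: w = Psi (v T) by rewrite /Psi PhiT.
apply: ev_ext => K sK; rewrite ev0; apply/eqP; apply: contraT => nz.
have pK : perm_eq K I.
  move: nz; rewrite evD evN [X in _ - X]evZ; have [e|nz' _] := eqVneq (ev (Phi (v T)) K) 0; last first.
    exact: isotypics_support (iPhi _) nz'.
  rewrite e sub0r oppr_eq0 mulf_eq0 negb_or => /andP[_].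
  exact/isotypics_support/isotypics_w.
have [p eK] := tuple_permP pK.
have eW : wperm p^-1%g = K :> seq _.
  by rewrite eK; congr tval; apply: eq_from_tnth => i; rewrite !tnth_mktuple invgK.
have [b e] := T_basis p^-1%g.
have := PsiK p^-1%g (v T); rewrite e dotZr dot_basis -ev_tuple eW => /eqP.
by rewrite mulf_eq0 expf_eq0 (negPf q0) andbF (negPf nz).
Qed.

End Line.

(** * The action of the idempotent *)

Variable T : syt la m.

Lemma young_idempotentE x : hecke_act (@Rcheck F n m q) (young_idempotent q rho v T) x =
  (c_la q la)^-1 *: X (v T) (f T) x.
Proof.
rewrite hecke_XE /hecke_act sum_lfunE scaler_sumr; apply: eq_bigr => s _.
by rewrite scale_lfunE scalerA /young_idempotent ycoordE.
Qed.

Lemma not_ssyt : ~~ is_ssyt (theta I T) -> exists b b' : box la,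
  [/\ box_col b = box_col b', (box_row b < box_row b')%N &
      c (val T b) = c (val T b')].
Proof.
rewrite /is_ssyt (_ : rows_rel _ _) /=; last first.
  apply/forallP => b; apply/forallP => b'; apply/implyP => /andP[/eqP er lc].
  by rewrite !ffunE -!colourE; apply/colour_mono/ltnW/syt_row.
case/forallPn => b /forallPn[b']; rewrite negb_imply => /andP[/andP[/eqP ec lr]].
rewrite !ffunE -!colourE -leqNgt => le; exists b, b'; split=> //.
by apply/eqP; rewrite eqn_leq le andbT; apply/colour_mono/ltnW/syt_col.
Qed.

Theorem idempotent_action :
  let w := hecke_act (@Rcheck F n m q) (young_idempotent q rho v T) (tens_basis F I) in
  if is_ssyt (theta I T)
  then (exists x, is_xi_tensor_v qh q (theta I T) T x) /\
       (forall x, is_xi_tensor_v qh q (theta I T) T x ->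
          exists2 c : F, c != 0 & w = c *: x)
  else w = 0.
Proof.
rewrite /= young_idempotentE; set w := hecke_X _ _ _ _ _; have c0 := c_la_neq0 la q0 hq.
case: ifPn => [hT|/not_ssyt[b [b' [ec lr e]]]]; last first.
  by rewrite /w (X_vanish _ ec lr e) scaler0.
have nzw : w != 0.
  have := psiT_neq0 hT; rewrite -w_coef.
  by apply: contra_neq; rewrite -/w => ->; rewrite ev0.
have lw := w_line T.
split.
  exists w; split=> // x; split=> [|[a ->]]; last exact: line_scale lw.
  exact: (line_uniq hT).
move=> x [nzx lx]; have [a ea] := (lx w).1 lw.
exists ((c_la q la)^-1 * a); last by rewrite ea scalerA.
rewrite mulf_neq0 ?invr_eq0 //; apply: contra_neq nzw => a0.
by rewrite ea a0 scale0r.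
Qed.

End Multiset.
End YoungModule.

(* Loaded last: the notation R[i] of complex captures views such as /existsP[i]. *)
From mathcomp Require Import reals complex.

Theorem lemma3p7 (R : realType) (q qh : R[i])
    (hq0 : q != 0) (hq : forall k : nat, (0 < k)%N -> q ^+ k != 1)
    (hqh : qh ^+ 2 = q)
    (n m : nat) (hn : (1 <= n)%N) (hm : (1 <= m)%N)
    (la : seq nat) (hla : is_partition_of m la)
    (V : vectType R[i]) (rho : 'I_m.-1 -> 'End(V)) (v : syt la m -> V)
    (hV : young_module q rho v)
    (T : syt la m)
    (I : m.-tuple 'I_n) (hI : sorted leq (map val I)) :
  let w := hecke_act (@Rcheck R[i] n m q) (young_idempotent q rho v T)
             (tens_basis R[i] I) in
  if is_ssyt (theta I T)
  then (exists x, is_xi_tensor_v qh q (theta I T) T x) /\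
       (forall x, is_xi_tensor_v qh q (theta I T) T x ->
          exists2 c : R[i], c != 0 & w = c *: x)
  else w = 0.
Proof. exact: (idempotent_action hq0 hq hla hV hI hqh T). Qed.
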